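(* A state $\rho$ is quantum Schnorr random if and only if for every computable measure machine $C$, every $\epsilon>0$ and every $d$, there is $n_0$ such that $QK^{\epsilon}_C(\rho_n)>n+d$ for all $n\ge n_0$.
   Context: A computable measure machine is a prefix-free Turing machine $C$ whose domain has computable Lebesgue measure $\sum_{\pi\in\operatorname{dom}(C)}2^{-|\pi|}$. Outputs of machines are interpreted as finite sets of vectors with complex algebraic entries via a fixed canonical effective indexing; $C(\pi)\downarrow=F$ means $C$ on input $\pi$ halts with output the code of $F$. $\mathbb{C}^{2^n}_{alg}$ denotes the vectors in $\mathbb{C}^{2^n}$ with complex algebraic entries. Logarithms are base 2. For a density matrix $\tau$ on $\mathbb{C}^{2^n}$ write $|\tau|=n$, and for $\epsilon>0$ define $QK^{\epsilon}_C(\tau)=\inf\{|\pi|+\log|F| : C(\pi)\downarrow=F,\ F \text{ an orthonormal subset of } \mathbb{C}^{2^{|\tau|}}_{alg},\ \sum_{v\in F}\langle v|\tau|v\rangle>\epsilon\}$, with $\inf\emptyset=\infty$. A state is a sequence $\rho=(\rho_n)_{n\in\mathbb{N}}$ of density matrices $\rho_n$ on $\mathbb{C}^{2^n}$ such that the partial trace of $\rho_n$ over the last qubit equals $\rho_{n-1}$. A special projection is a Hermitian projection matrix with complex algebraic entries. For a special projection $S$ on $\mathbb{C}^{2^n}$ put $\tau(S)=2^{-n}\operatorname{Tr}(S)$ and $\rho(S)=\operatorname{Tr}(\rho_nS)$. A strong Solovay test is a computable sequence $(S^m)_m$ of special projections with $\sum_m\tau(S^m)<\infty$; $\rho$ fails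 it at level $\epsilon>0$ if $\rho(S^m)>\epsilon$ for infinitely many $m$, and passes it if it fails it at no level $\epsilon>0$. A quantum Schnorr test is a strong Solovay test $(S^m)_m$ such that $\sum_m\tau(S^m)$ is a computable real number. A state is quantum Schnorr random if it passes every quantum Schnorr test. *)

(* Defs.v *)
From mathcomp Require Import all_boot all_order all_algebra.
From mathcomp Require Import all_classical all_reals all_analysis.
From mathcomp Require Import complex.
From mathcomp Require Import Rstruct.
Set Implicit Arguments.
Unset Strict Implicit.
Unset Printing Implicit Defensive.
Import Order.TTheory GRing.Theory Num.Theory numFieldNormedType.Exports.
Local Open Scope classical_set_scope.
Local Open Scope ring_scope.
Local Open Scope complex_scope.

Definition Rl : realType := Rdefinitions.R.
Definition Cx : numClosedFieldType := Rl[i].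

(* A model of computation: partial recursive functions nat -> nat built from  *)
(* the Cantor pairing function (a standard Turing-complete basis).            *)
Definition cpair (x y : nat) : nat := ((x + y) * (x + y).+1) %/ 2 + y.

Inductive prf : Type :=
| PZero | PSucc | PId | PFst | PSnd
| PComp of prf & prf
| PPair of prf & prf
| PRec of prf & prf
| PMu of prf.

Inductive eval : prf -> nat -> nat -> Prop :=
| eval_zero x : eval PZero x 0
| eval_succ x : eval PSucc x x.+1
| eval_id x : eval PId x x
| eval_fst x y : eval PFst (cpair x y) x
| eval_snd x y : eval PSnd (cpair x y) y
| eval_comp f g x y z : eval g x y -> eval f y z -> eval (PComp f g) x z
| eval_pair f g x y z : eval f x y -> eval g x z -> eval (PPair f g) x (cpair y z)
| eval_rec0 f g x y : eval f x y -> eval (PRec f g) (cpair x 0) y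
| eval_recS f g x n y z : eval (PRec f g) (cpair x n) y ->
    eval g (cpair x (cpair n y)) z -> eval (PRec f g) (cpair x n.+1) z
| eval_mu f x n : eval f (cpair x n) 0 ->
    (forall k, (k < n)%N -> exists v, eval f (cpair x k) v.+1) ->
    eval (PMu f) x n.

(* Effective decoding of natural numbers into finite data (mathcomp's
   countType coding, which is given by Coq-definable, hence computable,
   functions). *)
Definition dec_rat (m : nat) : option rat := unpickle m.

Definition computable_real (x : Rl) : Prop :=
  exists c : prf, forall n : nat, exists m q,
    eval c n m /\ dec_rat m = Some q /\ `|ratr q - x| <= 2 ^- n.

(* A bijection {0,1}^* -> nat. *)
Fixpoint nat_of_bits (s : seq bool) : nat :=
  match s with
  | [::] => 0
  | b :: s' => (nat_of_bits s').*2 + (b : nat) + 1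
  end.

Definition mrun (c : prf) (pi : seq bool) (y : nat) : Prop :=
  eval c (nat_of_bits pi) y.

Definition mdom (c : prf) : set (seq bool) := [set pi | exists y, mrun c pi y].

Definition prefix_free_machine (c : prf) : Prop :=
  forall p q, mdom c p -> mdom c q -> prefix p q -> p = q.

Definition dom_measure (c : prf) : Rl :=
  limn (series (fun L : nat =>
    \sum_(p : L.-tuple bool)
       (if asbool (mdom c (tval p)) then (2 : Rl) ^- L else 0))).

Definition computable_measure_machine (c : prf) : Prop :=
  prefix_free_machine c /\ computable_real (dom_measure c).

(* An algebraic number is coded by (p, (a, b, c, d)): p a nonzero polynomial  *)
(* with rational coefficients (constant term first) and an open rational box  *)
(* (a,b) x (c,d) in which z is the unique root of p.                          *)
Definition alg_code := (seq rat * (rat * rat * rat * rat))%type.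
Definition alg_code0 : alg_code := ([::], (0, 0, 0, 0)).

Definition in_box (bx : rat * rat * rat * rat) (z : Cx) : Prop :=
  let: (a, b, c, d) := bx in
  [/\ ratr a < 'Re z, 'Re z < ratr b, ratr c < 'Im z & 'Im z < ratr d].

Definition peval (p : seq rat) (z : Cx) : Cx :=
  \sum_(i < size p) ratr p`_i * z ^+ i.

Definition alg_denote (a : alg_code) (z : Cx) : Prop :=
  let: (p, bx) := a in
  [/\ has (fun q => q != 0) p, peval p z = 0, in_box bx z &
      forall w, peval p w = 0 -> in_box bx w -> w = z].

Definition vec_denote (cs : seq alg_code) (v : seq Cx) : Prop :=
  size cs = size v /\
  forall i, (i < size cs)%N -> alg_denote (nth alg_code0 cs i) (nth 0 v i).

Definition set_denote (k : nat) (F : seq (seq Cx)) : Prop :=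
  exists (css : seq (seq alg_code)) (vs : seq (seq Cx)),
    unpickle k = Some css /\ size css = size vs /\
    (forall i, (i < size css)%N -> vec_denote (nth [::] css i) (nth [::] vs i)) /\
    F = undup vs.

Definition mx_denote (k : nat) (n : nat) (S : 'M[Cx]_(2 ^ n)) : Prop :=
  exists es : seq alg_code,
    unpickle k = Some (n, es) /\ size es = (2 ^ n * 2 ^ n)%N /\
    forall i j : 'I_(2 ^ n), alg_denote (nth alg_code0 es (i * 2 ^ n + j)) (S i j).

Definition adjmx (m n : nat) (A : 'M[Cx]_(m, n)) : 'M[Cx]_(n, m) :=
  map_mx Num.conj (A^T).

Definition density (n : nat) (A : 'M[Cx]_(2 ^ n)) : Prop :=
  [/\ adjmx A = A,
      (forall v : 'cV[Cx]_(2 ^ n), 0 <= (adjmx v *m A *m v) 0 0) &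
      \tr A = 1].

Definition mx_at (m : nat) (A : 'M[Cx]_m) (i j : nat) : Cx :=
  match insub i, insub j with
  | Some i', Some j' => A i' j'
  | _, _ => 0
  end.

(* Partial trace over the last qubit: C^(2^(n+1)) = C^(2^n) (x) C^2,
   basis index 2a + b with b the last qubit. *)
Definition ptrace_last (n : nat) (A : 'M[Cx]_(2 ^ n.+1)) : 'M[Cx]_(2 ^ n) :=
  \matrix_(i, j) \sum_(b < 2) mx_at A ((i : nat).*2 + b) ((j : nat).*2 + b).

Definition is_state (rho : forall n : nat, 'M[Cx]_(2 ^ n)) : Prop :=
  (forall n, density (rho n)) /\ (forall n, ptrace_last (rho n.+1) = rho n).

Definition special_projection (n : nat) (S : 'M[Cx]_(2 ^ n)) : Prop :=
  adjmx S = S /\ S *m S = S.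
(* (Algebraicity of the entries is built into mx_denote below.) *)

Definition tauS (n : nat) (S : 'M[Cx]_(2 ^ n)) : Rl :=
  (2 : Rl) ^- n * complex.Re (\tr S).

Definition rhoS (rho : forall n : nat, 'M[Cx]_(2 ^ n)) (n : nat)
  (S : 'M[Cx]_(2 ^ n)) : Cx := \tr (rho n *m S).

Definition computable_proj_seq (dim : nat -> nat)
  (S : forall m, 'M[Cx]_(2 ^ dim m)) : Prop :=
  (forall m, special_projection (S m)) /\
  exists c : prf, forall m, exists k, eval c m k /\ mx_denote k (S m).

Definition strong_Solovay_test (dim : nat -> nat)
  (S : forall m, 'M[Cx]_(2 ^ dim m)) : Prop :=
  computable_proj_seq S /\ cvgn (series (fun m => tauS (S m))).

Definition quantum_Schnorr_test (dim : nat -> nat)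
  (S : forall m, 'M[Cx]_(2 ^ dim m)) : Prop :=
  strong_Solovay_test S /\
  computable_real (limn (series (fun m => tauS (S m)))).

Definition fails_at_level (rho : forall n : nat, 'M[Cx]_(2 ^ n))
  (dim : nat -> nat) (S : forall m, 'M[Cx]_(2 ^ dim m)) (eps : Rl) : Prop :=
  forall M : nat, exists m, (M <= m)%N /\ (eps%:C < rhoS rho (S m))%R.

Definition passes (rho : forall n : nat, 'M[Cx]_(2 ^ n))
  (dim : nat -> nat) (S : forall m, 'M[Cx]_(2 ^ dim m)) : Prop :=
  forall eps : Rl, 0 < eps -> ~ fails_at_level rho S eps.

Definition quantum_Schnorr_random (rho : forall n : nat, 'M[Cx]_(2 ^ n)) : Prop :=
  forall (dim : nat -> nat) (S : forall m, 'M[Cx]_(2 ^ dim m)),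
    quantum_Schnorr_test S -> passes rho S.

Definition log2 (x : Rl) : Rl := ln x / ln 2.

Definition inner (n : nat) (v w : seq Cx) : Cx :=
  \sum_(i < 2 ^ n) Num.conj (nth 0 v i) * nth 0 w i.

Definition orthonormal (n : nat) (F : seq (seq Cx)) : Prop :=
  (forall v, v \in F -> size v = (2 ^ n)%N) /\
  (forall v w, v \in F -> w \in F -> inner n v w = (v == w)%:R).

Definition expval (n : nat) (tau : 'M[Cx]_(2 ^ n)) (v : seq Cx) : Cx :=
  \sum_(i < 2 ^ n) \sum_(j < 2 ^ n) Num.conj (nth 0 v i) * tau i j * nth 0 v j.

Definition QK (n : nat) (c : prf) (eps : Rl) (tau : 'M[Cx]_(2 ^ n)) : \bar Rl :=
  ereal_inf [set x : \bar Rl | exists (pi : seq bool) (k : nat) (F : seq (seq Cx)),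
     [/\ mrun c pi k, set_denote k F, orthonormal n F,
         (eps%:C < \sum_(v <- F) expval tau v)%R &
         x = ((size pi)%:R + log2 (size F)%:R)%:E]].

(* Main.v *)
Require Import Defs.
From mathcomp Require Import all_boot all_order all_algebra all_fingroup.
From mathcomp Require Import zify ring lra.
From Stdlib Require Import Classical.
Set Implicit Arguments.
Unset Strict Implicit.
Unset Printing Implicit Defensive.

(** A machine of computable measure has a decidable domain, since enumerating it
    until the weight found is within [2 ^- |pi|] of its measure settles whether [pi]
    belongs to it. If it describes on input [pi] an orthonormal set [F], approximate
    the members of [F] by Gaussian rational vectors and run Gram-Schmidt, discarding
    vectors with a small residual. Two approximants of one vector are not both kept,
    so the projection [P] onto the resulting span has rank at most [|F|], while
    [tr (rho F F^* ) <= 2 tr (rho P) + small]. Where [|F| 2^|pi| <= 2^(n+d)], the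
    value [tau P <= 2^(d-|pi|)] is dominated by the Kraft sum of the machine, so these
    [P] form a quantum Schnorr test.

    Conversely, the rank [r] of each projection [S] of a test is computable, being its
    trace, and one can search for [r] Gaussian rational vectors whose span nearly
    contains the columns of [S]; normalising an orthogonal basis of that span gives an
    algebraic orthonormal set catching at least half of [rho S], up to a small error.
    Shannon-Fano-Elias codewords of length [n - log2 r + O(1)] for these sets have
    total weight dominated by [sum tau S], hence form the domain of a computable
    measure machine with [|pi| + log2 |F| <= n + O(1)]. *)

(** * Partial recursive functions *)

(** Computability here means a [prf] program acting on [pickle] codes, so every procedure is an
    explicit function shown to be [cpt]. A code only isolates a root in a box; whether two codes
    denote the same number, and hence the size of a described set after [undup], cannot be read off
    from it. The work is therefore done on rational approximations, whose errors must not spoil the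
    exact requirements: weights have to be computable and dominated, so a rank must be exact or at
    most |F|. This is why almost dependent vectors are discarded for a described set, while for a
    test the trace, being an integer, is needed only within 1 / 4. Approximating a coded number is a
    search that must know how far the root stays from the edges of its box; this separation comes
    from integrality of characteristic polynomials. The loss in [rhoS] is a factor 2 from the
    parallelogram identity and an additive 2 * 2 ^- e with 2 ^- e < eps / 4, so the level drops from
    eps to eps / 8 in both directions. Sums become computable by comparison: a nonnegative
    computable series dominated by one with computable sum has a computable sum. *)

Fixpoint cunpair (z : nat) : nat * nat :=
  if z is z'.+1 then
    if (cunpair z').1 is a.+1 then (a, (cunpair z').2.+1) else ((cunpair z').2.+1, 0)
  else (0, 0).

Lemma triangle_succ s : (s.+1 * s.+2) %/ 2 = (s * s.+1) %/ 2 + s.+1.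
Proof.
have -> : s.+1 * s.+2 = s.+1 * 2 + s * s.+1 by lia.
by rewrite divnMDl // addnC.
Qed.

Lemma cpairE x y : cpair x y = ((x + y) * (x + y).+1) %/ 2 + y.
Proof. by []. Qed.

(** With [cpair_next_row], the walk along the antidiagonals that [cunpair] performs, so the pairing
    is inverted by primitive recursion. *)
Lemma cpair_next_step a b : cpair a b.+1 = (cpair a.+1 b).+1.
Proof. by rewrite !cpairE addSn !addnS. Qed.

Lemma cpair_next_row b : cpair b.+1 0 = (cpair 0 b).+1.
Proof. by rewrite !cpairE !addn0 add0n triangle_succ addnS. Qed.

Lemma cunpairK z : cpair (cunpair z).1 (cunpair z).2 = z.
Proof.
elim: z => [//|z IH] /=.
case E: (cunpair z).1 IH => [|a] /= IH; first by rewrite cpair_next_row IH.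
by rewrite cpair_next_step IH.
Qed.

Lemma cpairK x y : cunpair (cpair x y) = (x, y).
Proof.
move: {2}(x + y) (erefl (x + y)) => s; elim: s x y => [|s IHs] x y.
  by move/eqP; rewrite addn_eq0 => /andP[/eqP-> /eqP->].
elim: y x => [|y IHy] x.
  rewrite addn0 => ->; rewrite cpair_next_row /= IHs ?add0n //.
rewrite addnS => E; rewrite cpair_next_step /= IHy //; lia.
Qed.

Lemma cpair_inj x y x' y' : cpair x y = cpair x' y' -> x = x' /\ y = y'.
Proof. by move=> /(congr1 cunpair); rewrite !cpairK => -[-> ->]. Qed.

Definition cfst z := (cunpair z).1.
Definition csnd z := (cunpair z).2.

Lemma cfstK x y : cfst (cpair x y) = x. Proof. by rewrite /cfst cpairK. Qed.
Lemma csndK x y : csnd (cpair x y) = y. Proof. by rewrite /csnd cpairK. Qed.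

(* The fuel [s] only bounds the searches of [PMu]. *)
Fixpoint evalf (c : prf) (s x : nat) : option nat :=
  match c with
  | PZero => Some 0
  | PSucc => Some x.+1
  | PId => Some x
  | PFst => Some (cfst x)
  | PSnd => Some (csnd x)
  | PComp f g => obind (evalf f s) (evalf g s x)
  | PPair f g =>
      obind (fun y => omap (cpair y) (evalf g s x)) (evalf f s x)
  | PRec f g =>
      nat_rect (fun _ => option nat) (evalf f s (cfst x))
        (fun k acc => obind (fun y => evalf g s (cpair (cfst x) (cpair k y))) acc)
        (csnd x)
  | PMu f =>
      let n := find (fun k => evalf f s (cpair x k) \in [:: None; Some 0]) (iota 0 s) in
      if evalf f s (cpair x n) == Some 0 then Some n else None
  end.

(** The search in [PMu] also stops at [None], so every index it passes over is known to have a
    positive value, as [eval_mu] demands. *)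
Lemma evalf_sound c s x y : evalf c s x = Some y -> eval c x y.
Proof.
elim: c x y => [||||| f IHf g IHg | f IHf g IHg | f IHf g IHg | f IHf] x y /=.
- by case=> <-; constructor.
- by case=> <-; constructor.
- by case=> <-; constructor.
- by case=> <-; rewrite -{1}(cunpairK x); constructor.
- by case=> <-; rewrite -{1}(cunpairK x); constructor.
- case E: (evalf g s x) => [z|] //= Ef.
  exact: eval_comp (IHg _ _ E) (IHf _ _ Ef).
- case E: (evalf f s x) => [z|] //=; case E': (evalf g s x) => [w|] //= [<-].
  exact: eval_pair (IHf _ _ E) (IHg _ _ E').
- rewrite -[in eval _ x](cunpairK x) -/(cfst x) -/(csnd x).
  elim: (csnd x) y => [|n IHn] y /=; first by move/IHf; apply: eval_rec0.
  case E: (nat_rect _ _ _ n) => [z|] //= /IHg Eg.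
  exact: eval_recS (IHn _ E) Eg.
- set F := (fun k => _ \in _); set n := find F _.
  case: eqP => //= E [<-]; constructor; first exact: IHf.
  move=> k ltkn; have Fk : F k = false.
    have := before_find 0 ltkn; rewrite nth_iota ?add0n //.
    by apply: leq_trans ltkn _; rewrite -[s in _ <= s](size_iota 0) find_size.
  move: Fk; rewrite /F; case E': (evalf f s (cpair x k)) => [[|v]|] //= _.
  by exists v; apply: IHf.
Qed.

(** Merges finitely many thresholds into one, for instance the fuel needed by all arguments below a
    bound. *)
Lemma eventually_forall_lt (P : nat -> nat -> Prop) n :
  (forall k, k < n -> exists s0, forall s, s0 <= s -> P k s) ->
  exists s0, forall s, s0 <= s -> forall k, k < n -> P k s.
Proof.
elim: n => [|n IH] H; first by exists 0.
have [|s0 H0] := IH; first by move=> k ltkn; apply: H; apply: ltnW.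
have [s1 H1] := H n (ltnSn n).
exists (maxn s0 s1) => s; rewrite geq_max => /andP[h0 h1] k.
by rewrite ltnS leq_eqVlt => /orP[/eqP->|/H0]; [apply: H1|apply].
Qed.

Lemma evalf_complete c x y : eval c x y ->
  exists s0, forall s, s0 <= s -> evalf c s x = Some y.
Proof.
elim: c x y => [||||| f IHf g IHg | f IHf g IHg | f IHf g IHg | f IHf] x y H.
- by inversion H; exists 0.
- by inversion H; exists 0.
- by inversion H; exists 0.
- by inversion H; subst; exists 0 => s _ /=; rewrite cfstK.
- by inversion H; subst; exists 0 => s _ /=; rewrite csndK.
- inversion H; subst.
  have [s0 H0] := IHg _ _ H2; have [s1 H1] := IHf _ _ H5.
  exists (maxn s0 s1) => s; rewrite geq_max => /andP[h0 h1] /=.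
  by rewrite H0 //= H1.
- inversion H; subst.
  have [s0 H0] := IHf _ _ H2; have [s1 H1] := IHg _ _ H5.
  exists (maxn s0 s1) => s; rewrite geq_max => /andP[h0 h1] /=.
  by rewrite H0 //= H1.
- rewrite -(cunpairK x) -/(cfst x) -/(csnd x) in H *.
  move: (cfst x) (csnd x) H => {x} a n.
  elim: n y => [|n IHn] y; move E: (cpair _ _) => z H; inversion H; subst;
    match goal with [ e : cpair _ _ = cpair _ _ |- _ ] =>
      have [e1 e2] := cpair_inj e; subst => // end.
    have [s0 Hs0] := IHf _ _ H4; exists s0 => s le0 /=.
    by rewrite cfstK csndK /= Hs0.
  case: e2 => e2; subst.
  have [s0 H0'] := IHn _ H2; have [s1 H1'] := IHg _ _ H5.
  exists (maxn s0 s1) => s; rewrite geq_max => /andP[h0 h1].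
  move: (H0' s h0); rewrite /= !cfstK !csndK /= => -> /=.
  by rewrite H1'.
- inversion H; subst.
  have [s0 H0] := IHf _ _ H1.
  have [|s1 Hs1] := @eventually_forall_lt
      (fun k s => exists v, evalf f s (cpair x k) = Some v.+1) y.
    move=> k /H2[v /IHf[s1 Hs1]]; exists s1 => s les; exists v; exact: Hs1.
  (* The fuel must exceed [y] itself, since the search only inspects [iota 0 s]. *)
  exists (maxn y.+1 (maxn s0 s1)) => s; rewrite !geq_max => /and3P[ys h0 h1] /=.
  set F := (fun k => _ \in _).
  have -> : find F (iota 0 s) = y; last by rewrite H0.
  have szy : y < size (iota 0 s) by rewrite size_iota.
  apply/eqP; rewrite eqn_leq; apply/andP; split.
    rewrite leqNgt; apply/negP => /(before_find 0).
    by rewrite nth_iota // add0n /F H0.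
  rewrite leqNgt; apply/negP => lt.
  have : has F (iota 0 s) by rewrite has_find; apply: ltn_trans lt szy.
  move=> /(nth_find 0); rewrite nth_iota ?(leq_trans lt (ltnW ys)) // add0n.
  by have [v] := Hs1 s h1 _ lt; rewrite /F => ->.
Qed.

Lemma eval_det c x y z : eval c x y -> eval c x z -> y = z.
Proof.
move=> /evalf_complete[s0 H0] /evalf_complete[s1 H1].
have := H0 _ (leq_maxl s0 s1); rewrite H1 ?leq_maxr // => -[->] //.
Qed.

Definition ncomp (f : nat -> nat) := exists c, forall x, eval c x (f x).

Lemma ncomp_ext f g : (forall x, f x = g x) -> ncomp f -> ncomp g.
Proof. by move=> E [c Hc]; exists c => x; rewrite -E. Qed.

Lemma ncomp_id : ncomp (fun x => x).
Proof. by exists PId; constructor. Qed.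

Lemma ncomp_const k : ncomp (fun=> k).
Proof.
elim: k => [|k [c Hc]]; first by exists PZero; constructor.
by exists (PComp PSucc c) => x; apply: eval_comp (Hc x) _; constructor.
Qed.

Lemma ncomp_comp f g : ncomp f -> ncomp g -> ncomp (fun x => f (g x)).
Proof.
by move=> [c Hc] [d Hd]; exists (PComp c d) => x; apply: eval_comp (Hd x) (Hc _).
Qed.

Lemma ncomp_succ f : ncomp f -> ncomp (fun x => (f x).+1).
Proof. by apply: (@ncomp_comp succn); exists PSucc; constructor. Qed.

Lemma ncomp_cfst f : ncomp f -> ncomp (fun x => cfst (f x)).
Proof.
by apply: ncomp_comp; exists PFst => x; rewrite -{1}(cunpairK x); constructor.
Qed.

Lemma ncomp_csnd f : ncomp f -> ncomp (fun x => csnd (f x)).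
Proof.
by apply: ncomp_comp; exists PSnd => x; rewrite -{1}(cunpairK x); constructor.
Qed.

Lemma ncomp_cpair f g : ncomp f -> ncomp g -> ncomp (fun x => cpair (f x) (g x)).
Proof. by move=> [c Hc] [d Hd]; exists (PPair c d) => x; apply: eval_pair. Qed.

Lemma ncomp_rec (f0 : nat -> nat) (g : nat -> nat -> nat -> nat) (n : nat -> nat) :
  ncomp f0 -> ncomp (fun z => g (cfst z) (cfst (csnd z)) (csnd (csnd z))) ->
  ncomp n ->
  ncomp (fun x => nat_rect (fun=> nat) (f0 x) (g x) (n x)).
Proof.
move=> [c0 H0] [c Hc] hn.
have [cn Hn] := ncomp_cpair ncomp_id hn.
exists (PComp (PRec c0 c) cn) => x; apply: eval_comp (Hn x) _.
elim: (n x) => [|k IHk] /=; first by constructor.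
apply: eval_recS IHk _.
by have := Hc (cpair x (cpair k (nat_rect (fun=> nat) (f0 x) (g x) k)));
   rewrite !(cfstK, csndK).
Qed.

Lemma ncomp_mu (P : nat -> nat -> nat) (h : nat -> nat) :
  ncomp (fun z => P (cfst z) (csnd z)) ->
  (forall x, P x (h x) = 0) -> (forall x k, k < h x -> P x k <> 0) -> ncomp h.
Proof.
move=> [c Hc] H0 H1; exists (PMu c) => x.
have H k : eval c (cpair x k) (P x k) by have := Hc (cpair x k); rewrite cfstK csndK.
constructor; first by rewrite -(H0 x).
move=> k /H1; case E: (P x k) => [|v] // _; exists v; rewrite -E; exact: H.
Qed.

Lemma ncomp_pred f : ncomp f -> ncomp (fun x => (f x).-1).
Proof.
move=> hf; apply: (@ncomp_ext (fun x => nat_rect (fun=> nat) 0 (fun k _ => k) (f x))).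
  by move=> x; case: (f x).
by apply: ncomp_rec => //; [apply: ncomp_const|apply/ncomp_cfst/ncomp_csnd/ncomp_id].
Qed.

Lemma ncomp_add f g : ncomp f -> ncomp g -> ncomp (fun x => f x + g x).
Proof.
move=> hf hg; apply: (@ncomp_ext (fun x => nat_rect (fun=> nat) (f x) (fun _ => succn) (g x))).
  by move=> x; elim: (g x) => [|n IH] /=; rewrite ?addn0 // IH addnS.
by apply: ncomp_rec => //; apply/ncomp_succ/ncomp_csnd/ncomp_csnd/ncomp_id.
Qed.

Lemma ncomp_mul f g : ncomp f -> ncomp g -> ncomp (fun x => f x * g x).
Proof.
move=> hf hg; apply: (@ncomp_ext (fun x => nat_rect (fun=> nat) 0 (fun _ a => a + f x) (g x))).
  by move=> x; elim: (g x) => [|n IH] /=; rewrite ?muln0 // IH mulnS addnC.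
apply: ncomp_rec => //; first exact: ncomp_const.
apply: ncomp_add; first by apply/ncomp_csnd/ncomp_csnd/ncomp_id.
by apply: ncomp_comp => //; apply/ncomp_cfst/ncomp_id.
Qed.

Lemma ncomp_sub f g : ncomp f -> ncomp g -> ncomp (fun x => f x - g x).
Proof.
move=> hf hg; apply: (@ncomp_ext (fun x => nat_rect (fun=> nat) (f x) (fun _ => predn) (g x))).
  by move=> x; elim: (g x) => [|n IH] /=; rewrite ?subn0 // IH subnS.
by apply: ncomp_rec => //; apply/ncomp_pred/ncomp_csnd/ncomp_csnd/ncomp_id.
Qed.

Lemma ncomp_exp f g : ncomp f -> ncomp g -> ncomp (fun x => f x ^ g x).
Proof.
move=> hf hg; apply: (@ncomp_ext (fun x => nat_rect (fun=> nat) 1 (fun _ a => f x * a) (g x))).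
  by move=> x; elim: (g x) => [|n IH] //=; rewrite IH expnS.
apply: ncomp_rec => //; first exact: ncomp_const.
apply: ncomp_mul; last by apply/ncomp_csnd/ncomp_csnd/ncomp_id.
by apply: ncomp_comp => //; apply/ncomp_cfst/ncomp_id.
Qed.

Lemma ncomp_double f : ncomp f -> ncomp (fun x => (f x).*2).
Proof.
by move=> hf; apply: ncomp_ext (ncomp_add hf hf) => x; rewrite addnn.
Qed.

(** The step by which [CodeSeq.code] prepends [m] to a list of code [q]; the [pickle] codes of pairs
    and sequences are built from it. *)
Definition oddcode m q := 2 ^ m * q.*2.+1.

Lemma ncomp_oddcode f g : ncomp f -> ncomp g -> ncomp (fun x => oddcode (f x) (g x)).
Proof.
move=> hf hg; apply: ncomp_mul; last exact/ncomp_succ/ncomp_double.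
by apply: ncomp_exp => //; apply: ncomp_const.
Qed.

Definition oddcode_fst z := logn 2 z.
Definition oddcode_snd z := (z %/ 2 ^ logn 2 z)./2.

Lemma oddcode_gt0 m q : 0 < oddcode m q.
Proof. by rewrite muln_gt0 expn_gt0. Qed.

Lemma oddcode_fstK m q : oddcode_fst (oddcode m q) = m.
Proof.
rewrite /oddcode_fst lognM ?expn_gt0 // pfactorK //.
by rewrite (_ : logn 2 _ = 0) ?addn0 // lognE /= dvdn2 /= odd_double.
Qed.

Lemma oddcode_sndK m q : oddcode_snd (oddcode m q) = q.
Proof.
rewrite /oddcode_snd -/(oddcode_fst _) oddcode_fstK mulKn ?expn_gt0 //.
by rewrite /= uphalf_double.
Qed.

Lemma oddcodeK z : 0 < z -> oddcode (oddcode_fst z) (oddcode_snd z) = z.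
Proof.
move=> z0; rewrite /oddcode /oddcode_fst /oddcode_snd.
have := @pfactor_coprime 2 z isT z0; case=> m.
rewrite coprime2n => om E.
have -> : z %/ 2 ^ logn 2 z = m by rewrite {1}E mulnK ?expn_gt0.
by rewrite mulnC [RHS]E -[(_./2).*2.+1]add1n -[1 + _]/(true + _) -om odd_double_half.
Qed.

Lemma ncomp_oddcode_inv :
  exists2 h, ncomp h & forall z, 0 < z -> h z = cpair (oddcode_fst z) (oddcode_snd z).
Proof.
exists (fun z => if z is 0 then 0 else cpair (oddcode_fst z) (oddcode_snd z)); last by case.
(* Vanishes when [w] pairs up a preimage of [z]. The factor [z] stops the search at once at 0, which
   is no value of [oddcode]. *)
pose P z w := z * ((oddcode (cfst w) (csnd w) - z) + (z - oddcode (cfst w) (csnd w))).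
apply: (@ncomp_mu P).
- rewrite /P.
  have h2 : ncomp (fun z => oddcode (cfst (csnd z)) (csnd (csnd z))).
    by apply: ncomp_oddcode; [apply/ncomp_cfst/ncomp_csnd|apply/ncomp_csnd/ncomp_csnd];
       apply: ncomp_id.
  have h1 : ncomp cfst by apply/ncomp_cfst/ncomp_id.
  by apply: ncomp_mul => //; apply: ncomp_add; apply: ncomp_sub.
- by case=> [//|z]; rewrite /P cfstK csndK oddcodeK // subnn muln0.
- case=> [//|z] k lt /eqP; rewrite /P muln_eq0 /= addn_eq0 !subn_eq0 -eqn_leq => /eqP E.
  by move: lt; rewrite -E oddcode_fstK oddcode_sndK cunpairK ltnn.
Qed.

Lemma ncomp_oddcode_fst f : ncomp f -> (forall x, 0 < f x) ->
  ncomp (fun x => oddcode_fst (f x)).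
Proof.
move=> hf f0; have [h hh H] := ncomp_oddcode_inv.
by apply: ncomp_ext (ncomp_cfst (ncomp_comp hh hf)) => x; rewrite H // cfstK.
Qed.

Lemma ncomp_oddcode_snd f : ncomp f -> (forall x, 0 < f x) ->
  ncomp (fun x => oddcode_snd (f x)).
Proof.
move=> hf f0; have [h hh H] := ncomp_oddcode_inv.
by apply: ncomp_ext (ncomp_csnd (ncomp_comp hh hf)) => x; rewrite H // csndK.
Qed.

(** * Computable maps between countable types *)

(** The program is constrained only at codes of elements of [A]; its behaviour on other numbers is
    free. *)
Definition cpt (A B : countType) (f : A -> B) :=
  exists c, forall a, eval c (pickle a) (pickle (f a)).

Section CompBasics.
Variables A B C D : countType.

Lemma cpt_ext (f g : A -> B) : f =1 g -> cpt f -> cpt g.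
Proof. by move=> E [c Hc]; exists c => a; rewrite -E. Qed.

(** Lets a map be computed in another type with the same codes: an option is coded as a list, an
    integer as a pair of options, a rational as its underlying pair. *)
Lemma cpt_transport (f : A -> B) (g : A -> C) :
  (forall a, pickle (f a) = pickle (g a)) -> cpt f -> cpt g.
Proof. by move=> E [c Hc]; exists c => a; rewrite -E. Qed.

Lemma cpt_id : cpt (fun a : A => a).
Proof. by exists PId; constructor. Qed.

Lemma cpt_const (b : B) : cpt (fun _ : A => b).
Proof. by have [c Hc] := ncomp_const (pickle b); exists c. Qed.

Lemma cpt_comp (g : B -> C) (f : A -> B) : cpt g -> cpt f -> cpt (fun a => g (f a)).
Proof. by move=> [c Hc] [d Hd]; exists (PComp c d) => a; apply: eval_comp (Hd a) (Hc _). Qed.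

Lemma cpt_pickle (f : A -> B) : cpt f -> cpt (fun a => pickle (f a)).
Proof. by case=> c Hc; exists c. Qed.

Lemma ncomp_comp1 (F : nat -> nat) (f : A -> B) (g : A -> C) : ncomp F -> cpt f ->
  (forall a, F (pickle (f a)) = pickle (g a)) -> cpt g.
Proof.
by move=> [c Hc] [d Hd] E; exists (PComp c d) => a;
   apply: eval_comp (Hd a) _; rewrite -E.
Qed.

Lemma ncomp_comp2 (F : nat -> nat -> nat) (f : A -> B) (g : A -> C) (h : A -> D) :
  ncomp (fun z => F (cfst z) (csnd z)) -> cpt f -> cpt g ->
  (forall a, F (pickle (f a)) (pickle (g a)) = pickle (h a)) -> cpt h.
Proof.
move=> [c Hc] [d Hd] [e He] E; exists (PComp c (PPair d e)) => a.
apply: eval_comp (eval_pair (Hd a) (He a)) _.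
by rewrite -E; have := Hc (cpair (pickle (f a)) (pickle (g a))); rewrite cfstK csndK.
Qed.
End CompBasics.
Arguments cpt_id {A}.
Arguments cpt_const {A B} b.

Lemma pickle_pairE (A B : countType) (a : A) (b : B) :
  pickle (a, b) = oddcode (pickle a) (oddcode (pickle b) 0).
Proof. by []. Qed.

Lemma pickle_consE (A : countType) (a : A) (s : seq A) :
  pickle (a :: s) = oddcode (pickle a) (pickle s).
Proof. by []. Qed.

Section CompPairs.
Variables A B C : countType.

Lemma cpt_pair (f : A -> B) (g : A -> C) : cpt f -> cpt g -> cpt (fun a => (f a, g a)).
Proof.
move=> hf hg; apply: (ncomp_comp2 (F := fun x y => oddcode x (oddcode y 0))) hf hg _ => //.
have h1 : ncomp cfst by apply/ncomp_cfst/ncomp_id.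
have h2 : ncomp csnd by apply/ncomp_csnd/ncomp_id.
by apply: ncomp_oddcode => //; apply: ncomp_oddcode => //; apply: ncomp_const.
Qed.

Lemma cpt_fst (f : A -> B * C) : cpt f -> cpt (fun a => (f a).1).
Proof.
move=> hf; have [h nh H] := ncomp_oddcode_inv.
apply: (ncomp_comp1 (F := fun x => cfst (h x))) hf _; first exact: ncomp_cfst.
move=> a; case: (f a) => b c; rewrite pickle_pairE H ?oddcode_gt0 //.
by rewrite cfstK oddcode_fstK.
Qed.

Lemma cpt_snd (f : A -> B * C) : cpt f -> cpt (fun a => (f a).2).
Proof.
move=> hf; have [h nh H] := ncomp_oddcode_inv.
apply: (ncomp_comp1 (F := fun x => cfst (h (csnd (h x))))) hf _.
  by apply/ncomp_cfst; apply: ncomp_comp => //; apply/ncomp_csnd.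
move=> a; case: (f a) => b c; rewrite pickle_pairE (H (oddcode (pickle b) _)) ?oddcode_gt0 //.
by rewrite csndK oddcode_sndK H ?oddcode_gt0 // cfstK oddcode_fstK.
Qed.

End CompPairs.

Section CompRec.
Variables A B : countType.

Lemma cpt_natrec (f0 : A -> B) (g : A -> nat -> B -> B) (n : A -> nat) :
  cpt f0 -> cpt (fun p : A * (nat * B) => g p.1 p.2.1 p.2.2) -> cpt n ->
  cpt (fun a => nat_rect (fun=> B) (f0 a) (g a) (n a)).
Proof.
move=> [c0 H0] [c Hc] [cn Hn].
(* Converts the Cantor-coded arguments that [PRec] supplies into the [pickle] code of a nested
   pair. *)
have [cp Hp] : exists cp, forall x n b,
    eval cp (cpair x (cpair n b)) (oddcode x (oddcode (oddcode n (oddcode b 0)) 0)).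
  have h1 : ncomp cfst by apply/ncomp_cfst/ncomp_id.
  have h2 : ncomp (fun z => cfst (csnd z)) by apply/ncomp_cfst/ncomp_csnd/ncomp_id.
  have h3 : ncomp (fun z => csnd (csnd z)) by apply/ncomp_csnd/ncomp_csnd/ncomp_id.
  have h0 := ncomp_const 0.
  have [cp Hp] := ncomp_oddcode h1 (ncomp_oddcode (ncomp_oddcode h2 (ncomp_oddcode h3 h0)) h0).
  by exists cp => x k b; have := Hp (cpair x (cpair k b)); rewrite !(cfstK, csndK).
exists (PComp (PRec c0 (PComp c cp)) (PPair PId cn)) => a.
apply: eval_comp (eval_pair (eval_id _) (Hn a)) _.
rewrite [X in cpair _ X]/pickle /=; elim: (n a) => [|k IHk] /=.
  exact: eval_rec0.
apply: eval_recS IHk _; apply: eval_comp (Hp _ _ _) _.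
exact: Hc (a, (k, nat_rect (fun=> B) (f0 a) (g a) k)).
Qed.

Lemma cpt_mu (P : A -> nat -> bool) (h : A -> nat) :
  cpt (fun p : A * nat => P p.1 p.2) ->
  (forall a, P a (h a)) -> (forall a k, k < h a -> ~~ P a k) -> cpt h.
Proof.
move=> [c Hc] H0 H1.
have [cp Hp] : exists cp, forall x n, eval cp (cpair x n) (oddcode x (oddcode n 0)).
  have h1 : ncomp cfst by apply/ncomp_cfst/ncomp_id.
  have h2 : ncomp csnd by apply/ncomp_csnd/ncomp_id.
  have h0 := ncomp_const 0.
  have [cp Hp] := ncomp_oddcode h1 (ncomp_oddcode h2 h0).
  by exists cp => x k; have := Hp (cpair x k); rewrite !(cfstK, csndK).
have [cs Hs] := ncomp_sub (ncomp_const 1) ncomp_id.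
exists (PMu (PComp cs (PComp c cp))) => a.
have H k : eval (PComp cs (PComp c cp)) (cpair (pickle a) k) (1 - P a k).
  by apply: eval_comp (Hs _); apply: eval_comp (Hp _ _) (Hc (a, k)).
constructor; first by have := H (h a); rewrite H0.
by move=> k /H1/negPf E; exists 0; have := H k; rewrite E.
Qed.

(** A search known to succeed is computable, however its success was proved. Numbers of terms, fuel,
    ranks, codeword indices and approximating vectors are all obtained in this way. *)
Lemma cpt_ex_minn (P : A -> nat -> bool) (exP : forall a, exists k, P a k) :
  cpt (fun p : A * nat => P p.1 p.2) -> cpt (fun a => ex_minn (exP a)).
Proof.
move=> hP; apply: (cpt_mu hP) => [a|a k]; case: ex_minnP => // m _ mn lt.
by apply/negP => /mn; rewrite leqNgt lt.
Qed.

Lemma cpt_if (b : A -> bool) (f g : A -> B) : cpt b -> cpt f -> cpt g ->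
  cpt (fun a => if b a then f a else g a).
Proof.
move=> hb hf hg.
apply: (@cpt_ext _ _ (fun a => nat_rect (fun=> B) (g a) (fun _ _ => f a) (b a : nat))).
  by move=> a; case: (b a).
apply: (@cpt_natrec g (fun a _ _ => f a) (fun a => b a : nat)) => //.
  by apply: (@cpt_comp _ _ _ f); [|apply/cpt_fst/cpt_id].
Qed.
End CompRec.

(* [ct] proves [cpt (fun a => e)] by following the syntax of [e]; [ct_ext] is
   redefined whenever further operations have been shown computable. *)
Ltac ct_ext := fail.
Ltac ct0 := lazymatch goal with
 | |- @cpt ?A ?B (fun _ => ?c) => exact (@cpt_const A B c)
 | |- cpt (fun a => a) => exact: cpt_id
 | |- cpt (fun a => (@?f a, @?g a)) => refine (cpt_pair _ _)
 | |- cpt fst => exact (cpt_fst cpt_id)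
 | |- cpt snd => exact (cpt_snd cpt_id)
 | |- cpt (fun a => fst (@?f a)) => refine (cpt_fst (f := f) _)
 | |- cpt (fun a => snd (@?f a)) => refine (cpt_snd (f := f) _)
 | |- cpt (fun a => if _ then _ else _) => refine (cpt_if (b := _) (f := _) (g := _) _ _ _)
 | |- cpt (fun a => nat_rect _ (@?f a) (fun n b => @?g a n b) (@?k a)) =>
    refine (cpt_natrec (f0 := f) (g := g) (n := k) _ _ _)
 | |- cpt (fun a => nat_of_bool (@?f a)) => refine (cpt_pickle (f := f) _)
 | |- cpt (fun a => pickle (@?f a)) => refine (cpt_pickle (f := f) _)
 end.
Ltac ct_hyp := match goal with
 | H : cpt ?f |- cpt (fun p => ?f (@?g p)) => refine (cpt_comp H (f := g) _)
 | H : cpt (fun q => ?F (fst q) (snd q)) |- cpt (fun p => ?F (@?x p) (@?y p)) =>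
    refine (cpt_comp H (f := fun p => (x p, y p)) _)
 | H : cpt (fun q => ?F (fst q) (fst (snd q)) (snd (snd q)))
   |- cpt (fun p => ?F (@?x p) (@?y p) (@?z p)) =>
    refine (cpt_comp H (f := fun p => (x p, (y p, z p))) _)
 end.
Ltac ct_eta := lazymatch goal with
 | |- @cpt ?A ?B (fun _ => _) => fail
 | |- @cpt ?A ?B ?f => change (@cpt A B (fun a => f a))
 end.
Ltac ct_assumption := match goal with H : ?P |- ?Q => constr_eq P Q; exact H end.
Ltac ct := repeat (first [ct_assumption | ct0 | ct_ext | ct_hyp | ct_eta]; cbn beta).

(** * Computable operations on booleans, numbers, lists, integers and rationals *)

Section CompBool.
Variable A : countType.
Implicit Types f g : A -> bool.

Lemma cpt_negb f : cpt f -> cpt (fun a => ~~ f a).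
Proof. by move=> hf; apply: (@cpt_ext _ _ (fun a => if f a then false else true)); [|ct]. Qed.

Lemma cpt_andb f g : cpt f -> cpt g -> cpt (fun a => f a && g a).
Proof. by move=> hf hg; apply: (@cpt_ext _ _ (fun a => if f a then g a else false)); [|ct]. Qed.

Lemma cpt_orb f g : cpt f -> cpt g -> cpt (fun a => f a || g a).
Proof. by move=> hf hg; apply: (@cpt_ext _ _ (fun a => if f a then true else g a)); [|ct]. Qed.

Lemma cpt_addb f g : cpt f -> cpt g -> cpt (fun a => f a (+) g a).
Proof.
move=> hf hg; apply: (@cpt_ext _ _ (fun a => if f a then if g a then false else true else g a)).
  by move=> a; case: (f a) (g a) => -[].
by ct.
Qed.
End CompBool.

Section CompNat.
Variable A : countType.
Implicit Types f g : A -> nat.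

Lemma cpt_ncomp1 (F : nat -> nat) f : (forall h, ncomp h -> ncomp (fun x => F (h x))) ->
  cpt f -> cpt (fun a => F (f a)).
Proof. by move=> H hf; apply: ncomp_comp1 hf _; first exact/H/ncomp_id. Qed.

Lemma cpt_ncomp2 (F : nat -> nat -> nat) f g :
  (forall h k, ncomp h -> ncomp k -> ncomp (fun x => F (h x) (k x))) ->
  cpt f -> cpt g -> cpt (fun a => F (f a) (g a)).
Proof.
move=> H hf hg; apply: ncomp_comp2 hf hg _ => //.
by apply: H; [apply/ncomp_cfst/ncomp_id|apply/ncomp_csnd/ncomp_id].
Qed.

Lemma cpt_succn f : cpt f -> cpt (fun a => (f a).+1).
Proof. exact/cpt_ncomp1/ncomp_succ. Qed.
Lemma cpt_predn f : cpt f -> cpt (fun a => (f a).-1).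
Proof. exact/cpt_ncomp1/ncomp_pred. Qed.
Lemma cpt_doublen f : cpt f -> cpt (fun a => (f a).*2).
Proof. exact/cpt_ncomp1/ncomp_double. Qed.
Lemma cpt_addn f g : cpt f -> cpt g -> cpt (fun a => f a + g a).
Proof. exact/cpt_ncomp2/ncomp_add. Qed.
Lemma cpt_muln f g : cpt f -> cpt g -> cpt (fun a => f a * g a).
Proof. exact/cpt_ncomp2/ncomp_mul. Qed.
Lemma cpt_subn f g : cpt f -> cpt g -> cpt (fun a => f a - g a).
Proof. exact/cpt_ncomp2/ncomp_sub. Qed.
Lemma cpt_expn f g : cpt f -> cpt g -> cpt (fun a => f a ^ g a).
Proof. exact/cpt_ncomp2/ncomp_exp. Qed.

Lemma cpt_eqn0 f : cpt f -> cpt (fun a => f a == 0).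
Proof.
move=> hf; apply: (@cpt_transport _ _ _ (fun a => 1 - f a)).
  by move=> a; case: (f a).
by apply: cpt_subn => //; ct.
Qed.

Lemma cpt_leq f g : cpt f -> cpt g -> cpt (fun a => f a <= g a).
Proof. by move=> hf hg; apply/cpt_eqn0/cpt_subn. Qed.

Lemma cpt_iter (B : countType) (F : A -> B -> B) (z : A -> B) (f : A -> nat) :
  cpt (fun p : A * B => F p.1 p.2) -> cpt z -> cpt f ->
  cpt (fun a => iter (f a) (F a) (z a)).
Proof.
move=> hF hz hf.
apply: (@cpt_ext _ _ (fun a => nat_rect (fun=> B) (z a) (fun _ => F a) (f a))).
  by move=> a; elim: (f a) => //= n ->.
apply: (@cpt_natrec _ _ z (fun a _ => F a)) => //.
ct.
Qed.

End CompNat.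

Lemma cpt_eq (A B : countType) (f g : A -> B) :
  cpt f -> cpt g -> cpt (fun a => f a == g a).
Proof.
move=> hf hg.
apply: (@cpt_ext _ _ (fun a => (pickle (f a) <= pickle (g a)) && (pickle (g a) <= pickle (f a)))).
  by move=> a; rewrite -eqn_leq (inj_eq (pcan_inj pickleK)).
by apply: cpt_andb; apply: cpt_leq; ct.
Qed.

Ltac ct_nat := lazymatch goal with
 | |- cpt (fun a => S (@?f a)) => refine (cpt_succn _)
 | |- cpt (fun a => predn (@?f a)) => refine (cpt_predn _)
 | |- cpt (fun a => double (@?f a)) => refine (cpt_doublen _)
 | |- cpt (fun a => addn (@?f a) (@?g a)) => refine (cpt_addn _ _)
 | |- cpt (fun a => subn (@?f a) (@?g a)) => refine (cpt_subn _ _)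
 | |- cpt (fun a => muln (@?f a) (@?g a)) => refine (cpt_muln _ _)
 | |- cpt (fun a => expn (@?f a) (@?g a)) => refine (cpt_expn _ _)
 | |- cpt (fun a => leq (@?f a) (@?g a)) => refine (cpt_leq _ _)
 | |- cpt (fun a => eq_op (@?f a) (@?g a)) => refine (cpt_eq _ _)
 | |- cpt (fun a => negb (@?f a)) => refine (cpt_negb _)
 | |- cpt (fun a => andb (@?f a) (@?g a)) => refine (cpt_andb _ _)
 | |- cpt (fun a => orb (@?f a) (@?g a)) => refine (cpt_orb _ _)
 | |- cpt (fun a => addb (@?f a) (@?g a)) => refine (cpt_addb _ _)
 | |- cpt (fun a => iter (@?k a) (fun b => @?g a b) (@?f a)) =>
    refine (cpt_iter (F := g) (z := f) (f := k) _ _ _)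
 end.
Ltac ct_ext ::= ct_nat.

Section CompNat2.
Variable A : countType.
Implicit Types f g : A -> nat.

Lemma cpt_divn f g : cpt f -> cpt g -> cpt (fun a => f a %/ g a).
Proof.
move=> hf hg.
apply: (@cpt_mu _ (fun a q => (g a == 0) && (q == 0) || (f a < q.+1 * g a))).
- ct.
- move=> a; case: eqP => [->|/eqP]; first by rewrite divn0.
  by rewrite -lt0n => h; rewrite /= -ltn_divLR.
- move=> a k lt; case: eqP lt => [->|/eqP]; first by rewrite divn0.
  by rewrite -lt0n => h lt; rewrite /= -ltn_divLR // -leqNgt.
Qed.

Lemma cpt_modn f g : cpt f -> cpt g -> cpt (fun a => f a %% g a).
Proof.
move=> hf hg; apply: (@cpt_ext _ _ (fun a => f a - f a %/ g a * g a)).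
  by move=> a; rewrite {1}(divn_eq (f a) (g a)) addKn.
by have hd := cpt_divn hf hg; apply: cpt_subn => //; apply: cpt_muln.
Qed.

Lemma cpt_odd f : cpt f -> cpt (fun a => odd (f a)).
Proof.
move=> hf; apply: (@cpt_ext _ _ (fun a => f a %% 2 == 1)).
  by move=> a; rewrite modn2; case: odd.
apply: cpt_eq; last ct; apply: cpt_modn => //; ct.
Qed.

End CompNat2.

Section CompGcd.
Variable A : countType.
Implicit Types f g : A -> nat.

Lemma cpt_gcdn f g : cpt f -> cpt g -> cpt (fun a => gcdn (f a) (g a)).
Proof.
move=> hf hg.
(* Euclid's algorithm: the first component decreases strictly until it is 0, so [f a] rounds
   suffice. *)
have hgg : cpt (fun a => iter (f a) (fun p : nat * nat =>
     if p.1 == 0 then p else (p.2 %% p.1, p.1)) (f a, g a)).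
  apply: (@cpt_iter _ _ (fun _ p => if p.1 == 0 then p else (p.2 %% p.1, p.1))) => //; ct.
  by apply: cpt_modn; ct.
apply: cpt_ext (cpt_snd hgg) => a /=.
have : forall n x y, x <= n -> (iter n (fun p : nat * nat =>
     if p.1 == 0 then p else (p.2 %% p.1, p.1)) (x, y)).2 = gcdn x y.
  elim=> [|n IH] x y; first by rewrite leqn0 => /eqP-> /=; rewrite gcd0n.
  move=> le; rewrite iterSr /=; case: eqP => [->|/eqP x0].
    exact: IH.
  rewrite IH; first by rewrite gcdnC gcdn_modr.
  by rewrite -ltnS (leq_trans _ le) // ltn_mod lt0n.
by apply.
Qed.

End CompGcd.

Ltac ct_div := lazymatch goal with
 | |- cpt (fun a => divn (@?f a) (@?g a)) => refine (cpt_divn _ _)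
 | |- cpt (fun a => modn (@?f a) (@?g a)) => refine (cpt_modn _ _)
 | |- cpt (fun a => gcdn (@?f a) (@?g a)) => refine (cpt_gcdn _ _)
 | |- cpt (fun a => odd (@?f a)) => refine (cpt_odd _)
 end.
Ltac ct_ext ::= first [ct_nat | ct_div].

Section CompSeq.
Variable A : countType.

Lemma cpt_cons (B : countType) (f : A -> B) (g : A -> seq B) :
  cpt f -> cpt g -> cpt (fun a => f a :: g a).
Proof.
move=> hf hg; apply: (ncomp_comp2 (F := oddcode)) hf hg _ => //.
by apply: ncomp_oddcode; [apply/ncomp_cfst/ncomp_id|apply/ncomp_csnd/ncomp_id].
Qed.

Lemma cpt_nilp (B : countType) (f : A -> seq B) : cpt f -> cpt (fun a => nilp (f a)).
Proof.
move=> hf; apply: (@cpt_ext _ _ (fun a => pickle (f a) == 0)); last ct.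
by move=> a; case: (f a) => // b s; rewrite pickle_consE -leqn0 leqNgt oddcode_gt0.
Qed.

Lemma cpt_oddcode_inv (F : nat -> nat) (f : A -> nat) (k : nat) :
  (forall h, ncomp h -> (forall x, 0 < h x) -> ncomp (fun x => F (h x))) -> cpt f ->
  cpt (fun a => if f a == 0 then k else F (f a)).
Proof.
move=> hF hf.
have h1 : cpt (fun a => F (maxn 1 (f a))).
  apply: (@ncomp_comp1 _ _ _ (fun x => F (if x is 0 then 1 else x))) hf _ => //; last first.
    move=> a; change (F (if f a is 0 then 1 else f a) = F (maxn 1 (f a))).
    by case: (f a) => [|[]].
  apply: hF; last by case.
  apply: (@ncomp_ext (fun x => x + (1 - x))); first by case=> // n; lia.
  apply: ncomp_add; first exact: ncomp_id.
  by apply: ncomp_sub; [apply: ncomp_const|apply: ncomp_id].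
apply: (@cpt_ext _ _ (fun a => if f a == 0 then k else F (maxn 1 (f a)))); last by ct.
by move=> a; case: (f a) => [|[]].
Qed.

Lemma cpt_head (B : countType) (b0 : B) (f : A -> seq B) :
  cpt f -> cpt (fun a => head b0 (f a)).
Proof.
move=> hf.
apply: (@cpt_transport _ _ _ (fun a => if pickle (f a) == 0 then pickle b0
   else oddcode_fst (pickle (f a)))).
  move=> a; case: (f a) => // b s; rewrite pickle_consE -leqn0 leqNgt oddcode_gt0 /=.
  by rewrite oddcode_fstK.
by apply: cpt_oddcode_inv; [exact: ncomp_oddcode_fst|ct].
Qed.

Lemma cpt_behead (B : countType) (f : A -> seq B) :
  cpt f -> cpt (fun a => behead (f a)).
Proof.
move=> hf.
apply: (@cpt_transport _ _ _ (fun a => if pickle (f a) == 0 then 0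
   else oddcode_snd (pickle (f a)))).
  move=> a; case: (f a) => // b s; rewrite pickle_consE -leqn0 leqNgt oddcode_gt0 /=.
  by rewrite oddcode_sndK.
by apply: cpt_oddcode_inv; [exact: ncomp_oddcode_snd|ct].
Qed.

End CompSeq.

(** Allows the code of a list to serve as the number of iterations of a fold over it. *)
Lemma size_le_pickle (B : countType) (s : seq B) : size s <= pickle s.
Proof.
elim: s => // b s IH /=; rewrite pickle_consE /oddcode.
rewrite -[X in X <= _]mul1n leq_mul ?expn_gt0 // ltnS (leq_trans IH) //.
by rewrite -addnn leq_addr.
Qed.

Section CompFold.
Variables A X B : countType.

Lemma cpt_foldl (h : A -> B -> X -> B) (z : A -> B) (l : A -> seq X) :
  cpt (fun p : A * (B * X) => h p.1 p.2.1 p.2.2) -> cpt z -> cpt l ->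
  cpt (fun a => foldl (h a) (z a) (l a)).
Proof.
(* [head] requires a default element; when [X] has none, every list is empty. *)
move=> hh hz hl; case: (classic (inhabited X)) => [[x0]|nX]; last first.
  apply: cpt_ext hz => a; case: (l a) => // x; case: nX; constructor; exact: x.
pose F a (p : B * seq X) := if nilp p.2 then p else (h a p.1 (head x0 p.2), behead p.2).
apply: (@cpt_ext _ _ (fun a => (iter (pickle (l a)) (F a) (z a, l a)).1)).
  move=> a; have := size_le_pickle (l a).
  move: (pickle (l a)) => n; elim: n (z a) (l a) => [|n IH] b [|x s] //.
    by move=> _; rewrite iterSr /= IH.
  by rewrite iterSr; have -> : F a (b, x :: s) = (h a b x, s) by []; move=> /IH.
apply: cpt_fst; apply: cpt_iter; last 2 first.
- by ct.
- exact: cpt_pickle.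
have ht : cpt (fun p : A * (B * seq X) => head x0 p.2.2) by apply: cpt_head; ct.
have hb : cpt (fun p : A * (B * seq X) => behead p.2.2) by apply: cpt_behead; ct.
have hn : cpt (fun p : A * (B * seq X) => nilp p.2.2) by apply: cpt_nilp; ct.
by rewrite /F; ct.
Qed.
End CompFold.

Section CompFold2.
Variables A X B : countType.

Lemma cpt_rev (l : A -> seq X) : cpt l -> cpt (fun a => rev (l a)).
Proof.
move=> hl; apply: (@cpt_ext _ _ (fun a => foldl (fun acc x => x :: acc) [::] (l a))).
  move=> a; rewrite /rev; elim: (l a) [::] => //= x s IH acc; exact: IH.
apply: (@cpt_foldl _ _ _ (fun _ acc x => x :: acc)); ct.
by apply: cpt_cons; ct.
Qed.

Lemma cpt_foldr (h : A -> X -> B -> B) (z : A -> B) (l : A -> seq X) :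
  cpt (fun p : A * (X * B) => h p.1 p.2.1 p.2.2) -> cpt z -> cpt l ->
  cpt (fun a => foldr (h a) (z a) (l a)).
Proof.
move=> hh hz hl.
apply: (@cpt_ext _ _ (fun a => foldl (fun acc x => h a x acc) (z a) (rev (l a)))).
  by move=> a; rewrite foldl_rev.
apply: (@cpt_foldl _ _ _ (fun a acc x => h a x acc)) => //; last exact: cpt_rev.
by apply: (cpt_comp hh (f := fun p : A * (B * X) => (p.1, (p.2.2, p.2.1)))); ct.
Qed.
End CompFold2.

Ltac ct_fold := lazymatch goal with
 | |- cpt (fun a => cons (@?f a) (@?g a)) => refine (cpt_cons _ _)
 | |- cpt (fun a => nilp (@?f a)) => refine (cpt_nilp _)
 | |- cpt (fun a => head ?b (@?f a)) => refine (cpt_head _ _)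
 | |- cpt (fun a => behead (@?f a)) => refine (cpt_behead _)
 | |- cpt (fun a => rev (@?f a)) => refine (cpt_rev _)
 | |- cpt (fun a => foldr (fun x y => @?h a x y) (@?z a) (@?l a)) =>
    refine (cpt_foldr (h := h) (z := z) (l := l) _ _ _)
 | |- cpt (fun a => foldl (fun x y => @?h a x y) (@?z a) (@?l a)) =>
    refine (cpt_foldl (h := h) (z := z) (l := l) _ _ _)
 end.
Ltac ct_ext ::= first [ct_nat | ct_div | ct_fold].

Section CompSeq2.
Variables A X Y : countType.
Implicit Types (l : A -> seq X).

Lemma cpt_map (f : A -> X -> Y) l : cpt (fun p : A * X => f p.1 p.2) -> cpt l ->
  cpt (fun a => map (f a) (l a)).
Proof.
move=> hf hl; apply: (@cpt_ext _ _ (fun a => foldr (fun x s => f a x :: s) [::] (l a))).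
  by move=> a; elim: (l a) => //= x s ->.
by ct.
Qed.

Lemma cpt_all (f : A -> X -> bool) l : cpt (fun p : A * X => f p.1 p.2) -> cpt l ->
  cpt (fun a => all (f a) (l a)).
Proof.
move=> hf hl; apply: (@cpt_ext _ _ (fun a => foldr (fun x s => f a x && s) true (l a))).
  by move=> a; elim: (l a) => //= x s ->.
by ct.
Qed.

Lemma cpt_find (f : A -> X -> bool) l : cpt (fun p : A * X => f p.1 p.2) -> cpt l ->
  cpt (fun a => find (f a) (l a)).
Proof.
move=> hf hl; apply: (@cpt_ext _ _ (fun a => foldr (fun x n => if f a x then 0 else n.+1) 0 (l a))).
  by move=> a; elim: (l a) => //= x s ->.
by ct.
Qed.

Lemma cpt_filter (f : A -> X -> bool) l : cpt (fun p : A * X => f p.1 p.2) -> cpt l ->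
  cpt (fun a => filter (f a) (l a)).
Proof.
move=> hf hl.
apply: (@cpt_ext _ _ (fun a => foldr (fun x s => if f a x then x :: s else s) [::] (l a))).
  by move=> a; elim: (l a) => //= x s ->.
by ct.
Qed.

Lemma cpt_size l : cpt l -> cpt (fun a => size (l a)).
Proof.
move=> hl; apply: (@cpt_ext _ _ (fun a => foldr (fun _ n => n.+1) 0 (l a))).
  by move=> a; elim: (l a) => //= x s ->.
by ct.
Qed.

Lemma cpt_cat l l' : cpt l -> cpt l' -> cpt (fun a => l a ++ l' a).
Proof.
move=> hl hl'; apply: (@cpt_ext _ _ (fun a => foldr (fun x s => x :: s) (l' a) (l a))).
  by move=> a; elim: (l a) => //= x s ->.
by ct.
Qed.

Lemma cpt_drop l (n : A -> nat) : cpt n -> cpt l -> cpt (fun a => drop (n a) (l a)).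
Proof.
move=> hn hl; apply: (@cpt_ext _ _ (fun a => iter (n a) (fun s => behead s) (l a))).
  move=> a; elim: (n a) (l a) => [|k IH] [|x s] //; rewrite ?drop0 // iterSr ?IH //=.
by ct.
Qed.

Lemma cpt_nth (x0 : X) l (n : A -> nat) :
  cpt l -> cpt n -> cpt (fun a => nth x0 (l a) (n a)).
Proof.
move=> hl hn; apply: (@cpt_ext _ _ (fun a => head x0 (drop (n a) (l a)))).
  by move=> a; rewrite -nth0 nth_drop addn0.
by apply: cpt_head; apply: cpt_drop.
Qed.

Lemma cpt_mem (l : A -> seq X) (f : A -> X) :
  cpt f -> cpt l -> cpt (fun a => f a \in l a).
Proof.
move=> hf hl; apply: (@cpt_ext _ _ (fun a => foldr (fun x s => (f a == x) || s) false (l a))).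
  by move=> a; elim: (l a) => //= x s; rewrite in_cons => ->.
by ct.
Qed.

End CompSeq2.

Section CompSeq3.
Variables A X : countType.

Lemma cpt_rcons (l : A -> seq X) (f : A -> X) :
  cpt l -> cpt f -> cpt (fun a => rcons (l a) (f a)).
Proof.
move=> hl hf; apply: (@cpt_ext _ _ (fun a => l a ++ [:: f a])).
  by move=> a; rewrite cats1.
by apply: cpt_cat; ct.
Qed.

End CompSeq3.

Section CompSeq4.
Variables A X : countType.

Lemma cpt_iota (m n : A -> nat) : cpt m -> cpt n -> cpt (fun a => iota (m a) (n a)).
Proof.
move=> hm hn.
apply: (@cpt_ext _ _ (fun a => nat_rect (fun=> seq nat) [::]
   (fun k s => rcons s (m a + k)) (n a))).
  move=> a; elim: (n a) => // k IH.
  by rewrite -[in RHS](addn1 k) iotaD cats1 -IH.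
ct; apply: cpt_rcons; ct.
Qed.

Lemma cpt_flatten (l : A -> seq (seq X)) : cpt l -> cpt (fun a => flatten (l a)).
Proof.
move=> hl; apply: (@cpt_ext _ _ (fun a => foldr (fun x s => x ++ s) [::] (l a))) => //.
by ct; apply: cpt_cat; ct.
Qed.

Lemma cpt_decode (f : A -> nat) : cpt f -> cpt (fun a => CodeSeq.decode (f a)).
Proof.
apply: cpt_transport => a; rewrite -{1}(CodeSeq.decodeK (f a)).
by rewrite [RHS]/pickle /= /pickle_seq map_id.
Qed.

End CompSeq4.

Section CompOpt.
Variables A B C : countType.

Lemma cpt_Some (f : A -> B) : cpt f -> cpt (fun a => Some (f a)).
Proof.
by move=> hf; apply: (@cpt_transport _ _ _ (fun a => [:: f a])) => //; ct.
Qed.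

Lemma cpt_seq_of_opt (f : A -> option B) : cpt f -> cpt (fun a => seq_of_opt (f a)).
Proof. exact: cpt_transport. Qed.

Lemma cpt_optmatch (o : A -> option B) (f : A -> B -> C) (z : A -> C) :
  cpt (fun p : A * B => f p.1 p.2) -> cpt z -> cpt o ->
  cpt (fun a => if o a is Some b then f a b else z a).
Proof.
move=> hf hz ho.
apply: (@cpt_ext _ _ (fun a => foldr (fun b _ => f a b) (z a) (seq_of_opt (o a)))).
  by move=> a; case: (o a).
have := cpt_seq_of_opt ho; move=> ?; ct.
Qed.
End CompOpt.

Ltac ct_seq := lazymatch goal with
 | |- cpt (fun a => map (fun x => @?f a x) (@?l a)) => refine (cpt_map (f := f) (l := l) _ _)
 | |- cpt (fun a => all (fun x => @?f a x) (@?l a)) => refine (cpt_all (f := f) (l := l) _ _)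
 | |- cpt (fun a => find (fun x => @?f a x) (@?l a)) => refine (cpt_find (f := f) (l := l) _ _)
 | |- cpt (fun a => filter (fun x => @?f a x) (@?l a)) => refine (cpt_filter (f := f) (l := l) _ _)
 | |- cpt (fun a => size (@?l a)) => refine (cpt_size _)
 | |- cpt (fun a => cat (@?l a) (@?k a)) => refine (cpt_cat _ _)
 | |- cpt (fun a => drop (@?l a) (@?k a)) => refine (cpt_drop _ _)
 | |- cpt (fun a => rcons (@?l a) (@?k a)) => refine (cpt_rcons _ _)
 | |- cpt (fun a => iota (@?l a) (@?k a)) => refine (cpt_iota _ _)
 | |- cpt (fun a => nth ?x (@?l a) (@?k a)) => refine (cpt_nth _ _ _)
 | |- cpt (fun a => flatten (@?l a)) => refine (cpt_flatten _)
 | |- cpt (fun a => CodeSeq.decode (@?l a)) => refine (cpt_decode _)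
 | |- cpt (fun a => Some (@?l a)) => refine (cpt_Some _)
 | |- cpt (fun a => seq_of_opt (@?l a)) => refine (cpt_seq_of_opt _)
 | |- cpt (fun a => match @?o a with Some b => @?f a b | None => @?z a end) =>
     refine (cpt_optmatch (o := o) (f := f) (z := z) _ _ _)
 | |- cpt (fun a => @in_mem _ (@?f a) (mem (@?l a))) =>
     refine (cpt_mem _ _)
 end.
Ltac ct_ext ::= first [ct_nat | ct_div | ct_fold | ct_seq].

Import Order.TTheory GRing.Theory Num.Theory.
Local Open Scope ring_scope.

Definition isneg (z : int) := if z is Negz _ then true else false.
Definition mksg (b : bool) (n : nat) : int := if b then - n%:Z else n%:Z.

Section CompInt.
Variable A : countType.
Implicit Types (f g : A -> int).

Lemma cpt_Posz (f : A -> nat) : cpt f -> cpt (fun a => Posz (f a)).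
Proof.
by move=> hf; apply: (@cpt_transport _ _ _ (fun a => (Some (f a), None : option nat))) => //; ct.
Qed.

Lemma cpt_Negz (f : A -> nat) : cpt f -> cpt (fun a => Negz (f a)).
Proof.
by move=> hf; apply: (@cpt_transport _ _ _ (fun a => (None : option nat, Some (f a)))) => //; ct.
Qed.

Lemma cpt_opair_of_int f : cpt f -> cpt (fun a => opair_of_sum (natsum_of_int (f a))).
Proof. exact: cpt_transport. Qed.

Lemma cpt_isneg f : cpt f -> cpt (fun a => isneg (f a)).
Proof.
move=> /cpt_opair_of_int hf.
apply: (@cpt_ext _ _ (fun a => if (opair_of_sum (natsum_of_int (f a))).2 is Some _ then true else false)).
  by move=> a; case: (f a).
by ct.
Qed.

Lemma cpt_absz f : cpt f -> cpt (fun a => absz (f a)).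
Proof.
move=> /cpt_opair_of_int hf.
apply: (@cpt_ext _ _ (fun a => if (opair_of_sum (natsum_of_int (f a))).2 is Some n then n.+1
   else if (opair_of_sum (natsum_of_int (f a))).1 is Some n then n else 0%N)).
  by move=> a; case: (f a).
by ct.
Qed.

Lemma cpt_mksg (b : A -> bool) (f : A -> nat) : cpt b -> cpt f ->
  cpt (fun a => mksg (b a) (f a)).
Proof.
move=> hb hf.
apply: (@cpt_ext _ _ (fun a => if b a then if f a == 0%N then 0%Z else Negz (f a).-1 else Posz (f a))).
  by move=> a; rewrite /mksg; case: (b a) => //; case: (f a).
by ct; [apply: cpt_Negz; ct|apply: cpt_Posz].
Qed.

Lemma cpt_addz f g : cpt f -> cpt g -> cpt (fun a => f a + g a).
Proof.
move=> hf hg.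
apply: (@cpt_ext _ _ (fun a => if isneg (f a) == isneg (g a) then
   mksg (isneg (f a)) (absz (f a) + absz (g a))
   else if (absz (g a) <= absz (f a))%N then mksg (isneg (f a)) (absz (f a) - absz (g a))
   else mksg (isneg (g a)) (absz (g a) - absz (f a)))).
  move=> a; rewrite /mksg.
  by case: (f a) (g a) => [m|m] [n|n] /=; rewrite ?NegzE; try case: leqP => ?; lia.
have := cpt_absz hf; have := cpt_absz hg; have := cpt_isneg hf; have := cpt_isneg hg => *.
by ct; apply: cpt_mksg; ct.
Qed.

Lemma cpt_mulz f g : cpt f -> cpt g -> cpt (fun a => f a * g a).
Proof.
move=> hf hg.
apply: (@cpt_ext _ _ (fun a => mksg (isneg (f a) (+) isneg (g a)) (absz (f a) * absz (g a)))).
  move=> a; rewrite /mksg.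
  by case: (f a) (g a) => [m|m] [n|n] /=; rewrite ?NegzE; lia.
have := cpt_absz hf; have := cpt_absz hg; have := cpt_isneg hf; have := cpt_isneg hg => *.
by apply: cpt_mksg; ct.
Qed.

Lemma cpt_oppz f : cpt f -> cpt (fun a => - f a).
Proof.
move=> hf; apply: (@cpt_ext _ _ (fun a => mksg (~~ isneg (f a)) (absz (f a)))).
  by move=> a; rewrite /mksg; case: (f a) => [m|m] /=; rewrite ?NegzE; lia.
have := cpt_absz hf; have := cpt_isneg hf => *.
by apply: cpt_mksg; ct.
Qed.

End CompInt.

Lemma cpt_lez (A : countType) (f g : A -> int) :
  cpt f -> cpt g -> cpt (fun a => f a <= g a).
Proof.
move=> hf hg; apply: (@cpt_ext _ _ (fun a => ~~ isneg (g a + - f a))).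
  move=> a; rewrite -subr_ge0; case: (g a - f a) => [m|m] //.
by apply: cpt_negb; apply: cpt_isneg; apply: cpt_addz => //; apply: cpt_oppz.
Qed.

Lemma cpt_ltz (A : countType) (f g : A -> int) :
  cpt f -> cpt g -> cpt (fun a => f a < g a).
Proof.
move=> hf hg; apply: (@cpt_ext _ _ (fun a => ~~ (g a <= f a))).
  by move=> a; rewrite -ltNge.
by apply: cpt_negb; apply: cpt_lez.
Qed.

Ltac ct_int := lazymatch goal with
 | |- cpt (fun a => Posz (@?f a)) => refine (cpt_Posz _)
 | |- cpt (fun a => absz (@?f a)) => refine (cpt_absz _)
 | |- cpt (fun a => mksg (@?f a) (@?g a)) => refine (cpt_mksg _ _)
 | |- cpt (fun a => @GRing.opp _ (@?f a)) => refine (cpt_oppz (f := f) _)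
 | |- cpt (fun a => @GRing.add _ (@?f a) (@?g a)) => refine (cpt_addz (f := f) (g := g) _ _)
 | |- cpt (fun a => @GRing.mul _ (@?f a) (@?g a)) => refine (cpt_mulz (f := f) (g := g) _ _)
 | |- cpt (fun a => @Order.le _ _ (@?f a) (@?g a)) => refine (cpt_lez (f := f) (g := g) _ _)
 | |- cpt (fun a => @Order.lt _ _ (@?f a) (@?g a)) => refine (cpt_ltz (f := f) (g := g) _ _)
 end.
Ltac ct_ext ::= first [ct_nat | ct_div | ct_fold | ct_seq | ct_int].

Section CompRat.
Variable A : countType.
Implicit Types (f g : A -> rat).

Lemma cpt_valq f : cpt f -> cpt (fun a => valq (f a)).
Proof. by case=> c Hc; exists c. Qed.

Lemma cpt_numq f : cpt f -> cpt (fun a => numq (f a)).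
Proof. by move=> /cpt_valq hf; apply: cpt_fst. Qed.

Lemma cpt_denq f : cpt f -> cpt (fun a => denq (f a)).
Proof. by move=> /cpt_valq hf; apply: cpt_snd. Qed.

Lemma cpt_fracq (f g : A -> int) : cpt f -> cpt g -> cpt (fun a => fracq (f a, g a)).
Proof.
move=> hf hg; apply: (@cpt_transport _ _ _ (fun a =>
  if g a != 0 then
    (mksg ((g a < 0) (+) (f a < 0)) (absz (f a) %/ gcdn (absz (f a)) (absz (g a)))%N,
     Posz (absz (g a) %/ gcdn (absz (f a)) (absz (g a)))%N)
  else (0, 1))); last by ct.
move=> a; have := val_fracq (f a, g a); rewrite /fracq_subdef [_.1]/= [_.2]/=.
have -> : pickle (fracq (f a, g a)) = pickle (val (fracq (f a, g a))) by [].
move=> ->; congr pickle; case: ifP => // _.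
by congr (_, _); rewrite /mksg; case: (_ (+) _); rewrite ?expr1z ?expr0z ?mulN1r ?mul1r.
Qed.

Lemma cpt_addq f g : cpt f -> cpt g -> cpt (fun a => f a + g a).
Proof.
move=> hf hg; apply: (@cpt_ext _ _ (fun a => fracq (numq (f a) * denq (g a) + numq (g a) * denq (f a),
  denq (f a) * denq (g a)))).
  by move=> a; rewrite -[RHS]/(addq _ _) addq_def addq_subdefE.
have := cpt_numq hf; have := cpt_numq hg; have := cpt_denq hf; have := cpt_denq hg => *.
by apply: cpt_fracq; ct.
Qed.

Lemma cpt_mulq f g : cpt f -> cpt g -> cpt (fun a => f a * g a).
Proof.
move=> hf hg; apply: (@cpt_ext _ _ (fun a => fracq (numq (f a) * numq (g a),
  denq (f a) * denq (g a)))).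
  by move=> a; rewrite -[RHS]/(mulq _ _) mulq_def mulq_subdefE.
have := cpt_numq hf; have := cpt_numq hg; have := cpt_denq hf; have := cpt_denq hg => *.
by apply: cpt_fracq; ct.
Qed.

Lemma cpt_oppq f : cpt f -> cpt (fun a => - f a).
Proof.
move=> hf; apply: (@cpt_ext _ _ (fun a => fracq (- numq (f a), denq (f a)))).
  by move=> a; rewrite -[RHS]/(oppq _) oppq_def.
have := cpt_numq hf; have := cpt_denq hf => *.
by apply: cpt_fracq; ct.
Qed.

Lemma cpt_invq f : cpt f -> cpt (fun a => (f a)^-1).
Proof.
move=> hf; apply: (@cpt_ext _ _ (fun a => fracq (denq (f a), numq (f a)))).
  by move=> a; rewrite -[RHS]/(invq _) invq_def.
have := cpt_numq hf; have := cpt_denq hf => *.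
by apply: cpt_fracq; ct.
Qed.

Lemma cpt_leq_rat f g : cpt f -> cpt g -> cpt (fun a => f a <= g a).
Proof.
move=> hf hg; apply: (@cpt_ext _ _ (fun a => numq (f a) * denq (g a) <= numq (g a) * denq (f a))).
  by move=> a; rewrite -[RHS]/(le_rat _ _) le_ratE.
have := cpt_numq hf; have := cpt_numq hg; have := cpt_denq hf; have := cpt_denq hg => *.
by ct.
Qed.

Lemma cpt_ltq_rat f g : cpt f -> cpt g -> cpt (fun a => f a < g a).
Proof.
move=> hf hg; apply: (@cpt_ext _ _ (fun a => ~~ (g a <= f a))).
  by move=> a; rewrite -ltNge.
by apply: cpt_negb; apply: cpt_leq_rat.
Qed.

Lemma cpt_natr (f : A -> nat) : cpt f -> cpt (fun a => (f a)%:R : rat).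
Proof.
move=> hf; apply: (@cpt_ext _ _ (fun a => fracq (Posz (f a), 1))).
  by move=> a; rewrite -ratz_frac ratzE.
by apply: cpt_fracq; ct.
Qed.
End CompRat.

Ltac ct_rat := lazymatch goal with
 | |- cpt (fun a => numq (@?f a)) => refine (cpt_numq _)
 | |- cpt (fun a => denq (@?f a)) => refine (cpt_denq _)
 | |- cpt (fun a => @GRing.natmul _ (GRing.one _) (@?f a)) => refine (cpt_natr (f := f) _)
 | |- cpt (fun a => @GRing.opp _ (@?f a)) => refine (cpt_oppq (f := f) _)
 | |- cpt (fun a => @GRing.inv _ (@?f a)) => refine (cpt_invq (f := f) _)
 | |- cpt (fun a => @GRing.add _ (@?f a) (@?g a)) => refine (cpt_addq (f := f) (g := g) _ _)
 | |- cpt (fun a => @GRing.mul _ (@?f a) (@?g a)) => refine (cpt_mulq (f := f) (g := g) _ _)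
 | |- cpt (fun a => @Order.le _ _ (@?f a) (@?g a)) => refine (cpt_leq_rat (f := f) (g := g) _ _)
 | |- cpt (fun a => @Order.lt _ _ (@?f a) (@?g a)) => refine (cpt_ltq_rat (f := f) (g := g) _ _)
 end.
Ltac ct_ext ::= first [ct_nat | ct_div | ct_fold | ct_seq | ct_rat | ct_int].

Lemma cpt_normq (A : countType) (f : A -> rat) : cpt f -> cpt (fun a => `|f a|).
Proof.
move=> hf; apply: (@cpt_ext _ _ (fun a => if f a < 0 then - f a else f a)); last by ct.
by move=> a; case: ltrP => h; [rewrite ltr0_norm|rewrite ger0_norm].
Qed.

Lemma cpt_expq (A : countType) (f : A -> rat) (n : A -> nat) :
  cpt f -> cpt n -> cpt (fun a => f a ^+ n a).
Proof.
move=> hf hn; apply: (@cpt_ext _ _ (fun a => iter (n a) (fun x => f a * x) 1)); last by ct.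
by move=> a; elim: (n a) => [|k IH]; rewrite ?expr0 //= IH exprS.
Qed.

Lemma cpt_sumq (A X : countType) (l : A -> seq X) (F : A -> X -> rat) :
  cpt l -> cpt (fun p : A * X => F p.1 p.2) -> cpt (fun a => \sum_(x <- l a) F a x).
Proof.
move=> hl hF; apply: (@cpt_ext _ _ (fun a => foldr (fun x s => F a x + s) 0 (l a))).
  by move=> a; elim: (l a) => [|x s IH]; rewrite ?big_nil // big_cons -IH.
by ct.
Qed.

Ltac ct_rat_ops := lazymatch goal with
 | |- cpt (fun a => @Num.norm _ _ (@?f a)) => refine (cpt_normq (f := f) _)
 | |- cpt (fun a => @GRing.exp _ (@?f a) (@?g a)) => refine (cpt_expq (f := f) (n := g) _ _)
 | |- cpt (fun a => \sum_(i <- @?l a) (@?F a i)) => refine (cpt_sumq (l := l) (F := F) _ _)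
 end.
Ltac ct_ext ::= first [ct_nat | ct_div | ct_fold | ct_seq | ct_rat | ct_rat_ops | ct_int].

(** * Decoding of arbitrary numbers *)

(** Unlike [cpt], this also concerns numbers that code nothing, which must be recognised: outputs of
    a given machine are arbitrary numbers, and so are the candidates of a search over codes. *)
Definition dcpt (T : countType) := cpt (unpickle : nat -> option T).

Lemma dcpt_nat : dcpt nat.
Proof. by apply: (@cpt_ext _ _ (fun n => Some n)) => //; ct. Qed.

Lemma cpt_obind (A B C : countType) (f : A -> B -> option C) (o : A -> option B) :
  cpt (fun p : A * B => f p.1 p.2) -> cpt o -> cpt (fun a => obind (f a) (o a)).
Proof. by move=> hf ho; apply: (cpt_optmatch (f := f) (z := fun _ => None)) => //; ct. Qed.

Ltac ct_obind := lazymatch goal with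
 | |- cpt (fun a => obind (fun b => @?f a b) (@?o a)) => refine (cpt_obind (f := f) (o := o) _ _)
 end.
Ltac ct_ext ::= first [ct_nat | ct_div | ct_fold | ct_seq | ct_rat | ct_rat_ops | ct_obind | ct_int].

Lemma dcpt_pair (B C : countType) : dcpt B -> dcpt C -> dcpt (B * C)%type.
Proof.
rewrite /dcpt => hB hC.
apply: (@cpt_ext _ _ (fun n => if size (CodeSeq.decode n) == 2 then
  obind (fun b : B => obind (fun c : C => Some (b, c))
    (unpickle (nth 0 (CodeSeq.decode n) 1)))
    (unpickle (nth 0 (CodeSeq.decode n) 0)) else None)%N).
  move=> n; rewrite [RHS]/unpickle /= /pcomp [unpickle n]/unpickle /= /unpickle_tagged.
  case: (CodeSeq.decode n) => [|x [|y [|]]] //=.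
  by case: (unpickle x) => //= b; case: (unpickle y).
by ct.
Qed.

Lemma dcpt_seq (B : countType) : dcpt B -> dcpt (seq B).
Proof.
move=> hB.
apply: (@cpt_ext _ _ (fun n => Some (flatten (map (fun x => seq_of_opt (unpickle x : option B)) (CodeSeq.decode n))))).
  move=> n; rewrite [RHS]/unpickle /= /unpickle_seq; congr Some.
  by elim: (CodeSeq.decode n) => //= x s ->; case: (unpickle x).
by ct; apply: (cpt_comp hB); ct.
Qed.

Lemma dcpt_option (B : countType) : dcpt B -> dcpt (option B).
Proof.
move=> /dcpt_seq; rewrite /dcpt => hB.
apply: (@cpt_ext _ _ (fun n => if (unpickle n : option (seq B)) is Some s then
  Some (foldr (fun b _ => Some b) None s) else None)).
  move=> n; have -> : (unpickle n : option (option B)) =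
    obind (fun s => Some (ohead s)) (unpickle n : option (seq B)) by [].
  by case: (unpickle n) => // -[].
by ct.
Qed.

Lemma dcpt_int : dcpt int.
Proof.
have h := dcpt_pair (dcpt_option dcpt_nat) (dcpt_option dcpt_nat); rewrite /dcpt in h *.
apply: (@cpt_ext _ _ (fun n => if (unpickle n : option (option nat * option nat)) is Some p then
   if p.2 is Some q then Some (Negz q) else if p.1 is Some q then Some (Posz q) else None
   else None)).
  move=> n; rewrite [RHS]/unpickle /= /pcomp /=; rewrite [X in obind _ X]/unpickle /= /pcomp /=.
  by case: (unpickle n) => // -[[p|] [q|]].
by ct; apply: cpt_Negz; ct.
Qed.

Lemma dcpt_rat : dcpt rat.
Proof.
have h := dcpt_pair dcpt_int dcpt_int; rewrite /dcpt in h *.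
apply: (@cpt_ext _ _ (fun n => if (unpickle n : option (int * int)) is Some p then
   if (0 < p.2) && (gcdn (absz p.1) (absz p.2) == 1%N) then Some (fracq (p.1, p.2)) else None
   else None)).
  move=> n; rewrite [RHS]/unpickle /= /pcomp /=; case: (unpickle n) => //= -[x y] /=.
  case: insubP => /= [q|]; rewrite /coprime => E; last by rewrite (negPf E).
  by rewrite E => q_eq; congr Some; rewrite -q_eq -[RHS]valqK.
by ct; apply: cpt_fracq; ct.
Qed.

(** * Approximation of coded algebraic numbers *)

Definition coef_dom (p q : {poly int}) := forall i, `|p`_i| <= q`_i.

Lemma coef_domD p q p' q' : coef_dom p q -> coef_dom p' q' -> coef_dom (p + p') (q + q').
Proof. by move=> h h' i; rewrite !coefD (le_trans (ler_normD _ _)) // lerD. Qed.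

Lemma coef_domM p q p' q' : coef_dom p q -> coef_dom p' q' -> coef_dom (p * p') (q * q').
Proof.
move=> h h' i; rewrite !coefM (le_trans (ler_norm_sum _ _ _)) //.
by apply: ler_sum => j _; rewrite normrM ler_pM.
Qed.

Lemma coef_domN p q : coef_dom p q -> coef_dom (- p) q.
Proof. by move=> h i; rewrite coefN normrN. Qed.

Lemma coef_dom_prod (I : Type) (r : seq I) (F G : I -> {poly int}) :
  (forall i, coef_dom (F i) (G i)) -> coef_dom (\prod_(i <- r) F i) (\prod_(i <- r) G i).
Proof.
move=> h; elim: r => [|i r IH]; last by rewrite !big_cons; apply: coef_domM.
by rewrite !big_nil => i; rewrite coef1 normr_nat.
Qed.

Lemma coef_dom_sum (I : Type) (r : seq I) (F G : I -> {poly int}) :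
  (forall i, coef_dom (F i) (G i)) -> coef_dom (\sum_(i <- r) F i) (\sum_(i <- r) G i).
Proof.
move=> h; elim: r => [|i r IH]; last by rewrite !big_cons; apply: coef_domD.
by rewrite !big_nil => i; rewrite coef0 normr0.
Qed.

(** In the Leibniz expansion there are [N!] products of [N] factors, and every entry of the
    characteristic matrix is dominated by X + B. *)
Lemma coef_dom_char_poly N (T : 'M[int]_N) (B : nat) : (forall i j, `|T i j| <= B%:Z) ->
  coef_dom (char_poly T) (('X + B%:Z%:P) ^+ N *+ N`!).
Proof.
move=> hT; rewrite /char_poly /determinant.
have -> : ('X + B%:Z%:P) ^+ N *+ N`! = \sum_(s : 'S_N) ('X + (B%:Z)%:P) ^+ N.
  by rewrite sumr_const card_Sn.
apply: coef_dom_sum => s.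
have H : coef_dom (\prod_i char_poly_mx T i (s i)) (('X + (B%:Z)%:P) ^+ N).
  rewrite -[X in _ ^+ X](card_ord N) -prodr_const; apply: coef_dom_prod => i k.
  rewrite !mxE coefB coefMn coefX coefC coefD coefX coefC.
  have := hT i (s i); case: (i == s i); case: k => [|[|k]] //=;
    rewrite ?mulr0n ?mulr1n ?subr0 ?sub0r ?add0r ?addr0 ?normrN ?normr0 ?normr1 //.
case: (odd_perm s); rewrite ?expr1 ?expr0 ?mulN1r ?mul1r //; exact: coef_domN.
Qed.

Section IntegralRep.
Variable C : numClosedFieldType.
Implicit Types (x y : C).

(** Algebraic integers with explicit bounds: [N] plays the role of a degree and [B] of a height, and
    both can be followed through sums, conjugates and integer multiples without minimal
    polynomials. *)
Definition irep x (N B : nat) := exists (T : 'M[int]_N) (v : 'rV[C]_N),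
  [/\ v != 0, v *m map_mx intr T = x *: v & forall i j, `|T i j| <= B%:Z].

(* The lowest nonzero coefficient of the characteristic polynomial is an integer. *)
Lemma irep_lower_bound x N B : irep x N B -> x != 0 ->
  1 <= `|x| * (N`! * B.+1 ^ N)%:R.
Proof.
move=> [T [v [v0 eig hT]]] x0.
have hbig : (1 : C) <= (N`! * B.+1 ^ N)%:R.
  by rewrite ler1n muln_gt0 fact_gt0 expn_gt0.
have [lex1|/ltW lt1x] := real_leP (normr_real x) (real1 C); last first.
  by rewrite -[leLHS]mulr1; apply: ler_pM; rewrite ?ler01.
have rt : root (map_poly intr (char_poly T)) x.
  rewrite map_char_poly -eigenvalue_root_char; apply/eigenvalueP; exists v => //.
set chi := char_poly T in rt.
have chi0 : chi != 0 by rewrite monic_neq0 // char_poly_monic.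
have exk : exists k, chi`_k != 0.
  by exists (size chi).-1; rewrite -/(lead_coef chi) lead_coef_eq0.
case: (ex_minnP exk) => k ck kmin.
have lek : (k < size chi)%N.
  by rewrite ltnNge; apply: contra ck => h; rewrite nth_default.
have dom := coef_dom_char_poly hT; rewrite -/chi in dom.
set q := _ *+ _ in dom.
(* Dividing chi(x) = 0 by [x ^+ k] isolates the lowest nonzero coefficient. *)
have E : (chi`_k)%:~R = - x * \sum_(k.+1 <= i < size chi) (chi`_i)%:~R * x ^+ (i - k.+1).
  move: rt; rewrite /root horner_coef size_map_inj_poly ?rmorph0 //; last exact: intr_inj.
  rewrite -(big_mkord xpredT (fun i => (map_poly intr chi)`_i * x ^+ i)).
  rewrite (big_cat_nat _ (n := k)) ?(ltnW lek) //=.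
  rewrite big_nat big1 ?add0r; last first.
    move=> i /andP[_ ltik]; rewrite coef_map /=.
    case: (eqVneq chi`_i 0) => [->|/kmin]; first by rewrite mulr0z mul0r.
    by rewrite leqNgt ltik.
  rewrite big_ltn // coef_map /= => /eqP H.
  have xk : x ^+ k != 0 by rewrite expf_neq0.
  apply: (mulIf xk); move/eqP: H; rewrite addr_eq0 => /eqP ->.
  rewrite mulNr mulNr; congr (- _); rewrite -mulrA mulr_suml mulr_sumr.
  apply: eq_big_nat => i /andP[ki _]; rewrite coef_map /= mulrCA -mulrA; congr (_ * _).
  by rewrite -exprS -exprD subnK.
have : 1 <= `|(chi`_k)%:~R : C|.
  by rewrite -intr_norm -[1]/(1%:~R) ler_int; have := ck; lia.
move=> /le_trans; apply; rewrite E normrM normrN ler_pM2l ?normr_gt0 //.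
apply: (le_trans (ler_norm_sum _ _ _)).
(* The constant is the coefficient sum of the dominating polynomial, that is, its value at 1. *)
have -> : ((N`! * B.+1 ^ N)%:R : C) = (q.[1])%:~R.
  rewrite /q hornerMn horner_exp !hornerE rmorphMn /= rmorphXn /= natrM natrX mulr_natl.
  by congr (_ ^+ _ *+ _); rewrite -add1n natrD rmorphD.
rewrite horner_coef rmorph_sum /=.
apply: (@le_trans _ _ (\sum_(k.+1 <= i < size chi) (q`_i)%:~R)).
  rewrite big_nat [leRHS]big_nat; apply: ler_sum => i _; rewrite normrM.
  apply: (@le_trans _ _ `|(chi`_i)%:~R|).
    by rewrite ler_piMr // normrX exprn_ile1.
  by rewrite -intr_norm ler_int.
have q0 i : 0 <= q`_i by apply: le_trans (dom i).
rewrite (eq_bigr (fun i : 'I_(size q) => (q`_i)%:~R)); last by move=> i _; rewrite expr1n mulr1.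
rewrite -(big_mkord xpredT (fun i => (q`_i)%:~R)).
have [le|lt] := leqP (size chi) (size q).
  rewrite [leRHS](big_cat_nat _ (n := size chi)) //=.
  rewrite [X in _ <= X + _](big_cat_nat _ (n := k.+1)) //=.
  rewrite -addrA addrCA lerDl addr_ge0 //; apply: sumr_ge0 => i _; by rewrite ler0z.
have szle : (size chi <= size q)%N.
  rewrite leqNgt; apply/negP => h.
  have := dom (size chi).-1; rewrite [q`_ _]nth_default; last by move: h; case: (size chi).
  by rewrite normr_le0 -/(lead_coef chi) lead_coef_eq0 (negPf chi0).
by move: lt; rewrite ltnNge szle.
Qed.

Lemma irep_int (m : int) : irep m%:~R 1 (absz m).
Proof.
exists m%:M, 1; split; first by apply/eqP => /matrixP /(_ 0 0) /eqP; rewrite !mxE oner_eq0.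
  by rewrite map_scalar_mx /= mul1mx; apply/matrixP => i j; rewrite !mxE !ord1 /= mulr1n mulr1.
by move=> i j; rewrite mxE !ord1 mulr1n abszE.
Qed.

(** Serves imaginary parts, where z - z^* is compared with an imaginary rational; (1, i) is an
    eigenvector of a scaled quarter turn. *)
Lemma irep_imagint (m : int) : irep ('i * m%:~R) 2 (absz m).
Proof.
exists (\matrix_(i < 2, j < 2) if i == j then 0 else if i == 0 then - m else m).
exists (\row_(j < 2) if j == 0 then 1 else 'i); split.
- by apply/eqP => /matrixP /(_ 0 0) /eqP; rewrite !mxE oner_eq0.
- apply/matrixP => i j; rewrite !mxE !big_ord_recl big_ord0 !mxE /=.
  case: j => [[|[|j]]] //= lt; rewrite ?mulr0z ?mulr1 ?mulr0 ?add0r ?addr0 ?mul1r //.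
  by rewrite mulrAC -expr2 sqrCi mulN1r mulrNz.
- by move=> i j; rewrite mxE abszE; case: ifP => // _; case: ifP; rewrite ?normrN.
Qed.

Lemma irep_scale (m : int) x N B : irep x N B -> irep (m%:~R * x) N (absz m * B).
Proof.
move=> [T [v [v0 eig hT]]]; exists (m *: T), v; split => //.
  by rewrite map_mxZ /= -scalemxAr eig scalerA.
by move=> i j; rewrite mxE normrM PoszM abszE ler_wpM2l.
Qed.

Lemma irep_conj x N B : irep x N B -> irep x^* N B.
Proof.
move=> [T [v [v0 eig hT]]]; exists T, (map_mx Num.conj v); split => //.
  by rewrite map_mx_eq0.
rewrite -[map_mx intr T](_ : map_mx Num.conj (map_mx intr T) = _).
  by rewrite -map_mxM eig map_mxZ.
by apply/matrixP => i j; rewrite !mxE; apply: CrealP; rewrite realz.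
Qed.

(** Kronecker sum: X |-> T^T X + X S has the rank-one eigenvector v^T w, and each of its entries
    involves at most one entry of [T] and one of [S]. *)
Lemma irep_add x y N M B B' : irep x N B -> irep y M B' -> irep (x + y) (N * M) (B + B').
Proof.
move=> [T [v [v0 Ev hT]]] [S [w [w0 Ew hS]]].
exists (lin_mx (mulmx T^T) + lin_mx (mulmxr S)), (mxvec (v^T *m w)).
have nz : v^T *m w != 0.
  have /rV0Pn [i vi] := v0; have /rV0Pn [j wj] := w0.
  apply/eqP => /matrixP /(_ i j) /eqP; rewrite !mxE big_ord1 !mxE mulf_eq0.
  by rewrite (negPf vi) (negPf wj).
split.
- by rewrite mxvec_eq0.
- rewrite map_mxD mulmxDr.
  rewrite (map_lin_mx (gf := mulmx (map_mx intr T^T))); last first.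
    by move=> X; rewrite map_mxM.
  rewrite (map_lin_mx (gf := mulmxr (map_mx intr S))); last first.
    by move=> X; rewrite /= map_mxM.
  rewrite !mul_vec_lin /= -map_trmx mulmxA -trmx_mul Ev -mulmxA Ew.
  by rewrite linearZ /= -scalemxAl -scalemxAr -linearD -scalerDl linearZ.
- move=> r c; case/mxvec_indexP: r => i j; case/mxvec_indexP: c => k l.
  rewrite mxE PoszD (le_trans (ler_normD _ _)) //.
  have E (f : {linear 'M[int]_(N, M) -> 'M[int]_(N, M)}) :
    lin_mx f (mxvec_index i j) (mxvec_index k l) = f (delta_mx i j) k l.
    by rewrite -[LHS]mul1r -[RHS](mxvecE) -mul_vec_lin mxvec_delta -rowE !mxE mul1r.
  apply: lerD; rewrite E /=.
    rewrite mxE (bigD1 i) //= big1 ?addr0 ?mxE ?eqxx /=.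
      by case: (l == j); rewrite ?mulr1 ?mulr0 ?normr0.
    by move=> m mi; rewrite !mxE (negPf mi) mulr0.
  rewrite mxE (bigD1 j) //= big1 ?addr0 ?mxE ?eqxx /=.
    by rewrite andbT; case: (k == i); rewrite ?mul1r ?mul0r ?normr0.
  by move=> m mi; rewrite !mxE (negPf mi) andbF mul0r.
Qed.

(** Companion matrix multiplied by the leading coefficient, which keeps the entries integral for a
    non-monic polynomial; the powers of [z] form the eigenvector. *)
Lemma irep_root_lead (D : nat) (c : nat -> int) (H : nat) z : (0 < D)%N ->
  (forall i, `|c i| <= H%:Z) ->
  \sum_(i < D.+1) (c i)%:~R * z ^+ i = 0 -> irep ((c D)%:~R * z) D H.
Proof.
move=> D0 hc rt.
exists (\matrix_(i < D, j < D) if j.+1 == D then - c i else if i == j.+1 :> nat then c D else 0).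
exists (\row_(j < D) z ^+ j); split.
- apply/eqP => /matrixP /(_ 0 (Ordinal D0)) /eqP; by rewrite !mxE oner_eq0.
- apply/matrixP => i j; rewrite !mxE.
  case: (eqVneq j.+1 D) => [jD|jD].
    move: rt; rewrite big_ord_recr /= => /eqP; rewrite addrC addr_eq0 => /eqP E.
    rewrite -mulrA -exprS jD E -sumrN; apply: eq_bigr => k _.
    by rewrite !mxE jD eqxx rmorphN mulrN mulrC.
  have ltj : (j.+1 < D)%N by rewrite ltn_neqAle jD ltn_ord.
  rewrite (bigD1 (Ordinal ltj)) //= big1 ?addr0.
    by rewrite !mxE (negPf jD) eqxx mulrC -mulrA -exprS.
  move=> k kj; rewrite !mxE (negPf jD); case: eqP => E; last by rewrite mulr0z mulr0.
  by case/eqP: kj; apply: val_inj.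
- move=> i j; rewrite mxE; case: ifP => _; first by rewrite normrN.
  by case: ifP => // _; rewrite normr0.
Qed.

End IntegralRep.

Definition denprod (p : seq rat) : nat := foldr (fun c n => (absz (denq c) * n)%N) 1%N p.
Definition numsum (p : seq rat) : nat := foldr (fun c n => (absz (numq c) + n)%N) 0%N p.
(** Bounds the coefficients once denominators are cleared; taking the product of the denominators as
    common multiple makes it a plain fold. *)
Definition height (p : seq rat) : nat := (denprod p * numsum p)%N.

Lemma cpt_height (A : countType) (f : A -> seq rat) : cpt f -> cpt (fun a => height (f a)).
Proof. by move=> hf; rewrite /height /denprod /numsum; ct. Qed.

Lemma denprod_gt0 p : (0 < denprod p)%N.
Proof.
elim: p => //= c p IH; rewrite muln_gt0 IH andbT absz_gt0; exact: denq_neq0.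
Qed.

Lemma denprod_dvd p i : (absz (denq (p`_i)%R) %| denprod p)%N.
Proof.
elim: p i => [|c p IH] [|i] //=; first exact: dvdn_mulr.
by apply: dvdn_mull; apply: IH.
Qed.

Lemma numsum_ge p i : (absz (numq (p`_i)%R) <= numsum p)%N.
Proof.
elim: p i => [|c p IH] [|i] //=; first exact: leq_addr.
by apply: leq_trans (IH i) _; apply: leq_addl.
Qed.

Definition intcoef (p : seq rat) (i : nat) : int :=
  numq p`_i * (denprod p %/ absz (denq p`_i))%N%:Z.

Lemma intcoefE p i : (intcoef p i)%:~R = (denprod p)%:R * p`_i :> rat.
Proof.
rewrite /intcoef -[p`_i in RHS]divq_num_den.
have [k ->] := dvdnP (denprod_dvd p i).
rewrite mulnK ?absz_gt0 ?denq_neq0 // intrM natrM.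
have -> : (absz (denq p`_i))%:R = (denq p`_i)%:~R :> rat.
  by rewrite -[RHS]/((denq _)%:~R) -{2}[denq p`_i]gez0_abs ?denq_ge0.
have : (denq p`_i)%:~R != 0 :> rat by rewrite intr_eq0 denq_neq0.
move=> h; rewrite mulrC -mulrA [_ * (_ / _)]mulrCA mulfV // mulr1 //.
Qed.

Lemma intcoef_le p i : `|intcoef p i| <= (height p)%:Z.
Proof.
rewrite /intcoef normrM -abszE mulrC PoszM ler_pM //; last first.
  by rewrite lez_nat numsum_ge.
by rewrite ger0_norm // lez_nat leq_div.
Qed.

Section RootBound.
Variable C : numClosedFieldType.
Implicit Types z w : C.

Fixpoint pev (p : seq rat) z : C := if p is c :: p' then ratr c + z * pev p' z else 0.

Lemma pevE p z : pev p z = \sum_(i < size p) ratr p`_i * z ^+ i.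
Proof.
elim: p => [|c p IH] /=; first by rewrite big_ord0.
rewrite big_ord_recl expr0 mulr1 IH mulr_sumr /=; congr (_ + _).
by apply: eq_bigr => i _; rewrite /= exprS mulrCA.
Qed.

Lemma pev_Poly p z : pev p z = (map_poly ratr (Poly p)).[z].
Proof.
elim: p => [|c p IH] /=; first by rewrite rmorph0 horner0.
by rewrite cons_poly_def rmorphD rmorphM /= map_polyX map_polyC !hornerE -IH addrC mulrC.
Qed.

(* For a root z of p of height h, some l * z with |l| <= h is an eigenvalue of an
   integer matrix; with a = s / t, so is t * l * (z + z^* - 2 * a), to which
   [irep_lower_bound] applies. *)
Definition rbound (p : seq rat) (a : rat) : rat :=
  let t := absz (denq a) in let s := absz (numq a) in
  let h := height p in let N := (2 * (size p * size p))%N in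
  let B := (2 * (t + s) * h)%N in
  ((2 * t * h).+1 * (N`! * B.+1 ^ N))%N%:R^-1.

Lemma rbound_gt0 p a : 0 < rbound p a.
Proof. by rewrite /rbound invr_gt0 ltr0n muln_gt0 /= muln_gt0 fact_gt0 expn_gt0. Qed.

(** The list may end in zeros, so [l] is the last nonzero cleared coefficient and [D] the true
    degree. *)
Lemma irep_root p z : has (fun q => q != 0) p -> pev p z = 0 ->
  exists l : int, exists D : nat, [/\ l != 0, `|l| <= (height p)%:Z, (D <= size p)%N &
    irep (l%:~R * z) D (height p)].
Proof.
move=> nz rt.
have exk : exists k, intcoef p k != 0.
  have /hasP [q /(nthP 0) [i lti E] q0] := nz.
  exists i; rewrite -(intr_eq0 rat) intcoefE E mulf_eq0 (negPf q0) orbF.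
  by rewrite pnatr_eq0 -lt0n denprod_gt0.
have bnd k : intcoef p k != 0 -> (k <= size p)%N.
  move=> h; rewrite leqNgt; apply/negP => lt; case/eqP: h.
  by rewrite /intcoef nth_default ?(ltnW lt) // mul0r.
case: (ex_maxnP exk bnd) => D cD Dmax.
have H i : (intcoef p i)%:~R = (denprod p)%:R * ratr p`_i :> C.
  by rewrite -ratr_int intcoefE rmorphM /= ratr_nat.
have ltD : (D < size p)%N.
  rewrite ltnNge; apply: contra cD => h.
  by rewrite /intcoef nth_default // mul0r.
have rt2 : \sum_(i < D.+1) (intcoef p i)%:~R * z ^+ i = 0.
  have : (denprod p)%:R * pev p z = 0 by rewrite rt mulr0.
  rewrite pevE mulr_sumr -(big_mkord xpredT (fun i => (denprod p)%:R * (ratr p`_i * z ^+ i))).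
  rewrite (big_cat_nat _ (n := D.+1)) //= [X in _ + X]big_nat [X in _ + X]big1 ?addr0; last first.
    move=> i /andP[lt _]; rewrite mulrA -H.
    case: (eqVneq (intcoef p i) 0) => [->|/Dmax]; first by rewrite mulr0z mul0r.
    by rewrite leqNgt lt.
  by rewrite big_mkord => E; rewrite -[RHS]E; apply: eq_bigr => i _; rewrite mulrA -H.
have D0 : (0 < D)%N.
  rewrite lt0n; apply/eqP => E; move: rt2 cD; rewrite E big_ord1 expr0 mulr1 => /eqP.
  by rewrite intr_eq0 => ->.
exists (intcoef p D), D; split => //; [exact: intcoef_le|exact: ltnW|].
by apply: irep_root_lead => // i; apply: intcoef_le.
Qed.

Lemma bound_mono N B N' B' : (N <= N')%N -> (B <= B')%N ->
  (N`! * B.+1 ^ N <= N'`! * B'.+1 ^ N')%N.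
Proof.
move=> h h'; apply: leq_mul.
  elim: N' h {B B' h'} => [|n IH]; first by rewrite leqn0 => /eqP->.
  rewrite leq_eqVlt => /orP[/eqP->//|]; rewrite ltnS => /IH /leq_trans; apply.
  by rewrite factS leq_pmull.
apply: (@leq_trans (B'.+1 ^ N)); last by rewrite leq_pexp2l.
by case: N h => // n _; rewrite leq_exp2r.
Qed.

Lemma ratr_num_den (a : rat) : (denq a)%:~R * ratr a = (numq a)%:~R :> C.
Proof.
rewrite -[a in ratr a]divq_num_den fmorph_div /= !ratr_int mulrCA mulfV ?mulr1 //.
by rewrite intr_eq0 denq_neq0.
Qed.

Lemma rbound_aux p (a : rat) (l : int) x N B u : l != 0 ->
  `|l| <= (height p)%:Z -> (N <= 2 * (size p * size p))%N ->
  (B <= 2 * (absz (denq a) + absz (numq a)) * height p)%N ->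
  @irep C x N B -> 0 < u -> `|x| = 2 * (absz (denq a))%:R * `|l|%:~R * u ->
  ratr (rbound p a) <= u.
Proof.
move=> l0 hl leN leB hx u0 Ex.
have x0 : x != 0.
  by rewrite -normr_gt0 Ex !mulr_gt0 ?ltr0n ?absz_gt0 ?denq_neq0 // ltr0z normr_gt0.
have h1 := irep_lower_bound hx x0.
have h2 := bound_mono leN leB.
rewrite /rbound fmorphV /= ratr_nat -[X in X <= _]mulr1 mulrC ler_pdivrMr; last first.
  by rewrite ltr0n muln_gt0 /= muln_gt0 fact_gt0 expn_gt0.
set M' := (_`! * _)%N in h2 *; set M := (_ * _)%N in h1 h2.
apply: (le_trans h1); rewrite Ex natrM mulrA.
apply: ler_pM; rewrite ?mulr_ge0 ?ler0n ?ler0z ?(ltW u0) //; last by rewrite ler_nat.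
rewrite mulrC; apply: ler_wpM2l; first exact: ltW.
apply: (@le_trans _ _ (2 * absz (denq a) * height p)%:R); last by rewrite ler_nat.
have hl' : `|l|%:~R <= (height p)%:R :> C by rewrite pmulrn ler_int.
have hl0 : 0 <= `|l|%:~R :> C by rewrite ler0z normr_ge0.
rewrite !natrM; apply: ler_pM => //; last by rewrite -natrM.
by apply: mulr_ge0; apply: ler0n.
Qed.

Lemma absz_num_le (s l : int) (t h : nat) : `|l| <= h%:Z ->
  (t * h + t * h + absz (2 * s * l)%R <= 2 * (t + absz s) * h)%N.
Proof.
move=> hl; rewrite !abszM mulnDr mulnDl leq_add //; first by rewrite -mulnA mul2n -addnn.
by rewrite leq_mul2l -lez_nat abszE hl orbT.
Qed.

Lemma conj_int_scale (m : int) z : (m%:~R * z)^* = m%:~R * z^*.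
Proof. by rewrite rmorphM /= conj_Creal ?realz. Qed.

Lemma rbound_Re p (a : rat) z : has (fun q => q != 0) p -> pev p z = 0 ->
  'Re z != ratr a -> ratr (rbound p a) <= `|'Re z - ratr a|.
Proof.
move=> nz rt ne; have [l [D [l0 hl leD ir]]] := irep_root nz rt.
have i1 := irep_scale (denq a) ir.
have i2 := irep_conj i1.
have i3 := irep_int C (- (2 * numq a * l)).
have i4 := irep_add (irep_add i1 i2) i3.
apply: (rbound_aux l0 hl _ _ i4).
- by rewrite muln1 (leq_trans (leq_mul leD leD)) // leq_pmull.
- by rewrite abszN; apply: absz_num_le.
- by rewrite normr_gt0 subr_eq0.
rewrite !conj_int_scale.
have -> : (- (2 * numq a * l))%:~R = - (2 * ((denq a)%:~R * ratr a) * l%:~R) :> C.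
  by rewrite ratr_num_den rmorphN /= !rmorphM.
have -> : (denq a)%:~R * (l%:~R * z) + (denq a)%:~R * (l%:~R * z^*) -
   2 * ((denq a)%:~R * ratr a) * l%:~R = 2 * (denq a)%:~R * l%:~R * ('Re z - ratr a).
  have h : z + z^* = 2 * 'Re z.
    by rewrite {1 2}[z]Crect rmorphD rmorphM /= conjCi !conj_Creal ?Creal_Re ?Creal_Im //; ring.
  transitivity ((denq a)%:~R * l%:~R * (z + z^*) - 2 * ((denq a)%:~R * ratr a) * l%:~R); first by ring.
  by rewrite h; ring.
rewrite !normrM normr_nat; congr (_ * _ * _ * _); last by rewrite intr_norm.
by rewrite -intr_norm -abszE.
Qed.

(** As for real parts, with z - z^* in place of z + z^*; the summand of dimension 2 from
    [irep_imagint] is the origin of the factor 2 in the dimension used by [rbound]. *)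
Lemma rbound_Im p (a : rat) z : has (fun q => q != 0) p -> pev p z = 0 ->
  'Im z != ratr a -> ratr (rbound p a) <= `|'Im z - ratr a|.
Proof.
move=> nz rt ne; have [l [D [l0 hl leD ir]]] := irep_root nz rt.
have i1 := irep_scale (denq a) ir.
have i2 := irep_scale (-1) (irep_conj i1).
have i3 := irep_imagint C (- (2 * numq a * l)).
have i4 := irep_add (irep_add i1 i2) i3.
apply: (rbound_aux l0 hl _ _ i4).
- by rewrite mulnC leq_mul // leq_mul.
- by rewrite abszN1 mul1n abszN; apply: absz_num_le.
- by rewrite normr_gt0 subr_eq0.
rewrite !conj_int_scale.
have -> : (- (2 * numq a * l))%:~R = - (2 * ((denq a)%:~R * ratr a) * l%:~R) :> C.
  by rewrite ratr_num_den rmorphN /= !rmorphM.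
have -> : (denq a)%:~R * (l%:~R * z) + -1 * ((denq a)%:~R * (l%:~R * z^*)) +
   'i * - (2 * ((denq a)%:~R * ratr a) * l%:~R) = 'i * (2 * (denq a)%:~R * l%:~R * ('Im z - ratr a)).
  have h : z - z^* = 2 * 'i * 'Im z.
    by rewrite {1 2}[z]Crect rmorphD rmorphM /= conjCi !conj_Creal ?Creal_Re ?Creal_Im //; ring.
  transitivity ((denq a)%:~R * l%:~R * (z - z^*) - 'i * (2 * ((denq a)%:~R * ratr a) * l%:~R)); first by ring.
  by rewrite h; ring.
rewrite !normrM normCi mul1r normr_nat; congr (_ * _ * _ * _); last by rewrite intr_norm.
by rewrite -intr_norm -abszE.
Qed.

End RootBound.

Lemma cpt_rbound (A : countType) (p : A -> seq rat) (a : A -> rat) :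
  cpt p -> cpt a -> cpt (fun x => rbound (p x) (a x)).
Proof.
move=> hp ha; rewrite /rbound /=.
have hh := cpt_height hp.
have hf (f : A -> nat) : cpt f -> cpt (fun x => (f x)`!).
  move=> hf; apply: (@cpt_ext _ _ (fun x => nat_rect (fun=> nat) 1%N (fun n r => n.+1 * r)%N (f x))).
    by move=> x; elim: (f x) => // n IH; rewrite factS -IH.
  by ct.
have h2 : cpt (fun x => (2 * (size (p x) * size (p x)))`!) by apply: hf; ct.
by ct.
Qed.

(** * Gaussian rationals and the search for an approximate root *)

Notation gq := (rat * rat)%type.
Definition gadd (x y : gq) : gq := (x.1 + y.1, x.2 + y.2).
Definition gmul (x y : gq) : gq := (x.1 * y.1 - x.2 * y.2, x.1 * y.2 + x.2 * y.1).
Definition gconj (x : gq) : gq := (x.1, - x.2).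
Definition gscale (q : rat) (x : gq) : gq := (q * x.1, q * x.2).
Definition gnorm2 (x : gq) : rat := x.1 * x.1 + x.2 * x.2.

Section CptGq.
Variable A : countType.
Implicit Types (f g : A -> gq).
Lemma cpt_gadd f g : cpt f -> cpt g -> cpt (fun a => gadd (f a) (g a)).
Proof. by move=> hf hg; rewrite /gadd; ct. Qed.
Lemma cpt_gmul f g : cpt f -> cpt g -> cpt (fun a => gmul (f a) (g a)).
Proof. by move=> hf hg; rewrite /gmul; ct. Qed.
Lemma cpt_gconj f : cpt f -> cpt (fun a => gconj (f a)).
Proof. by move=> hf; rewrite /gconj; ct. Qed.
Lemma cpt_gscale (q : A -> rat) f : cpt q -> cpt f -> cpt (fun a => gscale (q a) (f a)).
Proof. by move=> hq hf; rewrite /gscale; ct. Qed.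
Lemma cpt_gnorm2 f : cpt f -> cpt (fun a => gnorm2 (f a)).
Proof. by move=> hf; rewrite /gnorm2; ct. Qed.
End CptGq.

Ltac ct_gauss := lazymatch goal with
 | |- cpt (fun a => gadd (@?f a) (@?g a)) => refine (cpt_gadd _ _)
 | |- cpt (fun a => gmul (@?f a) (@?g a)) => refine (cpt_gmul _ _)
 | |- cpt (fun a => gconj (@?f a)) => refine (cpt_gconj _)
 | |- cpt (fun a => gscale (@?f a) (@?g a)) => refine (cpt_gscale _ _)
 | |- cpt (fun a => gnorm2 (@?f a)) => refine (cpt_gnorm2 _)
 | |- cpt (fun a => rbound (@?f a) (@?g a)) => refine (cpt_rbound _ _)
 end.
Ltac ct_ext ::= first [ct_nat | ct_div | ct_fold | ct_seq | ct_rat | ct_rat_ops | ct_obind | ct_gauss | ct_int].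

Section GqSem.
Variable C : numClosedFieldType.
Implicit Types z w : C.

Definition gz (x : gq) : C := ratr x.1 + 'i * ratr x.2.

Lemma ratr_real (q : rat) : ratr q \is @Num.real C.
Proof. by rewrite realE ler0q lerq0 -realE num_real. Qed.

Lemma conj_ratr (q : rat) : (ratr q)^* = ratr q :> C.
Proof. by rewrite conj_Creal // ratr_real. Qed.

Lemma gzD x y : gz (gadd x y) = gz x + gz y.
Proof. by rewrite /gz /= !rmorphD /=; ring. Qed.
Lemma gzM x y : gz (gmul x y) = gz x * gz y.
Proof.
rewrite /gz /= rmorphB rmorphD /= !rmorphM /=.
transitivity ((ratr x.1 : C) * ratr y.1 + 'i ^+ 2 * (ratr x.2 * ratr y.2) +
  'i * (ratr x.1 * ratr y.2 + ratr x.2 * ratr y.1)); last by ring.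
by rewrite sqrCi; ring.
Qed.
Lemma gz_conj x : gz (gconj x) = (gz x)^*.
Proof. by rewrite /gz /= rmorphD rmorphM /= conjCi !conj_ratr rmorphN /=; ring. Qed.
Lemma gz_scale q x : gz (gscale q x) = ratr q * gz x.
Proof. by rewrite /gz /= !rmorphM /=; ring. Qed.
Lemma gz0 : gz (0, 0) = 0.
Proof. by rewrite /gz /= rmorph0 mulr0 addr0. Qed.
Lemma gz_rat q : gz (q, 0) = ratr q.
Proof. by rewrite /gz /= rmorph0 mulr0 addr0. Qed.
Lemma gz_norm2 x : ratr (gnorm2 x) = `|gz x| ^+ 2.
Proof.
by rewrite normCK -gz_conj -gzM /gz /gmul /gconj /gnorm2 /= -[LHS]addr0 -(mulr0 'i) -(rmorph0 ratr);
   congr (ratr _ + 'i * ratr _); ring.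
Qed.
Lemma Re_gz x : 'Re (gz x) = ratr x.1.
Proof. by rewrite /gz Re_rect ?ratr_real. Qed.
Lemma Im_gz x : 'Im (gz x) = ratr x.2.
Proof. by rewrite /gz Im_rect ?ratr_real. Qed.

Lemma norm_Re_le z : `|'Re z| <= `|z|.
Proof.
rewrite real_ler_norml ?Creal_Re // lerNl -raddfN /=.
by rewrite -{1}[`|z|]normrN !leif_Re_Creal.
Qed.

Lemma norm_Im_le z : `|'Im z| <= `|z|.
Proof.
have -> : 'Im z = 'Re (- 'i * z).
  have -> : - 'i * z = 'Im z + 'i * (- 'Re z).
    rewrite {1}[z]Crect; transitivity (- ('i ^+ 2) * 'Im z + 'i * (- 'Re z)); first by ring.
    by rewrite sqrCi opprK mul1r.
  by rewrite Re_rect ?rpredN ?Creal_Re ?Creal_Im.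
by apply: le_trans (norm_Re_le _) _; rewrite normrM normrN normCi mul1r.
Qed.

Lemma gz_dist x z : `|gz x - z| <= `|ratr x.1 - 'Re z| + `|ratr x.2 - 'Im z|.
Proof.
have -> : gz x - z = (ratr x.1 - 'Re z) + 'i * (ratr x.2 - 'Im z).
  by rewrite {1}[z]Crect /gz; ring.
by rewrite (le_trans (ler_normD _ _)) // normrM normCi mul1r.
Qed.

End GqSem.

Definition gpev (p : seq rat) (z : gq) : gq :=
  foldr (fun (c : rat) (acc : gq) => gadd (c, 0) (gmul z acc)) ((0, 0) : gq) p.

(** Horner recursion on the disc of radius [R]: the first component bounds the modulus, the second
    is a Lipschitz constant, by the product rule for c + z p. *)
Definition lipfold (R : rat) (p : seq rat) : gq :=
  foldr (fun (c : rat) (s : gq) => (`|c| + R * s.1, s.1 + R * s.2) : gq) ((0, 0) : gq) p.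

Definition trim (p : seq rat) : seq rat :=
  foldr (fun c s => if nilp s && (c == 0) then [::] else c :: s) [::] p.

Lemma trimE p : trim p = Poly p :> seq rat.
Proof.
elim: p => [|c p IH] /=; first by rewrite polyseq0.
rewrite IH polyseq_cons; case: ifP => h; first by rewrite (nilP (andP h).1) (eqP (andP h).2) polyseqC eqxx.
case: ifP => h'; first by [].
move: h; rewrite (negbFE h') /= => c0.
by rewrite (nilP (negbFE h')) polyseqC c0.
Qed.

Definition minq (x y : rat) := if x <= y then x else y.

Lemma minq_le (x y z : rat) : (x <= z) || (y <= z) -> minq x y <= z.
Proof.
by rewrite /minq; case: (leP x y) => [h|/ltW h] /orP[] h2 //; apply: le_trans h h2.
Qed.
Lemma cpt_minq (A : countType) (x y : A -> rat) :
  cpt x -> cpt y -> cpt (fun a => minq (x a) (y a)).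
Proof. by move=> hx hy; rewrite /minq; ct. Qed.
Lemma minq_gt0 (x y : rat) : 0 < x -> 0 < y -> 0 < minq x y.
Proof. by rewrite /minq; case: ifP. Qed.

Definition polydeg (p : seq rat) := (size (trim p)).-1.
Definition polylead (p : seq rat) := nth 0 p (polydeg p).

Notation box := (rat * rat * rat * rat)%type.
Definition rootsep (p : seq rat) (bx : box) : rat :=
  minq (minq (rbound p bx.1.1.1) (rbound p bx.1.1.2))
       (minq (rbound p bx.1.2) (rbound p bx.2)).
(* An accepted point is at distance more than eta from the edges of the box and has
   a root within eta, which must be the coded one. The coded root stays 4 * eta away
   from the edges, so a fine enough grid contains an accepted point. *)
Definition apr_eta p bx (t : nat) : rat := minq (rootsep p bx / 4) (2 ^+ t)^-1.
Definition apr_rad (bx : box) : rat :=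
  1 + `|bx.1.1.1| + `|bx.1.1.2| + `|bx.1.2| + `|bx.2|.
Definition apr_tol p (eta : rat) : rat := `|polylead p| * eta ^+ polydeg p.
(** A grid point within 2 h of the root has a value of modulus at most 2 h K, with K the Lipschitz
    bound; the second term brings this below [apr_tol], and the + 1 keeps the divisor positive. *)
Definition apr_step p bx t : rat :=
  minq (apr_eta p bx t)
    (apr_tol p (apr_eta p bx t) / (2 * ((lipfold (apr_rad bx) p).2 + 1))).
(** The numerator of a nonnegative rational is at least that rational, which gives an integer bound
    on the number of steps. *)
Definition apr_num (lo hi h : rat) : nat := (absz (numq ((hi - lo) / h))).+1.
Definition apr_ok p (bx : box) eta (z : gq) : bool :=
  [&& bx.1.1.1 + eta < z.1, z.1 + eta < bx.1.1.2, bx.1.2 + eta < z.2, z.2 + eta < bx.2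
    & gnorm2 (gpev p z) <= apr_tol p eta ^+ 2].
Definition apr_grid (bx : box) (h : rat) : seq gq :=
  flatten (map (fun i => map (fun j => (bx.1.1.1 + i%:R * h, bx.1.2 + j%:R * h))
    (iota 0 (apr_num bx.1.2 bx.2 h))) (iota 0 (apr_num bx.1.1.1 bx.1.1.2 h))).
Definition appr (c : seq rat * box) (t : nat) : gq :=
  head (0, 0) (filter (fun z => apr_ok c.1 c.2 (apr_eta c.1 c.2 t) z)
    (apr_grid c.2 (apr_step c.1 c.2 t))).

Lemma cpt_apr_rad (A : countType) (f : A -> box) : cpt f -> cpt (fun a => apr_rad (f a)).
Proof. by move=> hf; rewrite /apr_rad; ct. Qed.

Lemma cpt_lipfold (A : countType) (f : A -> seq rat) (R : A -> rat) :
  cpt f -> cpt R -> cpt (fun a => lipfold (R a) (f a)).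
Proof.
move=> hf hR; rewrite /lipfold.
by ct.
Qed.

Lemma cpt_appr (A : countType) (f : A -> seq rat * box) (g : A -> nat) :
  cpt f -> cpt g -> cpt (fun a => appr (f a) (g a)).
Proof.
move=> hf hg.
have htrim (D : countType) (p : D -> seq rat) : cpt p -> cpt (fun a => polydeg (p a)).
  by move=> *; rewrite /polydeg /trim; ct.
have hlead (D : countType) (p : D -> seq rat) : cpt p -> cpt (fun a => polylead (p a)).
  by move=> *; rewrite /polylead; ct; apply: htrim; ct.
have hsep : cpt (fun a => rootsep (f a).1 (f a).2).
  by rewrite /rootsep; apply: cpt_minq; apply: cpt_minq; ct.
have heta : cpt (fun a => apr_eta (f a).1 (f a).2 (g a)).
  by rewrite /apr_eta; apply: cpt_minq; ct.
have htol (D : countType) (p : D -> seq rat) e : cpt p -> cpt e -> cpt (fun a => apr_tol (p a) (e a)).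
  by move=> hp he; have h1 := htrim _ _ hp; have h2 := hlead _ _ hp; rewrite /apr_tol; ct.
have hstep : cpt (fun a => apr_step (f a).1 (f a).2 (g a)).
  have hl : cpt (fun a => lipfold (apr_rad (f a).2) (f a).1) by apply: cpt_lipfold; ct; apply: cpt_apr_rad; ct.
  have ht := htol _ (fun a => (f a).1) _ (cpt_fst hf) heta.
  by rewrite /apr_step; apply: cpt_minq; ct.
have hnum (D : countType) (x y z : D -> rat) : cpt x -> cpt y -> cpt z ->
    cpt (fun a => apr_num (x a) (y a) (z a)).
  by move=> *; rewrite /apr_num; ct.
have hgrid : cpt (fun a => apr_grid (f a).2 (apr_step (f a).1 (f a).2 (g a))).
  by rewrite /apr_grid; ct; try (apply: hnum; ct); apply: (cpt_comp hstep); ct.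
rewrite /appr; ct.
rewrite /apr_ok /gpev; ct; try (apply: (cpt_comp heta (f := fun p => p.1)); ct).
by apply: htol; ct; apply: (cpt_comp heta (f := fun p => p.1)); ct.
Qed.

Section ApprCorrect.
Variable C : numClosedFieldType.
Implicit Types z w : C.

Lemma gpevE p x : gz C (gpev p x) = pev p (gz C x).
Proof. by elim: p => [|c p IH] /=; rewrite ?gz0 // gzD gzM IH gz_rat. Qed.

Lemma lipfold_ge0 R p : 0 <= R -> (0 <= (lipfold R p).1) && (0 <= (lipfold R p).2).
Proof.
move=> R0; elim: p => //= c p /andP[h1 h2]; apply/andP; split.
  by rewrite addr_ge0 // mulr_ge0.
by rewrite addr_ge0 // mulr_ge0.
Qed.

Lemma lipfold_bound R p z : 0 <= R -> `|z| <= ratr R -> `|pev p z| <= ratr (lipfold R p).1.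
Proof.
move=> R0 hz; elim: p => [|c p IH] /=; first by rewrite normr0 rmorph0.
rewrite rmorphD rmorphM /= (le_trans (ler_normD _ _)) // ratr_norm lerD2l normrM.
by rewrite ler_pM.
Qed.

Lemma lipfoldP R p z w : 0 <= R -> `|z| <= ratr R -> `|w| <= ratr R ->
  `|pev p z - pev p w| <= `|z - w| * ratr (lipfold R p).2.
Proof.
move=> R0 hz hw; elim: p => [|c p IH] /=; first by rewrite subrr normr0 rmorph0 mulr0.
have -> : ratr c + z * pev p z - (ratr c + w * pev p w) =
  (z - w) * pev p z + w * (pev p z - pev p w) by ring.
rewrite (le_trans (ler_normD _ _)) // !normrM rmorphD mulrDr lerD //.
  by rewrite ler_wpM2l // lipfold_bound.
by rewrite rmorphM /= mulrCA ler_pM.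
Qed.

Lemma polylead_neq0 p : has (fun q => q != 0) p -> polylead p != 0.
Proof.
move=> nz; have P0 : Poly p != 0.
  apply/eqP => E; move/hasP: nz => [q /(nthP 0)[i _ <-]].
  by have := coef_Poly p i; rewrite E coef0 => <-; rewrite eqxx.
by rewrite /polylead /polydeg trimE -coef_Poly -/(lead_coef _) lead_coef_eq0.
Qed.

(** The modulus of p(w) is that of the leading coefficient times the product of the distances from
    [w] to the roots; were all these above [eta], the value would exceed [apr_tol]. *)
Lemma small_value_near_root p w (eta : rat) : has (fun q => q != 0) p -> 0 <= eta ->
  (0 < polydeg p)%N ->
  `|pev p w| <= ratr (apr_tol p eta) -> exists2 z, pev p z = 0 & `|w - z| <= ratr eta.
Proof.
move=> nz eta0 deg0 hw.
have [r Er] := closed_field_poly_normal (map_poly (@ratr C) (Poly p)).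
have l0 := polylead_neq0 nz.
have El : lead_coef (map_poly (@ratr C) (Poly p)) = ratr (polylead p).
  by rewrite lead_coef_map /polylead /polydeg trimE -coef_Poly.
have szr : size r = polydeg p.
  have := congr1 (fun q : {poly C} => size q) Er; rewrite El size_scale ?fmorph_eq0 //.
  by rewrite size_prod_XsubC size_map_poly /polydeg trimE => ->.
have ev u : pev p u = ratr (polylead p) * \prod_(z <- r) (u - z).
  rewrite pev_Poly Er El hornerZ horner_prod; congr (_ * _).
  by apply: eq_bigr => z _; rewrite hornerXsubC.
have [/hasP[z zr hz]|/hasPn far] := boolP (has (fun z => `|w - z| <= ratr eta) r).
  exists z => //; rewrite ev (big_rem z) //=; by rewrite subrr mul0r mulr0.
have : ratr eta ^+ size r < \prod_(z <- r) `|w - z|.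
  have -> : ratr eta ^+ size r = \prod_(z <- r) ratr eta :> C.
    by elim: (r) => [|u s IH]; rewrite ?big_nil // big_cons exprS IH.
  rewrite big_seq [ltRHS]big_seq.
  apply: ltr_prod.
    by apply/hasP; case: (r) szr deg0 => [<-//|z r' _ _]; exists z; rewrite ?inE ?eqxx.
  move=> z /far h; rewrite ler0q eta0 /=.
  by rewrite real_ltNge ?normr_real ?ratr_real.
rewrite szr => lt; move: hw; rewrite ev normrM normr_prod /apr_tol rmorphM rmorphXn /= ratr_norm.
rewrite ler_pM2l ?normr_gt0 ?fmorph_eq0 // => le; have := lt_le_trans lt le.
by rewrite ltxx.
Qed.

Lemma root_polydeg_gt0 p z : has (fun q => q != 0) p -> pev p z = 0 -> (0 < polydeg p)%N.
Proof.
move=> nz; rewrite lt0n; apply: contraPN => /eqP E.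
have l0 := polylead_neq0 nz.
have sz : (size (Poly p) <= 1)%N by move: E; rewrite /polydeg trimE; case: size => [|[]].
rewrite pev_Poly (size1_polyC sz) map_polyC hornerC /= => /eqP.
by rewrite fmorph_eq0 coef_Poly -[0%N]E (negPf l0).
Qed.

Lemma grid_point (lo hi h : rat) (x : C) : x \is Num.real -> 0 < h ->
  ratr lo < x -> x < ratr hi ->
  exists2 i, (i < apr_num lo hi h)%N & (ratr (lo + i%:R * h) <= x) && (x < ratr (lo + i%:R * h + h)).
Proof.
move=> xr h0 h1 h2.
pose k := absz (numq ((hi - lo) / h)).
have hk : hi <= lo + k%:R * h + h.
  suff : (hi - lo) / h <= k%:R by rewrite ler_pdivrMr // => ?; lra.
  set q := _ / h; have q0 : 0 <= q.
    apply: divr_ge0; last exact: ltW.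
    by rewrite subr_ge0; apply: ltW; rewrite -(ltr_rat C); apply: lt_trans h2.
  have -> : k%:R = (numq q)%:~R :> rat.
    by rewrite -[in RHS](gez0_abs (m := numq q)) ?numq_ge0.
  rewrite -{1}[q]divq_num_den ler_pdivrMr ?ltr0z ?denq_gt0 // ler_peMr ?ler0z ?numq_ge0 //.
  by rewrite -[1]/(1%:~R) ler_int; have := denq_gt0 q; lia.
have exi : exists i, x < ratr (lo + i%:R * h + h).
  by exists k; apply: lt_le_trans h2 _; rewrite ler_rat.
case: (ex_minnP exi) => i lti mini; exists i.
  by rewrite ltnS; apply: mini; apply: lt_le_trans h2 _; rewrite ler_rat.
rewrite lti andbT; case: i lti mini => [|i] lti mini; first by rewrite mul0r addr0 ltW.
rewrite real_leNgt ?ratr_real //; apply/negP => lt.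
have := mini i; rewrite ltnn => /(_ _) H; suff : false by []; apply: H.
by apply: lt_le_trans lt _; rewrite ler_rat -natr1; lra.
Qed.

Lemma norm_rat_between (a b : rat) (x : C) : x \is Num.real ->
  ratr a <= x -> x <= ratr b -> `|x| <= ratr (`|a| + `|b|).
Proof.
move=> xr h1 h2; rewrite real_ler_norml //; apply/andP; split.
  apply: le_trans h1; rewrite -rmorphN /= ler_rat.
  by have := normr_ge0 b; have := ler_norm (- a); rewrite normrN; lra.
by apply: le_trans h2 _; rewrite ler_rat; have := normr_ge0 a; have := ler_norm b; lra.
Qed.

Lemma grid_margins (a b x h e : rat) : 0 < e -> h <= e -> a + 4 * e < x + h ->
  x <= b - 4 * e -> [/\ a <= x, x <= b, a + e < x & x + e < b].
Proof. by move=> *; split; lra. Qed.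

Lemma appr_correct p (bx : box) t z : has (fun q => q != 0) p -> pev p z = 0 ->
  ratr bx.1.1.1 < 'Re z -> 'Re z < ratr bx.1.1.2 ->
  ratr bx.1.2 < 'Im z -> 'Im z < ratr bx.2 ->
  (forall w, pev p w = 0 -> ratr bx.1.1.1 < 'Re w -> 'Re w < ratr bx.1.1.2 ->
     ratr bx.1.2 < 'Im w -> 'Im w < ratr bx.2 -> w = z) ->
  `|gz C (appr (p, bx) t) - z| <= ratr (2 ^+ t)^-1.
Proof.
move=> nz rt ha hb hc hd uq.
have deg0 := root_polydeg_gt0 nz rt.
have sep0 : 0 < rootsep p bx by rewrite /rootsep !minq_gt0 ?rbound_gt0.
pose eta := apr_eta p bx t; pose h := apr_step p bx t.
have -> : appr (p, bx) t = head (0, 0) (filter (apr_ok p bx eta) (apr_grid bx h)) by [].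
have eta0 : 0 < eta by rewrite /eta /apr_eta minq_gt0 ?divr_gt0 ?invr_gt0 ?exprn_gt0.
have eta_sep : 4 * eta <= rootsep p bx.
  suff : eta <= rootsep p bx / 4 by lra.
  by apply: minq_le; rewrite lexx.
have eta_t : eta <= (2 ^+ t)^-1 by apply: minq_le; rewrite lexx orbT.
have rad1 : 1 <= apr_rad bx by rewrite /apr_rad -!addrA lerDl !addr_ge0.
have rad0 : 0 <= apr_rad bx by lra.
have /andP[_ K0] := lipfold_ge0 p rad0.
have l0 := polylead_neq0 nz.
have tol0 : 0 < apr_tol p eta by rewrite /apr_tol mulr_gt0 ?normr_gt0 ?exprn_gt0.
have den0 : 0 < 2 * ((lipfold (apr_rad bx) p).2 + 1) by lra.
have h0 : 0 < h by rewrite /h /apr_step minq_gt0 // divr_gt0.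
have h_eta : h <= eta by apply: minq_le; rewrite lexx.
have h_tol : h * (2 * ((lipfold (apr_rad bx) p).2 + 1)) <= apr_tol p eta.
  by rewrite -ler_pdivlMr //; apply: minq_le; rewrite lexx orbT.
(* The separation bound keeps both parts of a root at least 4 eta away from every edge. *)
have sepE q : rootsep p bx <= rbound p q -> forall u : C, u != ratr q ->
   u \is Num.real ->
   (u != ratr q -> ratr (rbound p q) <= `|u - ratr q|) ->
   (ratr q < u -> ratr (q + 4 * eta) <= u) /\ (u < ratr q -> u <= ratr (q - 4 * eta)).
  move=> le u ne ur H; have {}H := H ne.
  have le4 : ratr (4 * eta) <= `|u - ratr q|.
    by apply: le_trans H; rewrite ler_rat; apply: le_trans eta_sep le.
  split=> lt.
    by move: le4; rewrite gtr0_norm ?subr_gt0 // lerBrDr addrC -rmorphD.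
  by move: le4; rewrite ltr0_norm ?subr_lt0 // opprB lerBrDr addrC -lerBrDr -rmorphB.
have [s1 s2 s3 s4] : [/\ rootsep p bx <= rbound p bx.1.1.1, rootsep p bx <= rbound p bx.1.1.2,
     rootsep p bx <= rbound p bx.1.2 & rootsep p bx <= rbound p bx.2].
  by split; do 2 (apply: minq_le; rewrite ?lexx ?orbT //; try (apply/orP; (left + right)));
     rewrite ?(minq_le, lexx, orbT).
have Rr := Creal_Re z; have Ir := Creal_Im z.
have [A _] := sepE _ s1 _ (negbT (gt_eqF ha)) Rr (rbound_Re nz rt); have {}A := A ha.
have [_ B] := sepE _ s2 _ (negbT (lt_eqF hb)) Rr (rbound_Re nz rt); have {}B := B hb.
have [CC _] := sepE _ s3 _ (negbT (gt_eqF hc)) Ir (rbound_Im nz rt); have {}CC := CC hc.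
have [_ D] := sepE _ s4 _ (negbT (lt_eqF hd)) Ir (rbound_Im nz rt); have {}D := D hd.
have [i lti /andP[xi1 xi2]] := grid_point Rr h0 ha hb.
have [j ltj /andP[yj1 yj2]] := grid_point Ir h0 hc hd.
set x := bx.1.1.1 + _ in xi1 xi2; set y := bx.1.2 + _ in yj1 yj2.
have r1 : bx.1.1.1 + 4 * eta < x + h by rewrite -(ltr_rat C); apply: le_lt_trans A xi2.
have r2 : x <= bx.1.1.2 - 4 * eta by rewrite -(ler_rat C); apply: le_trans xi1 B.
have r3 : bx.1.2 + 4 * eta < y + h by rewrite -(ltr_rat C); apply: le_lt_trans CC yj2.
have r4 : y <= bx.2 - 4 * eta by rewrite -(ler_rat C); apply: le_trans yj1 D.
have [x1 x2 x3 x4] := grid_margins eta0 h_eta r1 r2.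
have [y1 y2 y3 y4] := grid_margins eta0 h_eta r3 r4.
have normx u v (a b c d : rat) : u \is Num.real -> v \is Num.real -> ratr a <= u -> u <= ratr b ->
   ratr c <= v -> v <= ratr d -> `|u + 'i * v| <= ratr (1 + `|a| + `|b| + `|c| + `|d|) :> C.
  move=> ur vr *; apply: (@le_trans _ _ (`|u| + `|v|)).
    by rewrite (le_trans (ler_normD _ _)) // normrM normCi mul1r.
  apply: (@le_trans _ _ (ratr (`|a| + `|b|) + ratr (`|c| + `|d|))).
    by rewrite lerD // norm_rat_between.
  by rewrite -rmorphD ler_rat; lra.
have hzR : `|z| <= ratr (apr_rad bx).
  by rewrite [z]Crect; apply: normx => //; apply: ltW.
have hxR : `|gz C (x, y)| <= ratr (apr_rad bx).
  by apply: normx; rewrite ?ratr_real ?ler_rat.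
have dist : `|gz C (x, y) - z| <= ratr (2 * h).
  apply: (le_trans (gz_dist _ _)); rewrite [_.1]/= [_.2]/=.
  have -> : ratr (2 * h) = ratr h + ratr h :> C by rewrite mulr_natl mulr2n rmorphD.
  apply: lerD; rewrite distrC ger0_norm ?subr_ge0 // lerBlDl -rmorphD ltW //.
have okxy : apr_ok p bx eta (x, y).
  apply/and5P; split=> //.
  rewrite -(ler_rat C) gz_norm2 gpevE rmorphXn /=.
  rewrite lerXn2r // ?nnegrE ?ler0q //; first exact: ltW.
  rewrite -[pev _ _]subr0 -rt.
  apply: (le_trans (lipfoldP _ rad0 hxR hzR)).
  apply: (@le_trans _ _ (ratr (2 * h) * ratr (lipfold (apr_rad bx) p).2)).
    by rewrite ler_wpM2r // ler0q.
  by rewrite -rmorphM ler_rat; apply: le_trans h_tol; rewrite mulrCA mulrA ler_wpM2l ?lerDl // mulr_ge0 // ltW.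
have inG : (x, y) \in apr_grid bx h.
  apply/flattenP; exists (map (fun j => (x, bx.1.2 + j%:R * h)) (iota 0 (apr_num bx.1.2 bx.2 h))).
    by apply/mapP; exists i => //; rewrite mem_iota.
  by apply/mapP; exists j => //; rewrite mem_iota.
have : (x, y) \in filter (apr_ok p bx eta) (apr_grid bx h) by rewrite mem_filter okxy.
case E : (filter _ _) => [|w s] //= _.
(* The head of the list may be another accepted point than (x, y). Its nearby root lies inside the
   box by the margins [eta], so uniqueness identifies it with [z]. *)
have : w \in filter (apr_ok p bx eta) (apr_grid bx h) by rewrite E mem_head.
rewrite mem_filter => /andP[okw _].
have /and5P[w1 w2 w3 w4 w5] := okw.
have [|w' rt' hw'] := @small_value_near_root p (gz C w) eta nz (ltW eta0) deg0.
  move: w5; rewrite -(ler_rat C) gz_norm2 gpevE rmorphXn /= ler_pXn2r ?nnegrE ?ler0q //.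
  exact: ltW.
have close (u : C) (q : rat) : u \is Num.real -> `|ratr q - u| <= ratr eta ->
   ratr (q - eta) <= u /\ u <= ratr (q + eta).
  move=> ur; rewrite real_ler_norml ?rpredB ?ratr_real // => /andP[e1 e2]; split.
    by rewrite rmorphB /= lerBlDr -lerBlDl.
  by rewrite rmorphD /= -lerBlDl -[u - _]opprB lerNl.
have [c1 c2] : ratr (w.1 - eta) <= 'Re w' /\ 'Re w' <= ratr (w.1 + eta).
  apply: close; first exact: Creal_Re.
  by apply: le_trans hw'; rewrite -Re_gz -raddfB norm_Re_le.
have [c3 c4] : ratr (w.2 - eta) <= 'Im w' /\ 'Im w' <= ratr (w.2 + eta).
  apply: close; first exact: Creal_Im.
  by apply: le_trans hw'; rewrite -Im_gz -raddfB norm_Im_le.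
have <- : w' = z.
  apply: uq => //.
  - by apply: lt_le_trans c1; rewrite ltr_rat ltrBrDr.
  - by apply: le_lt_trans c2 _; rewrite ltr_rat.
  - by apply: lt_le_trans c3; rewrite ltr_rat ltrBrDr.
  - by apply: le_lt_trans c4 _; rewrite ltr_rat.
by apply: le_trans hw' _; rewrite ler_rat.
Qed.

End ApprCorrect.

(** * Density matrices and projections *)

Section HermitianForms.
Variable C : numClosedFieldType.

Definition adj m n (A : 'M[C]_(m, n)) : 'M[C]_(n, m) := map_mx Num.conj A^T.

Lemma hadjM m n p (A : 'M[C]_(m, n)) (B : 'M[C]_(n, p)) : adj (A *m B) = adj B *m adj A.
Proof. by rewrite /adj trmx_mul map_mxM. Qed.
Lemma hadjD m n (A B : 'M[C]_(m, n)) : adj (A + B) = adj A + adj B.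
Proof. by rewrite /adj linearD map_mxD. Qed.
Lemma hadjB m n (A B : 'M[C]_(m, n)) : adj (A - B) = adj A - adj B.
Proof. by rewrite /adj linearB map_mxB. Qed.
Lemma hadjZ m n a (A : 'M[C]_(m, n)) : adj (a *: A) = a^* *: adj A.
Proof. by rewrite /adj linearZ map_mxZ. Qed.
Lemma hadjK m n (A : 'M[C]_(m, n)) : adj (adj A) = A.
Proof. by apply/matrixP => i j; rewrite !mxE conjCK. Qed.
Lemma hadj0 m n : adj (0 : 'M[C]_(m, n)) = 0.
Proof. by rewrite /adj trmx0 map_mx0. Qed.
Lemma hadj1 n : adj (1%:M : 'M[C]_n) = 1%:M.
Proof. by rewrite /adj trmx1 map_mx1. Qed.

Definition qf n (A : 'M[C]_n) (v : 'cV[C]_n) : C := (adj v *m A *m v) 0 0.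
Definition nrm2 n (v : 'cV[C]_n) : C := (adj v *m v) 0 0.
Definition psd n (A : 'M[C]_n) := forall v, 0 <= qf A v.
Definition hproj n (P : 'M[C]_n) := adj P = P /\ P *m P = P.
Definition dist2 n (P : 'M[C]_n) (v : 'cV[C]_n) : C := nrm2 (v - P *m v).

Lemma nrm2E n (v : 'cV[C]_n) : nrm2 v = \sum_i `|v i 0| ^+ 2.
Proof. by rewrite /nrm2 mxE; apply: eq_bigr => i _; rewrite !mxE mulrC normCK. Qed.

Lemma nrm2_ge0 n (v : 'cV[C]_n) : 0 <= nrm2 v.
Proof. by rewrite nrm2E sumr_ge0 // => i _; rewrite exprn_ge0. Qed.

Lemma nrm2_qf n (v : 'cV[C]_n) : nrm2 v = qf 1%:M v.
Proof. by rewrite /qf mulmx1. Qed.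

Lemma psd1 n : psd (1%:M : 'M[C]_n).
Proof. by move=> v; rewrite -nrm2_qf nrm2_ge0. Qed.

Lemma qf_parallelogram n (A : 'M[C]_n) x y : qf A (x + y) + qf A (x - y) = 2 * qf A x + 2 * qf A y.
Proof.
rewrite /qf hadjD hadjB !(mulmxDl, mulmxDr, mulmxBl, mulmxBr, mulNmx, mulmxN) !mxE.
by rewrite ?opprK; ring.
Qed.

Lemma qf_add_le n (A : 'M[C]_n) x y : psd A -> qf A (x + y) <= 2 * qf A x + 2 * qf A y.
Proof. by move=> hA; rewrite -qf_parallelogram lerDl. Qed.

Lemma qfZ n (A : 'M[C]_n) a x : qf A (a *: x) = `|a| ^+ 2 * qf A x.
Proof. by rewrite /qf hadjZ -!scalemxAl -scalemxAr !mxE mulrA normCK [a * _]mulrC. Qed.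

Lemma nrm2D_le n (x y : 'cV[C]_n) : nrm2 (x + y) <= 2 * nrm2 x + 2 * nrm2 y.
Proof. by rewrite !nrm2_qf qf_add_le //; apply: psd1. Qed.

Lemma nrm2N n (x : 'cV[C]_n) : nrm2 (- x) = nrm2 x.
Proof. by rewrite !nrm2E; apply: eq_bigr => i _; rewrite mxE normrN. Qed.

(** Each summand costs a doubling by the parallelogram identity; the exponential factor is absorbed
    later by the choice of precision. *)
Lemma qf_sum_le n (A : 'M[C]_n) (I : Type) (r : seq I) (x : I -> 'cV[C]_n) : psd A ->
  qf A (\sum_(i <- r) x i) <= 2 ^+ size r * \sum_(i <- r) qf A (x i).
Proof.
move=> hA; elim: r => [|i r IH].
  by rewrite !big_nil mulr0 /qf mulmx0 mxE.
rewrite !big_cons (le_trans (qf_add_le _ _ hA)) // exprS -mulrA mulrDr mulrDr.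
apply: lerD; rewrite ler_wpM2l //.
by rewrite ler_peMl // exprn_ege1 // ler1n.
Qed.

Lemma mxtrace_sum_qf n m (A : 'M[C]_n) (B : 'M[C]_(n, m)) :
  \tr (A *m (B *m adj B)) = \sum_j qf A (col j B).
Proof.
rewrite mulmxA mxtrace_mulC mulmxA /mxtrace; apply: eq_bigr => j _.
rewrite /qf colE hadjM !mulmxA.
have -> : adj (delta_mx j 0 : 'cV[C]_m) = delta_mx 0 j.
  by apply/matrixP => i k; rewrite !mxE andbC conjC_nat.
rewrite -!mulmxA -rowE !mxE; apply: eq_bigr => k _; congr (_ * _).
by rewrite mulmxA -colE [RHS]mxE.
Qed.

Lemma qf_delta n (A : 'M[C]_n) i : qf A (delta_mx i 0) = A i i.
Proof.
rewrite /qf -colE mxE -[adj _](_ : delta_mx 0 i = _) -?rowE ?mxE //.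
by apply/matrixP => j k; rewrite !mxE andbC conjC_nat.
Qed.

(** Expand [v] in the standard basis and bound each diagonal entry by the trace. Here [n] is the
    matrix dimension, so the factor is doubly exponential in the number of qubits. *)
Lemma qf_density_le n (A : 'M[C]_n) v : psd A -> \tr A = 1 -> qf A v <= 2 ^+ n * nrm2 v.
Proof.
move=> hA trA.
have E : v = \sum_(i <- enum 'I_n) (v i 0 *: delta_mx i 0).
  by rewrite big_enum {1}[v]matrix_sum_delta; apply: eq_bigr => i _; rewrite big_ord1.
rewrite {1}E; apply: (le_trans (qf_sum_le _ _ hA)).
rewrite size_enum_ord big_enum ler_wpM2l ?exprn_ge0 ?ler0n //.
rewrite nrm2E; apply: ler_sum => i _; rewrite qfZ qf_delta ler_piMr ?exprn_ge0 //.
rewrite -trA /mxtrace (bigD1 i) //= lerDl sumr_ge0 // => j _.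
by rewrite -qf_delta.
Qed.

Lemma hproj_compl n (P : 'M[C]_n) : hproj P -> hproj (1%:M - P).
Proof.
move=> [h1 h2]; split; first by rewrite hadjB hadj1 h1.
by rewrite mulmxBl mul1mx mulmxBr mulmx1 h2 subrr subr0.
Qed.

Lemma hproj_mul_qf n (P : 'M[C]_n) x : hproj P -> nrm2 (P *m x) = qf P x.
Proof. by move=> [h1 h2]; rewrite /nrm2 /qf hadjM h1 !mulmxA -[_ *m P *m P]mulmxA h2. Qed.

Lemma dist2E n (P : 'M[C]_n) x : hproj P -> dist2 P x = nrm2 x - nrm2 (P *m x).
Proof.
move=> hP; rewrite hproj_mul_qf // nrm2_qf /dist2.
have -> : x - P *m x = (1%:M - P) *m x by rewrite mulmxBl mul1mx.
by rewrite hproj_mul_qf; [rewrite /qf mulmxBr mulmxBl !mxE|apply: hproj_compl].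
Qed.

Lemma dist2_le_nrm2 n (P : 'M[C]_n) x : hproj P -> dist2 P x <= nrm2 x.
Proof. by move=> hP; rewrite dist2E // gerBl nrm2_ge0. Qed.

Lemma dist2_sub_fixed n (P : 'M[C]_n) x y : P *m y = y -> dist2 P x = dist2 P (x - y).
Proof. by move=> h; rewrite /dist2 mulmxBr h opprB addrA subrK. Qed.

Lemma dist2D_le n (P : 'M[C]_n) x y : hproj P -> dist2 P (x + y) <= 2 * dist2 P x + 2 * nrm2 y.
Proof.
move=> hP; have -> : dist2 P (x + y) = nrm2 ((x - P *m x) + (y - P *m y)).
  by rewrite /dist2 mulmxDr opprD addrACA.
by apply: (le_trans (nrm2D_le _ _)); rewrite lerD2l ler_wpM2l //; apply: dist2_le_nrm2.
Qed.

(** Split each column b as P b + (b - P b). With T the projection [B *m adj B], the first parts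
    contribute tr (rho P T P), at most tr (rho P) because P - P T P = P (1 - T) P is positive; the
    second parts have squared norm at most [kappa]. *)
Lemma tr_density_hproj_le n m (rho P : 'M[C]_n) (B : 'M[C]_(n, m)) (kappa : C) :
  psd rho -> \tr rho = 1 -> hproj P -> hproj (B *m adj B) ->
  (forall j, dist2 P (col j B) <= kappa) ->
  \tr (rho *m (B *m adj B)) <= 2 * \tr (rho *m P) + 2 * (2 ^+ n * (m%:R * kappa)).
Proof.
move=> hr tr1 hP hS hd.
have [aP PP] := hP; have [aS SS] := hS.
have colM (A : 'M[C]_n) j : A *m col j B = col j (A *m B) by rewrite !colE mulmxA.
rewrite mxtrace_sum_qf.
apply: (@le_trans _ _ (\sum_j (2 * qf rho (P *m col j B) + 2 * (2 ^+ n * kappa)))).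
  apply: ler_sum => j _.
  rewrite -{1}[col j B](subrK (P *m col j B)) addrC (le_trans (qf_add_le _ _ hr)) //.
  rewrite lerD2l ler_wpM2l // (le_trans (qf_density_le _ hr tr1)) //.
  by rewrite ler_wpM2l ?exprn_ge0 // hd.
rewrite big_split /= -!mulr_sumr sumr_const card_ord.
apply: lerD; last by rewrite -[kappa *+ m]mulr_natl.
rewrite ler_wpM2l //.
under eq_bigr do rewrite colM.
rewrite -mxtrace_sum_qf hadjM aP.
have E : P = P *m B *m (adj B *m P) + (P *m (1%:M - B *m adj B)) *m adj (P *m (1%:M - B *m adj B)).
  have [c1 c2] := hproj_compl hS.
  rewrite hadjM c1 aP !mulmxA -[_ *m _ *m (1%:M - _)]mulmxA c2.
  by rewrite mulmxBr mulmx1 mulmxBl PP !mulmxA addrC subrK.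
rewrite [X in _ <= \tr (_ *m X)]E mulmxDr mxtraceD lerDl mxtrace_sum_qf sumr_ge0 // => j _; exact: hr.
Qed.

End HermitianForms.

(** * Gram-Schmidt over the Gaussian rationals *)

Notation gvec := (seq (rat * rat)).
Definition g0 : gq := (0, 0).
Definition gdot (N : nat) (u v : gvec) : gq :=
  foldr (fun i acc => gadd (gmul (gconj (nth g0 u i)) (nth g0 v i)) acc) g0 (iota 0 N).
Definition gvnorm2 (N : nat) (u : gvec) : rat := \sum_(i <- iota 0 N) gnorm2 (nth g0 u i).
Definition gresid (N : nat) (U : seq gvec) (v : gvec) : gvec :=
  map (fun i => foldr (fun u acc =>
      gadd acc (gscale (- (gvnorm2 N u)^-1) (gmul (gdot N u v) (nth g0 u i))))
    (nth g0 v i) U) (iota 0 N).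
(** Vectors stay unnormalised and one divides by squared norms only, so the computation never leaves
    the Gaussian rationals. The list is processed from its end. *)
Definition gram_schmidt (N : nat) (delta : rat) (V : seq gvec) : seq gvec :=
  foldr (fun v U => if delta < gvnorm2 N (gresid N U v) then gresid N U v :: U else U) [::] V.
Definition gproj (N : nat) (U : seq gvec) (i j : nat) : gq :=
  foldr (fun u acc => gadd (gscale (gvnorm2 N u)^-1 (gmul (nth g0 u i) (gconj (nth g0 u j)))) acc)
    g0 U.

Section CptGS.
Variable A : countType.
Lemma cpt_gdot (N : A -> nat) (u v : A -> gvec) : cpt N -> cpt u -> cpt v ->
  cpt (fun a => gdot (N a) (u a) (v a)).
Proof. by move=> hN hu hv; rewrite /gdot; ct. Qed.
Lemma cpt_gvnorm2 (N : A -> nat) (u : A -> gvec) : cpt N -> cpt u ->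
  cpt (fun a => gvnorm2 (N a) (u a)).
Proof. by move=> hN hu; rewrite /gvnorm2; ct. Qed.
End CptGS.

Ltac ct_gdot := lazymatch goal with
 | |- cpt (fun a => gdot (@?f a) (@?g a) (@?h a)) => refine (cpt_gdot _ _ _)
 | |- cpt (fun a => gvnorm2 (@?f a) (@?g a)) => refine (cpt_gvnorm2 _ _)
 end.
Ltac ct_ext ::= first [ct_nat | ct_div | ct_fold | ct_seq | ct_rat | ct_rat_ops | ct_obind | ct_gauss | ct_gdot | ct_int].

Section CptGS2.
Variable A : countType.
Lemma cpt_gresid (N : A -> nat) (U : A -> seq gvec) (v : A -> gvec) :
  cpt N -> cpt U -> cpt v -> cpt (fun a => gresid (N a) (U a) (v a)).
Proof. by move=> hN hU hv; rewrite /gresid; ct. Qed.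
Lemma cpt_gproj (N : A -> nat) (U : A -> seq gvec) (i j : A -> nat) :
  cpt N -> cpt U -> cpt i -> cpt j -> cpt (fun a => gproj (N a) (U a) (i a) (j a)).
Proof. by move=> hN hU hi hj; rewrite /gproj; ct. Qed.
End CptGS2.

Ltac ct_gresid := lazymatch goal with
 | |- cpt (fun a => gresid (@?f a) (@?g a) (@?h a)) => refine (cpt_gresid _ _ _)
 | |- cpt (fun a => gproj (@?f a) (@?g a) (@?h a) (@?k a)) => refine (cpt_gproj _ _ _ _)
 end.
Ltac ct_ext ::= first [ct_nat | ct_div | ct_fold | ct_seq | ct_rat | ct_rat_ops | ct_obind | ct_gauss | ct_gdot | ct_gresid | ct_int].

Lemma cpt_gram_schmidt (A : countType) (N : A -> nat) (d : A -> rat) (V : A -> seq gvec) :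
  cpt N -> cpt d -> cpt V -> cpt (fun a => gram_schmidt (N a) (d a) (V a)).
Proof. by move=> hN hd hV; rewrite /gram_schmidt; ct. Qed.

Ltac ct_gram_schmidt := lazymatch goal with
 | |- cpt (fun a => gram_schmidt (@?f a) (@?g a) (@?h a)) => refine (cpt_gram_schmidt _ _ _)
 | |- cpt (fun a => appr (@?f a) (@?g a)) => refine (cpt_appr _ _)
 end.
Ltac ct_ext ::= first [ct_nat | ct_div | ct_fold | ct_seq | ct_rat | ct_rat_ops | ct_obind | ct_gauss | ct_gdot | ct_gresid | ct_gram_schmidt | ct_int].

Section GramSchmidt.
Variables (C : numClosedFieldType) (N : nat).

Definition cv (v : gvec) : 'cV[C]_N := \col_i gz C (nth g0 v i).
Definition cproj (U : seq gvec) : 'M[C]_N :=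
  \sum_(u <- U) ratr (gvnorm2 N u)^-1 *: (cv u *m adj (cv u)).

Lemma gz_foldr_gadd (I : Type) (F : I -> gq) (s : seq I) :
  gz C (foldr (fun i acc => gadd (F i) acc) g0 s) = \sum_(i <- s) gz C (F i).
Proof. by elim: s => [|i s IH]; rewrite ?big_nil ?gz0 // big_cons /= gzD IH. Qed.

Lemma gdotE u v : gz C (gdot N u v) = (adj (cv u) *m cv v) 0 0.
Proof.
rewrite /gdot gz_foldr_gadd -{1}(subn0 N) -/(index_iota 0 N) big_mkord mxE.
by apply: eq_bigr => i _; rewrite gzM gz_conj !mxE.
Qed.

Lemma gvnorm2E u : ratr (gvnorm2 N u) = nrm2 (cv u).
Proof.
rewrite nrm2E /gvnorm2 rmorph_sum /= -{1}(subn0 N) -/(index_iota 0 N) big_mkord.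
by apply: eq_bigr => i _; rewrite gz_norm2 mxE.
Qed.

Lemma gvnorm2_ge0 u : 0 <= gvnorm2 N u.
Proof. by rewrite -(ler0q C) gvnorm2E nrm2_ge0. Qed.

Lemma gresidE U v : cv (gresid N U v) = cv v - cproj U *m cv v.
Proof.
apply/matrixP => i j; rewrite !mxE ord1 {j} /gresid (nth_map 0%N) ?size_iota ?ltn_ord //.
rewrite nth_iota ?ltn_ord // add0n /cproj.
transitivity (gz C (nth g0 v i) - \sum_(u <- U)
   ratr (gvnorm2 N u)^-1 * (cv u i 0 * (adj (cv u) *m cv v) 0 0)).
  elim: U => [|u U IH]; first by rewrite big_nil subr0.
  rewrite big_cons /= gzD IH gz_scale gzM gdotE rmorphN /= [cv u i 0]mxE mulNr.
  by ring.
congr (_ - _); elim: U => [|u U IH]; first by rewrite !big_nil; apply/esym/big1 => k _; rewrite mxE mul0r.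
rewrite !big_cons; under [RHS]eq_bigr do rewrite mxE mulrDl.
rewrite big_split /= IH; congr (_ + _).
rewrite [(adj _ *m _) 0 0]mxE !mulr_sumr; apply: eq_bigr => k _.
by rewrite !mxE big_ord1 !mxE -!mulrA.
Qed.

Lemma gprojE U (i j : 'I_N) : gz C (gproj N U i j) = cproj U i j.
Proof.
rewrite /gproj gz_foldr_gadd /cproj summxE; apply: eq_bigr => u _.
by rewrite gz_scale gzM gz_conj !mxE big_ord1 !mxE.
Qed.

Definition orthobasis (U : seq gvec) :=
  [/\ hproj (cproj U), \tr (cproj U) = (size U)%:R,
      forall u, u \in U -> gvnorm2 N u != 0 /\ cproj U *m cv u = cv u &
      pairwise (fun u v => (adj (cv u) *m cv v) 0 0 == 0) U].

Lemma outer_sq (w : 'cV[C]_N) : w *m adj w *m (w *m adj w) = nrm2 w *: (w *m adj w).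
Proof.
rewrite !mulmxA -[w *m adj w *m w]mulmxA [adj w *m w]mx11_scalar -/(nrm2 w).
by rewrite mul_mx_scalar -scalemxAl.
Qed.

Lemma orthobasis_cons U w : orthobasis U -> gvnorm2 N w != 0 -> cproj U *m cv w = 0 ->
  orthobasis (w :: U) /\ cproj (w :: U) = cproj U + ratr (gvnorm2 N w)^-1 *: (cv w *m adj (cv w)).
Proof.
move=> [[aP PP] trP fixU pw] w0 Pw.
have Ec : cproj (w :: U) = cproj U + ratr (gvnorm2 N w)^-1 *: (cv w *m adj (cv w)).
  by rewrite /cproj big_cons addrC.
have wP : adj (cv w) *m cproj U = 0 by rewrite -aP -hadjM Pw hadj0.
have w0' : (ratr (gvnorm2 N w) : C) != 0 by rewrite fmorph_eq0.
have aOut : adj (cv w *m adj (cv w)) = cv w *m adj (cv w) by rewrite hadjM hadjK.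
split=> //; rewrite /orthobasis Ec; split.
- split; first by rewrite hadjD hadjZ conj_ratr aP aOut.
  rewrite mulmxDl !mulmxDr PP -!scalemxAl -!scalemxAr outer_sq !mulmxA Pw.
  rewrite -[_ *m adj (cv w) *m cproj U]mulmxA wP mulmx0 mul0mx !scaler0 addr0 add0r.
  by rewrite -gvnorm2E fmorphV !scalerA mulfVK // mulrC.
- rewrite mxtraceD trP mxtraceZ mxtrace_mulC trace_mx11 -/(nrm2 _) -gvnorm2E.
  by rewrite fmorphV mulVf // addrC /= -natr1 addrC.
- move=> u; rewrite inE => /orP[/eqP->|/fixU [h1 h2]]; split=> //.
    rewrite mulmxDl Pw add0r -scalemxAl -mulmxA [adj _ *m _]mx11_scalar -/(nrm2 _) -gvnorm2E.
    by rewrite mul_mx_scalar scalerA fmorphV mulVf // scale1r.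
  have wu : adj (cv w) *m cv u = 0 by rewrite -h2 mulmxA wP mul0mx.
  by rewrite mulmxDl h2 -scalemxAl -mulmxA wu mulmx0 scaler0 addr0.
- rewrite /= pw andbT; apply/allP => u /fixU [_ h2].
  by rewrite -h2 mulmxA wP mul0mx mxE.
Qed.

Lemma orthobasis_nil : orthobasis [::].
Proof.
rewrite /orthobasis /cproj big_nil; split => //; first by split; rewrite ?hadj0 ?mulmx0.
exact: mxtrace0.
Qed.

Lemma gresid_kernel U v : hproj (cproj U) -> cproj U *m cv (gresid N U v) = 0.
Proof. by move=> [_ PP]; rewrite gresidE mulmxBr mulmxA PP subrr. Qed.

Lemma gresid_dist2 U v : ratr (gvnorm2 N (gresid N U v)) = dist2 (cproj U) (cv v).
Proof. by rewrite gvnorm2E gresidE. Qed.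

Lemma gs_step U v : orthobasis U -> gvnorm2 N (gresid N U v) != 0 ->
  [/\ orthobasis (gresid N U v :: U), cproj (gresid N U v :: U) *m cv v = cv v &
      forall x : 'cV[C]_N, cproj U *m x = x -> cproj (gresid N U v :: U) *m x = x].
Proof.
move=> oU w0; have [hP _ _ _] := oU; set w := gresid N U v in w0 *.
have Pw := gresid_kernel v hP; rewrite -/w in Pw.
have [oU' E] := orthobasis_cons oU w0 Pw.
have fixx (x : 'cV[C]_N) : cproj U *m x = x -> cproj (w :: U) *m x = x.
  move=> h; have [aP _] := hP.
  have wx : adj (cv w) *m x = 0 by rewrite -h mulmxA -{1}aP -hadjM Pw hadj0 mul0mx.
  by rewrite E mulmxDl h -scalemxAl -mulmxA wx mulmx0 scaler0 addr0.
split => //; have [_ _ fixU _] := oU'.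
have -> : cv v = cv w + cproj U *m cv v by rewrite gresidE subrK.
rewrite mulmxDr; congr (_ + _); first by have [] := fixU w (mem_head _ _).
by apply: fixx; rewrite mulmxA; case: hP => _ ->.
Qed.

Lemma gram_schmidt_orthobasis d V : 0 <= d -> orthobasis (gram_schmidt N d V).
Proof.
move=> d0; elim: V => [|v V IH] /=; first exact: orthobasis_nil.
case: ifP => // lt.
have w0 : gvnorm2 N (gresid N (gram_schmidt N d V) v) != 0.
  by rewrite gt_eqF // (le_lt_trans d0 lt).
by have [] := gs_step IH w0.
Qed.

(** A discarded vector has residual at most [d] when it is met, a kept one lies in the span from
    then on, and enlarging the span only decreases distances. *)
Lemma gram_schmidt_dist2 d V v : 0 <= d -> v \in V ->
  dist2 (cproj (gram_schmidt N d V)) (cv v) <= ratr d.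
Proof.
move=> d0; elim: V => [//|w V IH]; rewrite inE.
have oU := gram_schmidt_orthobasis V d0; have [hP _ _ _] := oU.
have fixed0 P (x : 'cV[C]_N) : P *m x = x -> dist2 P x <= ratr d.
  by move=> h; rewrite /dist2 h subrr nrm2E big1 ?ler0q // => i _; rewrite mxE normr0 expr0n.
rewrite /=; case: ifP => lt.
  have w0 : gvnorm2 N (gresid N (gram_schmidt N d V) w) != 0.
    by rewrite gt_eqF // (le_lt_trans d0 lt).
  have [oU' fw fx] := gs_step oU w0.
  move=> /orP[/eqP->|/IH le]; first exact: fixed0.
  apply: le_trans le.
  set P := cproj (gram_schmidt N d V) in hP fx *; set P' := cproj (_ :: _).
  have [hP' _ _ _] := oU'.
  have PP' : P' *m P = P.
    apply/matrixP => i j; have := fx (col j P); case: hP => _ PP.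
    by rewrite !colE !mulmxA PP => /(_ erefl) /matrixP /(_ i 0); rewrite -!colE !mxE.
  rewrite (@dist2_sub_fixed _ _ P' (cv v) (P *m cv v)); last by rewrite mulmxA PP'.
  exact: dist2_le_nrm2.
move=> /orP[/eqP->|/IH //]; rewrite -gresid_dist2 ler_rat leNgt lt //.
Qed.

Lemma gram_schmidt_size d V : (size (gram_schmidt N d V) <= size V)%N.
Proof. by elim: V => //= v V IH; case: ifP => _ //=; apply: leq_trans IH _. Qed.

(* Two kept vectors carrying the same label would be close, so the second one
   would have been discarded. *)
Lemma gram_schmidt_size_labels (T : eqType) d eta (V : seq gvec) (L : seq T)
    (x : T -> 'cV[C]_N) : 0 <= d -> 4 * eta <= d -> size V = size L ->
  (forall i, (i < size V)%N -> forall t0, nrm2 (cv (nth [::] V i) - x (nth t0 L i)) <= ratr eta) ->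
  (size (gram_schmidt N d V) <= size (undup L))%N.
Proof.
move=> d0 le4 szL close.
suff [K [uK szK subK _]] : exists K : seq T, [/\ uniq K, size K = size (gram_schmidt N d V),
    {subset K <= L} & forall t, t \in K -> exists y : 'cV[C]_N,
      cproj (gram_schmidt N d V) *m y = y /\ nrm2 (y - x t) <= ratr eta].
  by rewrite -szK uniq_leq_size // => t /subK; rewrite mem_undup.
elim: V L szL close => [|v V IH] [|l L] //= szL close; first by exists [::].
case: szL => szL.
have [|K [uK szK subK hK]] := IH L szL.
  by move=> i lti t0; have := close i.+1 lti t0.
have subK' : {subset K <= l :: L} by move=> t /subK; rewrite inE orbC => ->.
case: ifP => lt; last by exists K.
have oU := gram_schmidt_orthobasis V d0; have [hP _ _ _] := oU.
have w0 : gvnorm2 N (gresid N (gram_schmidt N d V) v) != 0.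
  by rewrite gt_eqF // (le_lt_trans d0 lt).
have [oU' fv fx] := gs_step oU w0.
have hv := close 0%N isT l; rewrite /= in hv.
have lK : l \notin K.
  apply/negP => /hK [y [fy hy]].
  have : ratr d < dist2 (cproj (gram_schmidt N d V)) (cv v).
    by rewrite -gresid_dist2 ltr_rat.
  rewrite (dist2_sub_fixed _ fy) => /lt_le_trans /(_ (dist2_le_nrm2 _ hP)).
  have -> : cv v - y = (cv v - x l) + - (y - x l) by rewrite opprB addrA subrK.
  move=> /lt_le_trans /(_ (nrm2D_le _ _)); rewrite nrm2N.
  have : 2 * nrm2 (cv v - x l) + 2 * nrm2 (y - x l) <= ratr d.
    apply: (@le_trans _ _ (2 * ratr eta + 2 * ratr eta)).
      by apply: lerD; rewrite ler_wpM2l.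
    have -> : 2 * ratr eta + 2 * ratr eta = ratr (4 * eta) :> C.
      by rewrite rmorphM /= ratr_nat; ring.
    by rewrite ler_rat.
  by move=> h /lt_le_trans /(_ h); rewrite ltxx.
exists (l :: K); split => //=; first by rewrite lK.
- by rewrite szK.
- by move=> t; rewrite inE => /orP[/eqP->|/subK']; rewrite ?mem_head.
- move=> t; rewrite inE => /orP[/eqP->|/hK [y [fy hy]]].
    by exists (cv v).
  by exists y; split => //; apply: fx.
Qed.

End GramSchmidt.

(** * Codes for the entries of normalised Gaussian rational vectors *)

(** With [sgnhi], the ends of an interval containing a s, for s > 0 and |a s| < M, that excludes - a
    s unless a = 0. *)
Definition sgnlo (a M : rat) : rat := if 0 < a then 0 else - M.
Definition sgnhi (a M : rat) : rat := if a < 0 then 0 else M.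

(* With w = z / sqrt q and w ^ 2 = c + i d, the polynomial (X ^ 2 - c) ^ 2 + d ^ 2
   has roots w, - w and their conjugates; the signs of the two components of z
   select the quadrant of w. *)
Definition mkalg (z : gq) (q : rat) : seq rat * box :=
  ([:: (gnorm2 z / q) ^+ 2; 0; - 2 * ((z.1 * z.1 - z.2 * z.2) / q); 0; 1],
   (sgnlo z.1 (gnorm2 z / q + 1), sgnhi z.1 (gnorm2 z / q + 1),
    sgnlo z.2 (gnorm2 z / q + 1), sgnhi z.2 (gnorm2 z / q + 1))).

Lemma cpt_mkalg (A : countType) (z : A -> gq) (q : A -> rat) :
  cpt z -> cpt q -> cpt (fun a => mkalg (z a) (q a)).
Proof. by move=> hz hq; rewrite /mkalg /sgnlo /sgnhi; ct. Qed.

Section MkAlg.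
Variable C : numClosedFieldType.

Lemma sgn_box (a M : rat) (s x : C) : 0 < s -> `|ratr a * s| < ratr M ->
  (ratr (sgnlo a M) < ratr a * s < ratr (sgnhi a M)) /\
  (x = ratr a * s \/ x = - (ratr a * s) -> ratr (sgnlo a M) < x -> x < ratr (sgnhi a M) ->
   x = ratr a * s).
Proof.
move=> s0 hM.
have ar : ratr a * s \is Num.real by rewrite rpredM ?ratr_real // gtr0_real.
move: (hM); rewrite real_ltr_norml // => /andP[h1 h2].
rewrite /sgnlo /sgnhi; have [lt|lt|E] := ltrgt0P a.
- rewrite rmorph0 h2 pmulr_rgt0 ?s0 ?ltr0q //=; split=> // -[//|->] + _.
  have h : 0 < ratr a * s :> C by rewrite pmulr_rgt0 ?ltr0q.
  by rewrite oppr_gt0 => /(lt_trans h); rewrite ltxx.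
- rewrite rmorphN /= h1 rmorph0 nmulr_rlt0 ?s0 ?ltrq0 //=; split=> // -[//|->] _.
  have : ratr a * s < 0 :> C by rewrite nmulr_rlt0 ?ltrq0.
  by rewrite oppr_lt0 => h /(lt_trans h); rewrite ltxx.
- move: h1 h2; rewrite E rmorph0 mul0r oppr0 rmorphN /= => -> ->.
  by split=> // -[].
Qed.

(** Makes |w| ^ 2 + 1 a rational bound on both components of w, which themselves may be
    irrational. *)
Lemma real_lt_sqr1 (A B : C) : A \is Num.real -> B \is Num.real -> `|A| < A ^+ 2 + B ^+ 2 + 1.
Proof.
move=> Ar Br; rewrite -[A ^+ 2]real_normK // -subr_gt0.
have -> : `|A| ^+ 2 + B ^+ 2 + 1 - `|A| = (`|A| - 2^-1) ^+ 2 + B ^+ 2 + 3 / 4 by field.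
apply: ltr_wpDl; last by rewrite divr_gt0 ?ltr0n.
by rewrite addr_ge0 // real_exprn_even_ge0 ?rpredB ?normr_real ?rpredV ?realn.
Qed.

Lemma mkalg_spec (z : gq) (q : rat) (w := gz C z / sqrtC (ratr q)) : 0 < q ->
  let p := (mkalg z q).1 in let bx := (mkalg z q).2 in
  [/\ has (fun q => q != 0) p, pev p w = 0,
      [/\ ratr bx.1.1.1 < 'Re w, 'Re w < ratr bx.1.1.2, ratr bx.1.2 < 'Im w & 'Im w < ratr bx.2] &
      forall u, pev p u = 0 -> ratr bx.1.1.1 < 'Re u -> 'Re u < ratr bx.1.1.2 ->
     ratr bx.1.2 < 'Im u -> 'Im u < ratr bx.2 -> u = w].
Proof.
move=> q0 p bx; rewrite {}/p {}/bx; case: z @w => a b w.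
pose s : C := (sqrtC (ratr q))^-1.
have s0 : 0 < s by rewrite invr_gt0 sqrtC_gt0 ltr0q.
have sr : s \is Num.real by apply: gtr0_real.
have q0' : (ratr q : C) != 0 by rewrite fmorph_eq0 gt_eqF.
have s2 : s ^+ 2 = (ratr q)^-1 by rewrite exprVn sqrtCK.
pose A : C := ratr a * s; pose B : C := ratr b * s.
have Ar : A \is Num.real by rewrite rpredM ?ratr_real.
have Br : B \is Num.real by rewrite rpredM ?ratr_real.
have wE : w = A + 'i * B by rewrite /w /gz /= -/s mulrDl -mulrA.
have ReW : 'Re w = A by rewrite wE Re_rect.
have ImW : 'Im w = B by rewrite wE Im_rect.
have A2 : A ^+ 2 = ratr a ^+ 2 / ratr q by rewrite /A exprMn s2.
have B2 : B ^+ 2 = ratr b ^+ 2 / ratr q by rewrite /B exprMn s2.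
pose M := gnorm2 (a, b) / q + 1.
have ME : ratr M = A ^+ 2 + B ^+ 2 + 1 :> C.
  rewrite /M rmorphD rmorph1 /= fmorph_div /= /gnorm2 /= rmorphD !rmorphM /= A2 B2.
  by rewrite -!expr2 mulrDl.
have hA : `|A| < ratr M by rewrite ME real_lt_sqr1.
have hB : `|B| < ratr M by rewrite ME [A ^+ 2 + _]addrC real_lt_sqr1.
have ev u : pev (mkalg (a, b) q).1 u = (u - w) * (u + w) * (u - w^* ) * (u + w^* ).
  have -> : w^* = A - 'i * B.
    by rewrite wE rmorphD rmorphM /= conjCi !conj_Creal // mulNr.
  have e1 : ratr ((gnorm2 (a, b) / q) ^+ 2) = (A ^+ 2 + B ^+ 2) ^+ 2 :> C.
    by rewrite rmorphXn /= fmorph_div /= /gnorm2 /= rmorphD !rmorphM /= A2 B2 -!expr2 mulrDl.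
  have e2 : ratr (- 2 * ((a * a - b * b) / q)) = - 2 * (A ^+ 2 - B ^+ 2) :> C.
    rewrite rmorphM rmorphN /= ratr_nat; congr (_ * _).
    by rewrite fmorph_div /= rmorphB !rmorphM /= A2 B2 -!expr2 mulrBl.
  rewrite wE /= e1 e2 rmorph0 rmorph1.
  have i2 := sqrCi C; move: ('i : C) i2 => I i2.
  transitivity ((u ^+ 2 - (A ^+ 2 + I ^+ 2 * B ^+ 2)) ^+ 2 - 4 * A ^+ 2 * B ^+ 2 * I ^+ 2).
    by rewrite i2; ring.
  by ring.
have [boxA _] := sgn_box 0 s0 hA; have [boxB _] := sgn_box 0 s0 hB.
split.
- by apply/hasP; exists 1; rewrite ?inE ?eqxx ?orbT // oner_neq0.
- by rewrite ev subrr !mul0r.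
- by rewrite ReW ImW; move/andP: boxA => [-> ->]; move/andP: boxB => [-> ->].
move=> u; rewrite ev => /eqP; rewrite !mulf_eq0.
rewrite -!orbA => h r1 r2 r3 r4.
have [hRe hIm] : ('Re u = A \/ 'Re u = - A) /\ ('Im u = B \/ 'Im u = - B).
  have wc : w^* = A + 'i * - B.
    by rewrite wE rmorphD rmorphM /= conjCi !conj_Creal // mulNr mulrN.
  have [c1 c2] : 'Re w^* = A /\ 'Im w^* = - B by rewrite wc Re_rect ?Im_rect ?rpredN.
  have reN x : 'Re (- x) = - 'Re x :> C by rewrite raddfN.
  have imN x : 'Im (- x) = - 'Im x :> C by rewrite raddfN.
  move: h => /or4P[]; rewrite ?subr_eq0 ?addr_eq0 => /eqP->; rewrite ?reN ?imN ?ReW ?ImW ?c1 ?c2 ?opprK.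
  - by split; left.
  - by split; right.
  - by split; [left|right].
  - by split; [right|left].
have [_ uA'] := sgn_box ('Re u) s0 hA; have [_ uB'] := sgn_box ('Im u) s0 hB.
by rewrite [u]Crect (uA' hRe r1 r2) (uB' hIm r3 r4) wE.
Qed.
End MkAlg.

(** * Bounded evaluation of a fixed program *)

Lemma cpt_cunpair (A : countType) (f : A -> nat) : cpt f -> cpt (fun a => cunpair (f a)).
Proof.
move=> hf; apply: (@cpt_ext _ _ (fun a => nat_rect (fun=> (nat * nat)%type) (0%N, 0%N)
  (fun _ p => if p.1 == 0%N then (p.2.+1, 0%N) else (p.1.-1, p.2.+1)) (f a))).
  by move=> a; elim: (f a) => //= n ->; case: (cunpair n) => -[|x] y.
by ct.
Qed.

Lemma cpt_cpair (A : countType) (f g : A -> nat) : cpt f -> cpt g ->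
  cpt (fun a => cpair (f a) (g a)).
Proof.
move=> hf hg; apply: (@cpt_ext _ _ (fun a => ((f a + g a) * (f a + g a).+1 %/ 2 + g a)%N)) => //.
by ct.
Qed.

Ltac ct_cpair := lazymatch goal with
 | |- cpt (fun a => cpair (@?f a) (@?g a)) => refine (cpt_cpair _ _)
 | |- cpt (fun a => cunpair (@?f a)) => refine (cpt_cunpair _)
 end.
Ltac ct_ext ::= first [ct_nat | ct_div | ct_fold | ct_seq | ct_rat | ct_rat_ops | ct_obind | ct_gauss | ct_gdot | ct_gresid | ct_gram_schmidt | ct_cpair | ct_int].

(** Induction on the fixed program; fuel and input are arbitrary computable functions of [a], so
    that the hypotheses apply to the arguments formed inside recursion and search. *)
Lemma cpt_evalf (c : prf) (A : countType) (s x : A -> nat) : cpt s -> cpt x ->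
  cpt (fun a => evalf c (s a) (x a)).
Proof.
elim: c A s x => [||||| f IHf g IHg | f IHf g IHg | f IHf g IHg | f IHf] A s x hs hx /=.
- by ct.
- by ct.
- by ct.
- by rewrite /cfst; have := cpt_cunpair hx => h; ct.
- by rewrite /csnd; have := cpt_cunpair hx => h; ct.
- have hg := IHg _ _ _ hs hx.
  by apply: (cpt_obind (f := fun a y => evalf f (s a) y)) => //; apply: IHf; ct.
- have hg := IHg _ _ _ hs hx; have hf := IHf _ _ _ hs hx.
  apply: (cpt_obind (f := fun a y => omap (cpair y) (evalf g (s a) (x a)))) => //.
  apply: (@cpt_ext _ _ (fun p => obind (fun z => Some (cpair p.2 z)) (evalf g (s p.1) (x p.1)))).
    by move=> p; case: evalf.
  apply: (cpt_obind (f := fun p z => Some (cpair p.2 z))); last by apply: IHg; ct.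
  by apply: cpt_Some; apply: cpt_cpair; ct.
- have hu := cpt_cunpair hx; rewrite /cfst /csnd.
  apply: (@cpt_natrec _ _ (fun a => evalf f (s a) (cunpair (x a)).1)
     (fun a k acc => obind (fun y => evalf g (s a) (cpair (cunpair (x a)).1 (cpair k y))) acc)
     (fun a => (cunpair (x a)).2)); last by ct.
    by apply: IHf; ct.
  apply: (cpt_obind (f := fun p y => evalf g (s p.1) (cpair (cunpair (x p.1)).1 (cpair p.2.1 y)))); last by ct.
  by apply: IHg; ct.
- pose F a := find (fun k => evalf f (s a) (cpair (x a) k) \in [:: None; Some 0%N]) (iota 0 (s a)).
  have hF : cpt F.
    rewrite /F; apply: (cpt_find (f := fun a k => evalf f (s a) (cpair (x a) k) \in [:: None; Some 0%N])).
      apply: cpt_mem; last by ct.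
      by apply: IHf; ct.
    by ct.
  have h2 : cpt (fun a => evalf f (s a) (cpair (x a) (F a))).
    by apply: IHf; ct.
  apply: (@cpt_ext _ _ (fun a => if evalf f (s a) (cpair (x a) (F a)) == Some 0%N then Some (F a) else None)) => //.
  by ct.
Qed.

(** * Kraft sums and computable series *)

From mathcomp Require Import all_classical all_reals all_analysis.
From mathcomp Require Import complex Rstruct.
Import numFieldNormedType.Exports.
Local Open Scope classical_set_scope.
Local Open Scope ring_scope.

Lemma nat_of_bits_cons b s : nat_of_bits (b :: s) = ((nat_of_bits s).*2 + b + 1)%N.
Proof. by []. Qed.

Lemma nat_of_bits_bounds s :
  (2 ^ size s <= (nat_of_bits s).+1)%N /\ ((nat_of_bits s).+1 < 2 ^ (size s).+1)%N.
Proof.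
elim: s => [//|b s [IH1 IH2]]; rewrite nat_of_bits_cons /=.
rewrite [(2 ^ (size s).+2)%N]expnS [(2 ^ (size s).+1)%N]expnS.
rewrite expnS in IH2; move: IH1 IH2; set P := (2 ^ size s)%N; case: b; lia.
Qed.

Lemma nat_of_bits_inj : injective nat_of_bits.
Proof.
elim=> [|b s IH] [|b' s'] //; rewrite ?nat_of_bits_cons; try lia.
  by move=> h; have : nat_of_bits [::] = 0%N by []; lia.
  by move=> h; have : nat_of_bits [::] = 0%N by []; lia.
move=> h; have hb : b = b' by case: b b' h => -[] //; lia.
by rewrite hb; congr cons; apply: IH; rewrite hb in h; lia.
Qed.

Lemma nat_of_bits_surj x : exists s, nat_of_bits s = x.
Proof.
have [n] := ubnP x; elim: n x => // n IH [|x] lt; first by exists [::].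
have [|s Es] := IH x./2; first by lia.
by exists (odd x :: s); rewrite nat_of_bits_cons Es -[in RHS](odd_double_half x); lia.
Qed.

(** Length of the bit string numbered [x], that is, the floor of log2 (x + 1). Applied to r - 1 it
    yields the floor of log2 r, its second use. *)
Definition blen (x : nat) : nat := find (fun L => x.+1 < 2 ^ L.+1)%N (iota 0 x.+1).

Lemma cpt_blen (A : countType) (f : A -> nat) : cpt f -> cpt (fun a => blen (f a)).
Proof. by move=> hf; rewrite /blen; ct. Qed.

Lemma blenE s : blen (nat_of_bits s) = size s.
Proof.
have [h1 h2] := nat_of_bits_bounds s; rewrite /blen.
set x := nat_of_bits s in h1 h2 *.
have lts : (size s < x.+1)%N by apply: leq_trans h1; apply: ltn_expl.
have nthi i : (i < x.+1)%N -> nth 0%N (iota 0 x.+1) i = i by move=> lt; rewrite nth_iota.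
have hasF : has (fun L => x.+1 < 2 ^ L.+1)%N (iota 0 x.+1).
  by apply/hasP; exists (size s) => //; rewrite mem_iota.
apply/eqP; rewrite eqn_leq; apply/andP; split.
  by rewrite leqNgt; apply/negP => /(before_find 0%N); rewrite nthi // h2.
rewrite leqNgt; apply/negP => lt.
have := nth_find 0%N hasF; rewrite nthi ?(leq_trans lt (ltnW lts)) //.
rewrite ltnNge => /negP; apply; apply: leq_trans h1; rewrite leq_exp2l //.
Qed.

Lemma sum_double_shift (R : zmodType) (G : nat -> R) a b :
  (\sum_(a <= y < b) (G (y.*2.+1) + G (y.*2.+2)) = \sum_(a.*2.+1 <= x < b.*2.+1) G x)%R.
Proof.
have [le|lt] := leqP a b; last by rewrite !big_geq //; lia.
rewrite -(subnKC le); elim: (b - a)%N => [|k IH]; first by rewrite addn0 !big_geq.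
rewrite addnS big_nat_recr ?leq_addr //= IH doubleS.
rewrite [RHS]big_nat_recr /=; last by lia.
by rewrite [X in _ = X + _]big_nat_recr /= ?addrA //; lia.
Qed.

Lemma big_tuple_cons (R : zmodType) (n : nat) (F : seq bool -> R) :
  \sum_(p : n.+1.-tuple bool) F p = \sum_(p : n.-tuple bool) (F (true :: p) + F (false :: p)).
Proof.
rewrite [RHS](eq_bigr (fun p : n.-tuple bool => \sum_(b : bool) F (b :: p))); last first.
  by move=> p _; rewrite big_bool.
rewrite pair_big /=.
rewrite (reindex (fun q : n.-tuple bool * bool => [tuple of q.2 :: q.1])) //=.
exists (fun p : n.+1.-tuple bool => ([tuple of behead p], thead p)) => [[p b] _|p _] /=.
  by apply/eqP; rewrite xpair_eqE theadE eqxx andbT; apply/eqP/val_inj.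
by rewrite -tuple_eta.
Qed.

Lemma sum_tuple_nat_of_bits (R : zmodType) (G : nat -> R) L :
  \sum_(p : L.-tuple bool) G (nat_of_bits p) = \sum_((2 ^ L).-1 <= x < (2 ^ L.+1).-1) G x.
Proof.
elim: L G => [|L IH] G.
  rewrite (eq_bigr (fun=> G 0%N)); last by move=> p _; rewrite tuple0.
  by rewrite sumr_const card_tuple expn0 big_nat1.
rewrite (big_tuple_cons L (fun s => G (nat_of_bits s))).
rewrite (eq_bigr (fun p : L.-tuple bool => G ((nat_of_bits p).*2.+1) + G ((nat_of_bits p).*2.+2))).
  rewrite (IH (fun y => G y.*2.+1 + G y.*2.+2)) sum_double_shift.
  have e k : ((2 ^ k).-1.*2.+1 = (2 ^ k.+1).-1)%N.
    by rewrite expnS; have := expn_gt0 2 k; lia.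
  by rewrite !e.
by move=> p _; rewrite addrC !nat_of_bits_cons; congr (G _ + G _); lia.
Qed.

(** Passes from [dom_measure], which is summed by length, to sums over the numbers on which programs
    act. *)
Lemma sum_levels (R : zmodType) (G : nat -> R) n :
  \sum_(0 <= L < n) \sum_(p : L.-tuple bool) G (nat_of_bits p) = \sum_(0 <= x < (2 ^ n).-1) G x.
Proof.
elim: n => [|n IH]; first by rewrite !big_geq.
rewrite big_nat_recr //= IH sum_tuple_nat_of_bits -big_cat_nat //.
by rewrite expnS; have := expn_gt0 2 n; lia.
Qed.

Definition pfree (D : seq bool -> Prop) := forall p q, D p -> D q -> prefix p q -> p = q.

Definition kraft_sum (D : seq bool -> Prop) n : Rl :=
  \sum_(0 <= L < n) \sum_(p : L.-tuple bool) (if `[< D (tval p) >] then 2 ^- L else 0).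

Lemma kraft_sumS D n : kraft_sum D n.+1 = (if `[< D [::] >] then 1 else 0) +
  2^-1 * (kraft_sum (fun s => D (false :: s)) n + kraft_sum (fun s => D (true :: s)) n).
Proof.
rewrite /kraft_sum big_nat_recl //; congr (_ + _).
  rewrite (eq_bigr (fun=> if `[< D [::] >] then 1 else 0)); last first.
    by move=> p _; rewrite tuple0 expr0 invr1.
  by rewrite sumr_const card_tuple expn0.
rewrite -big_split /= mulr_sumr; apply: eq_bigr => L _.
rewrite (big_tuple_cons L (fun s => if `[< D s >] then (2 : Rl) ^- L.+1 else 0)).
rewrite -big_split /= mulr_sumr; apply: eq_bigr => p _.
have e2 : 2 ^- L.+1 = 2^-1 * 2 ^- L :> Rl by rewrite exprS invfM.
by rewrite e2; set e := 2 ^- L; do 2 case: ifP => _; lra.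
Qed.

(** Induction on the length by first bit: both subtrees are again prefix-free and count one half
    each, and the empty string, if present, is alone. *)
Lemma kraft_inequality D n : pfree D -> kraft_sum D n <= 1.
Proof.
elim: n D => [|n IH] D pf; first by rewrite /kraft_sum big_geq.
rewrite kraft_sumS; have [D0|nD0] := pselect (D [::]).
  rewrite asboolT //; have empty b : kraft_sum (fun s => D (b :: s)) n = 0.
    rewrite /kraft_sum big1 // => L _; rewrite big1 // => p _.
    by rewrite asboolF // => /(pf _ _ D0) /(_ (prefix0s _)).
  by rewrite !empty addr0 mulr0 addr0.
rewrite asboolF // add0r.
have h b : kraft_sum (fun s => D (b :: s)) n <= 1.
  apply: IH => p q hp hq pq; have := pf _ _ hp hq.
  by rewrite prefix_cons eqxx pq => /(_ isT) [].
by have := h false; have := h true; lra.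
Qed.

(** * Nonnegative series and computable sums *)

(** Supremum of the partial sums: for nonnegative terms this is convergence, stated through finite
    sums alone. *)
Definition sums_to (h : nat -> Rl) (x : Rl) :=
  (forall M, \sum_(0 <= i < M) h i <= x) /\
  (forall d, 0 < d -> exists M, x - d < \sum_(0 <= i < M) h i).

Lemma series_nondecreasing (h : nat -> Rl) : (forall i, 0 <= h i) ->
  {homo series h : n m / (n <= m)%N >-> n <= m}.
Proof.
move=> h0 n m le; change (\sum_(0 <= i < n) h i <= \sum_(0 <= i < m) h i).
rewrite (big_cat_nat (n := n) (p := m)) //= lerDl.
by rewrite sumr_ge0.
Qed.

Lemma sums_to_series (h : nat -> Rl) : (forall i, 0 <= h i) -> cvgn (series h) ->
  sums_to h (limn (series h)).
Proof.
move=> h0 cv; have mono := series_nondecreasing h0; split.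
  by move=> M; apply: (nondecreasing_cvgn_le mono cv).
move=> d d0; have /cvgrPdist_lt/(_ d d0) [M _ HM] := cv.
exists M; have := HM M (leqnn M); rewrite /= ltr_norml => /andP[_ lt].
by rewrite ltrBlDr -ltrBlDl.
Qed.

Lemma series_sums_to (h : nat -> Rl) x : (forall i, 0 <= h i) -> sums_to h x ->
  cvgn (series h) /\ limn (series h) = x.
Proof.
move=> h0 [h1 h2].
have c : series h @ \oo --> x.
  apply/cvgrPdist_lt => d d0; have [M HM] := h2 d d0; exists M => // n /= le.
  rewrite ger0_norm ?subr_ge0; last exact: h1.
  have := series_nondecreasing h0 le; rewrite /series /= in HM * => le2.
  by rewrite ltrBlDr -ltrBlDl (lt_le_trans HM).
split; first by apply/cvg_ex; exists x.
exact/cvg_lim.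
Qed.

Lemma sums_to_unique h x y : sums_to h x -> sums_to h y -> x = y.
Proof.
move=> [h1 h2] [g1 g2]; apply/eqP; rewrite eq_le; apply/andP; split.
  rewrite leNgt; apply/negP => lt; have [|M HM] := h2 (x - y); first by rewrite subr_gt0.
  by have := g1 M; move: HM; lra.
rewrite leNgt; apply/negP => lt; have [|M HM] := g2 (y - x); first by rewrite subr_gt0.
by have := h1 M; move: HM; lra.
Qed.

Lemma sums_to_exists (h : nat -> Rl) B : (forall i, 0 <= h i) ->
  (forall M, \sum_(0 <= i < M) h i <= B) -> exists x, sums_to h x.
Proof.
move=> h0 hB; exists (limn (series h)); apply: sums_to_series => //.
apply: nondecreasing_is_cvgn; first exact: series_nondecreasing.
by exists B => _ [n _ <-]; apply: hB.
Qed.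

Definition domweight (c : prf) (x : nat) : Rl :=
  if `[< exists y, Defs.eval c x y >] then 2 ^- blen x else 0.

Lemma domweight_ge0 c x : 0 <= domweight c x.
Proof. by rewrite /domweight; case: ifP => // _; rewrite invr_ge0 exprn_ge0. Qed.

Lemma domweight_levels c n : \sum_(0 <= L < n) \sum_(p : L.-tuple bool)
   (if `[< mdom c (tval p) >] then (2 : Rl) ^- L else 0) = \sum_(0 <= x < (2 ^ n).-1) domweight c x.
Proof.
rewrite -(sum_levels (domweight c)); apply: eq_bigr => L _; apply: eq_bigr => p _.
by rewrite /domweight blenE size_tuple.
Qed.

(** Kraft's inequality makes the series in [dom_measure] converge, so that [limn] is a genuine sum;
    the partial sums by level are cofinal among those by number. *)
Lemma dom_measure_sums_to c : prefix_free_machine c -> sums_to (domweight c) (dom_measure c).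
Proof.
move=> pf; set g := (fun L : nat => \sum_(p : L.-tuple bool)
       (if `[< mdom c (tval p) >] then (2 : Rl) ^- L else 0)).
have g0 i : 0 <= g i by apply: sumr_ge0 => p _; case: ifP => // _; rewrite invr_ge0 exprn_ge0.
have hs n : series g n = \sum_(0 <= x < (2 ^ n).-1) domweight c x by apply: domweight_levels.
have le1 n : series g n <= 1 by apply: kraft_inequality.
have cv : cvgn (series g).
  apply: nondecreasing_is_cvgn; first exact: series_nondecreasing.
  by exists 1 => _ [n _ <-]; apply: le1.
have [h1 h2] := sums_to_series g0 cv; rewrite -/(dom_measure c) in h1 h2.
split.
  move=> M; apply: le_trans (h1 M); rewrite -[X in _ <= X]/(series g M) hs.
  have le : (M <= (2 ^ M).-1)%N by have := ltn_expl M (isT : 1 < 2)%N; lia.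
  by apply: series_nondecreasing le => i; apply: domweight_ge0.
move=> d /h2 [M HM]; exists ((2 ^ M).-1); rewrite -hs; exact: HM.
Qed.

Lemma computable_realP x : computable_real x <->
  exists2 q : nat -> rat, cpt q & forall n, `|ratr (q n) - x| <= 2 ^- n.
Proof.
split.
  move=> [c Hc]; have [f Hf] := choice (fun n => Hc n).
  pose q n : rat := if (unpickle (f n) : option rat) is Some q then q else 0.
  exists q.
    have cf : cpt f by exists c => n; have [? [? _]] := Hf n.
    have hr := dcpt_rat; rewrite /dcpt in hr; rewrite /q; ct.
  by move=> n; have [q0 [_ [Eq le]]] := Hf n; rewrite /q; move: Eq; rewrite /dec_rat => ->.
move=> [q [c Hc] Hq]; exists c => n; exists (pickle (q n)), (q n).
by split; [exact: Hc|rewrite /dec_rat pickleK].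
Qed.

Lemma ler_expn2N (R : numFieldType) m n : (m <= n)%N -> 2 ^- n <= 2 ^- m :> R.
Proof. by move=> le; rewrite lef_pV2 ?posrE ?exprn_gt0 ?ltr0n // ler_weXn2l ?ler1n. Qed.

Lemma lt_exp2 n : n%:R < 2 ^+ n :> Rl.
Proof. by rewrite -natrX ltr_nat ltn_expl. Qed.

Lemma ratr_sum (I : Type) (r : seq I) (F : I -> rat) :
  ratr (\sum_(i <- r) F i) = \sum_(i <- r) (ratr (F i) : Rl).
Proof. exact: rmorph_sum. Qed.

(* The tail of the dominating series controls the tail of the dominated one. *)
Lemma dominated_computable (f g : nat -> rat) (K : nat) x : cpt f -> cpt g ->
  (forall i, 0 <= f i <= K%:R * g i) -> sums_to (fun i => ratr (g i)) x ->
  computable_real x ->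
  exists2 y, sums_to (fun i => ratr (f i)) y & computable_real y.
Proof.
move=> cf cg fg [g1 g2] /computable_realP [q cq Hq].
have f0 i : 0 <= ratr (f i) :> Rl by rewrite ler0q; case/andP: (fg i).
have fgR i : ratr (f i) <= K%:R * ratr (g i) :> Rl.
  by rewrite -(ratr_nat Rl) -rmorphM ler_rat; case/andP: (fg i).
have sub M : \sum_(0 <= i < M) ratr (f i) <= K%:R * \sum_(0 <= i < M) ratr (g i) :> Rl.
  by rewrite mulr_sumr; apply: ler_sum.
have [|y [y1 y2]] := @sums_to_exists (fun i => ratr (f i)) (K%:R * x) f0.
  by move=> M; apply: (le_trans (sub M)); rewrite ler_wpM2l.
exists y => //; apply/computable_realP.
(* The terms found leave a tail of at most 3 * 2 ^- k for [g], hence [K] times that for [f], and 3 K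
   <= 2 ^ (3 K). *)
pose k n := (n + 3 * K)%N.
have exM n : exists M, q (k n) - 2 / 2 ^+ k n < \sum_(i <- iota 0 M) g i.
  have [|M HM] := g2 (2 ^- k n); first by rewrite invr_gt0 exprn_gt0.
  exists M; rewrite -(ltr_rat Rl) ratr_sum rmorphB /= fmorph_div /= ratr_nat rmorphXn /= ratr_nat.
  move: HM; rewrite /index_iota subn0; set S := \sum_(_ <- _) _ => HM.
  have := Hq (k n); rewrite ler_norml => /andP[_]; move: HM; set e := 2 ^- _ => *; lra.
exists (fun n => \sum_(i <- iota 0 (ex_minn (exM n))) f i).
  have hM : cpt (fun n => ex_minn (exM n)).
    apply: (@cpt_ex_minn _ (fun n M => q (k n) - 2 / 2 ^+ k n < \sum_(i <- iota 0 M) g i)).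
    by rewrite /k; ct.
  by ct.
move=> n; case: ex_minnP => M HM _.
have {HM} : ratr (q (k n)) - 2 / 2 ^+ k n < \sum_(0 <= i < M) ratr (g i) :> Rl.
  move: HM; rewrite -(ltr_rat Rl) ratr_sum rmorphB /= fmorph_div /= ratr_nat rmorphXn /= ratr_nat.
  by rewrite /index_iota subn0.
rewrite ratr_sum -{2}(subn0 M) -/(index_iota 0 M) => HM.
have tail : y <= \sum_(0 <= i < M) ratr (f i) + K%:R * (x - \sum_(0 <= i < M) ratr (g i)).
  rewrite leNgt; apply/negP => lt.
  have [|M' HM'] := y2 (y - (\sum_(0 <= i < M) ratr (f i) + K%:R * (x - \sum_(0 <= i < M) ratr (g i)))).
    by rewrite subr_gt0.
  rewrite opprB addrC subrK in HM'.
  have [le|/ltnW le] := leqP M M'.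
    move: HM'; rewrite (big_cat_nat (n := M) (p := M')) //= ltrD2l => HM'.
    suff /(lt_le_trans HM') : \sum_(M <= i < M') ratr (f i) <= K%:R * (x - \sum_(0 <= i < M) ratr (g i)) by rewrite ltxx.
    apply: (@le_trans _ _ (K%:R * \sum_(M <= i < M') ratr (g i))).
      by rewrite mulr_sumr; apply: ler_sum.
    rewrite ler_wpM2l // lerBrDl.
    by have := g1 M'; rewrite (big_cat_nat (n := M) (p := M')).
  have := series_nondecreasing f0 le; rewrite /series /= => le2.
  have : 0 <= K%:R * (x - \sum_(0 <= i < M) ratr (g i)) by rewrite mulr_ge0 // subr_ge0.
  by move: HM' le2; lra.
rewrite distrC ger0_norm ?subr_ge0 //.
have hx : x - \sum_(0 <= i < M) ratr (g i) <= 3 * 2 ^- k n.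
  have := Hq (k n); rewrite ler_norml => /andP[h _]; move: HM h; set e := 2 ^- _ => *; lra.
apply: (@le_trans _ _ (K%:R * (3 * 2 ^- k n))).
  by have := ler_wpM2l (ler0n _ K) hx; move: tail; lra.
have h3 : (3 * K)%:R <= 2 ^+ (3 * K) :> Rl by apply/ltW/lt_exp2.
have -> : K%:R * (3 * 2 ^- k n) = 2 ^- n * ((3 * K)%:R / 2 ^+ (3 * K)) :> Rl.
  by rewrite /k exprD invfM natrM; ring.
by rewrite ger_pMr ?invr_gt0 ?exprn_gt0 // ler_pdivrMr ?exprn_gt0 // mul1r.
Qed.

Lemma blen_unique L x : (2 ^ L <= x.+1)%N -> (x.+1 < 2 ^ L.+1)%N -> blen x = L.
Proof.
have [s Es] := nat_of_bits_surj x; have := nat_of_bits_bounds s.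
rewrite -Es blenE; move: (size s) (nat_of_bits s) => k y [h1 h2] h3 h4.
have : (2 ^ k < 2 ^ L.+1)%N by apply: leq_ltn_trans h1 h4.
have : (2 ^ L < 2 ^ k.+1)%N by apply: leq_ltn_trans h3 h2.
by rewrite !ltn_exp2l //; lia.
Qed.

Lemma blen_pred_exp n : blen (2 ^ n).-1 = n.
Proof.
have h := expn_gt0 2 n; apply: blen_unique; rewrite prednK //.
by rewrite ltn_exp2l.
Qed.

(** * Deciding the domain of a machine of computable measure *)

Definition fuelweight (c : prf) (s : nat) : rat :=
  \sum_(x <- iota 0 s) (if evalf c s x != None then (2 ^+ blen x)^-1 else 0).

Lemma ratr_exp2V n : ratr (2 ^+ n)^-1 = 2 ^- n :> Rl.
Proof. by rewrite fmorphV rmorphXn /= ratr_nat. Qed.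

Lemma fuelweight_approx c x d : sums_to (domweight c) x -> 0 < d ->
  exists s, x - d < ratr (fuelweight c s).
Proof.
move=> [h1 h2] d0; have [M HM] := h2 d d0.
have [s0 H0] : exists s0, forall s, (s0 <= s)%N -> forall k, (k < M)%N ->
    (exists y, Defs.eval c k y) -> evalf c s k != None.
  apply: eventually_forall_lt => k _.
  have [[y Hy]|nH] := pselect (exists y, Defs.eval c k y); last by exists 0%N.
  have [s0 H0] := evalf_complete Hy; exists s0 => s /H0 -> _ //.
pose s := maxn M s0; exists s; apply: (lt_le_trans HM).
rewrite /fuelweight ratr_sum (_ : iota 0 s = index_iota 0 s); last by rewrite /index_iota subn0.
rewrite (big_cat_nat (n := M) (p := s)) ?leq_maxl //=.
rewrite -[X in X <= _]addr0; apply: lerD.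
  rewrite big_nat [leRHS]big_nat; apply: ler_sum => k /andP[_ ltk].
  rewrite /domweight; case: asboolP => [ex|_].
    by rewrite (H0 s (leq_maxr _ _) k ltk ex) ratr_exp2V.
  by case: ifP; rewrite ler0q // => _; rewrite invr_ge0 exprn_ge0.
by apply: sumr_ge0 => k _; rewrite ler0q; case: ifP => // _; rewrite invr_ge0 exprn_ge0.
Qed.

Lemma domain_decidable c : computable_measure_machine c ->
  exists2 D : nat -> bool, cpt D & forall x, D x <-> exists y, Defs.eval c x y.
Proof.
move=> [pf /computable_realP [q cq Hq]]; have sOm := dom_measure_sums_to pf.
set Om := dom_measure c in Hq sOm.
(* When the weight found exceeds q - 2 * 2 ^- k it is within 3 * 2 ^- k of the measure. The weight
   of [x] is 4 * 2 ^- k, so an undetected [x] would make the total too large. *)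
pose k x := (blen x + 2)%N.
have exs x : exists s, q (k x) - 2 * (2 ^+ k x)^-1 < fuelweight c s.
  have [|s Hs] := fuelweight_approx sOm (d := 2 ^- k x); first by rewrite invr_gt0 exprn_gt0.
  exists s; rewrite -(ltr_rat Rl) rmorphB rmorphM /= ratr_exp2V ratr_nat.
  have := Hq (k x); rewrite ler_norml => /andP[_]; move: Hs; set e := 2 ^- _ => *; lra.
pose fu x := ex_minn (exs x).
have cfu : cpt fu.
  apply: (@cpt_ex_minn _ (fun x s => q (k x) - 2 * (2 ^+ k x)^-1 < fuelweight c s)).
  rewrite /k /fuelweight.
  have hb : cpt (fun x : nat * nat => blen x.1) by apply: cpt_blen; ct.
  have hb2 : cpt (fun x : nat * nat * nat => blen x.2) by apply: cpt_blen; ct.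
  have he : cpt (fun x : nat * nat * nat => evalf c x.1.2 x.2) by apply: cpt_evalf; ct.
  by ct.
exists (fun x => (x < fu x)%N && (evalf c (fu x) x != None)).
  have he : cpt (fun x => evalf c (fu x) x) by apply: cpt_evalf => //; ct.
  by ct.
move=> x; split.
  by move=> /andP[_]; case E: (evalf c (fu x) x) => [y|//] _; exists y; apply: evalf_sound E.
move=> ex; apply/negPn/negP => nD.
rewrite /fu in nD; case: ex_minnP nD => s Hs _ nD.
pose f i : Rl := ratr (if evalf c s i != None then (2 ^+ blen i)^-1 else 0).
have f_le i : f i <= domweight c i.
  rewrite /f /domweight; case E: (evalf c s i) => [y|] /=.
    by rewrite asboolT ?ratr_exp2V //; exists y; apply: evalf_sound E.
  by rewrite rmorph0; case: ifP => // _; rewrite invr_ge0 exprn_ge0.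
have f0 i : 0 <= f i by rewrite /f ler0q; case: ifP => // _; rewrite invr_ge0 exprn_ge0.
have key : ratr (fuelweight c s) + 2 ^- blen x <= Om.
  have [h1 _] := sOm; apply: le_trans (h1 (maxn s x.+1)).
  pose g i := if i == x then 0 else domweight c i.
  have E : \sum_(0 <= i < maxn s x.+1) domweight c i = \sum_(0 <= i < maxn s x.+1) g i + 2 ^- blen x.
    have xin : x \in index_iota 0 (maxn s x.+1) by rewrite mem_index_iota /= leq_maxr.
    rewrite (bigD1_seq x) ?iota_uniq //= [X in _ = X + _](bigD1_seq x) ?iota_uniq //=.
    have -> : g x = 0 by rewrite /g eqxx.
    rewrite add0r addrC; congr (_ + _).
      by apply: eq_bigr => i /negPf ix; rewrite /g ix.
    by rewrite /domweight asboolT.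
  rewrite E lerD2r /fuelweight ratr_sum (_ : iota 0 s = index_iota 0 s); last by rewrite /index_iota subn0.
  have g0 i : 0 <= g i by rewrite /g; case: ifP => // _; apply: domweight_ge0.
  apply: (@le_trans _ _ (\sum_(0 <= i < s) g i)).
    rewrite big_nat [leRHS]big_nat; apply: ler_sum => i /andP[_ lti].
    rewrite -/(f i) /g; case: eqP => [ix|_]; last exact: f_le.
    by move: nD; rewrite -ix lti /= negbK => /eqP E'; rewrite /f E' /= rmorph0.
  have := @series_nondecreasing g g0 s (maxn s x.+1) (leq_maxl _ _); apply.
have := Hq (k x); rewrite ler_norml => /andP[h _].
have : ratr (q (k x)) - 2 * 2 ^- k x < ratr (fuelweight c s) :> Rl.
  by move: Hs; rewrite -(ltr_rat Rl) rmorphB rmorphM /= ratr_exp2V ratr_nat.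
have e4 : 2 ^- blen x = 4 * 2 ^- k x :> Rl.
  by rewrite /k exprD invfM mulrCA mulrA; field; rewrite expf_neq0.
have : 0 < 2 ^- k x :> Rl by rewrite invr_gt0 exprn_gt0.
by move: key h; rewrite e4; set e := 2 ^- k x; lra.
Qed.

Lemma computable_value c (D : nat -> bool) : cpt D -> (forall x, D x <-> exists y, Defs.eval c x y) ->
  exists2 v : nat -> nat, cpt v & forall x y, Defs.eval c x y -> v x = y.
Proof.
move=> cD HD.
(* Outside the domain the search ends immediately, so the value function is total. *)
have exs x : exists s, ~~ D x || (evalf c s x != None).
  have [Dx|] := boolP (D x); last by exists 0%N.
  by have [y /evalf_complete [s Hs]] := (HD x).1 Dx; exists s; rewrite Hs.
have cfu : cpt (fun x => ex_minn (exs x)).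
  apply: (@cpt_ex_minn _ (fun x s => ~~ D x || (evalf c s x != None))).
  have he : cpt (fun x : nat * nat => evalf c x.2 x.1) by apply: cpt_evalf; ct.
  by ct.
exists (fun x => if evalf c (ex_minn (exs x)) x is Some y then y else 0%N).
  have he : cpt (fun x => evalf c (ex_minn (exs x)) x) by apply: cpt_evalf => //; ct.
  by ct.
move=> x y Hy; case: ex_minnP => s + _.
have -> : D x by apply/HD; exists y.
case E: (evalf c s x) => [z|//] _; exact: eval_det (evalf_sound E) Hy.
Qed.

(** * Coded vectors and sets as matrices *)

Section Glue.

Lemma in_boxE (bx : box) (z : Cx) : in_box bx z <->
  [/\ ratr bx.1.1.1 < 'Re z, 'Re z < ratr bx.1.1.2, ratr bx.1.2 < 'Im z & 'Im z < ratr bx.2].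
Proof. by case: bx => [[[a b] c] d]. Qed.

Lemma peval_pev p (z : Cx) : peval p z = pev p z.
Proof. by rewrite pevE. Qed.

Lemma alg_denote_appr (a : alg_code) (z : Cx) t : alg_denote a z ->
  `|gz Cx (appr a t) - z| <= ratr (2 ^+ t)^-1.
Proof.
case: a => p bx [nz rt /in_boxE [b1 b2 b3 b4] uq].
apply: appr_correct => //; first by rewrite -peval_pev.
by move=> w; rewrite -peval_pev => rw *; apply: uq => //; apply/in_boxE.
Qed.

Lemma alg_denote_mkalg (z : gq) (q : rat) : 0 < q ->
  alg_denote (mkalg z q) (gz Cx z / sqrtC (ratr q)).
Proof.
move=> q0; have [nz rt bx uq] := mkalg_spec Cx z q0.
rewrite /alg_denote; case E: (mkalg z q) nz rt bx uq => [p b] /= nz rt bx uq.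
split=> //; first by rewrite peval_pev.
  by apply/in_boxE.
by move=> w; rewrite peval_pev => rw /in_boxE [*]; apply: uq.
Qed.

Definition vc n (v : seq Cx) : 'cV[Cx]_n := \col_i nth 0 v i.

Lemma expval_qf n (tau : 'M[Cx]_(2 ^ n)) v : expval tau v = qf tau (vc (2 ^ n) v).
Proof.
rewrite /expval /qf mxE exchange_big /=; apply: eq_bigr => j _.
by rewrite mxE mulr_suml; apply: eq_bigr => i _; rewrite !mxE.
Qed.

Lemma inner_vc n v w : inner n v w = (adj (vc (2 ^ n) v) *m vc (2 ^ n) w) 0 0.
Proof. by rewrite mxE; apply: eq_bigr => i _; rewrite !mxE. Qed.

Definition colmx n (F : seq (seq Cx)) : 'M[Cx]_(n, size F) :=
  \matrix_(i, j) nth 0 (nth [::] F j) i.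

Lemma col_colmx n F j : col j (colmx n F) = vc n (nth [::] F j).
Proof. by apply/matrixP => i k; rewrite !mxE. Qed.

Lemma sum_expval n (tau : 'M[Cx]_(2 ^ n)) F :
  \sum_(v <- F) expval tau v = \tr (tau *m (colmx (2 ^ n) F *m adj (colmx (2 ^ n) F))).
Proof.
rewrite mxtrace_sum_qf (big_nth [::]) big_mkord; apply: eq_bigr => j _.
by rewrite col_colmx expval_qf.
Qed.

Lemma orthonormal_hproj n F : Defs.orthonormal n F -> uniq F ->
  hproj (colmx (2 ^ n) F *m adj (colmx (2 ^ n) F)).
Proof.
move=> [_ on] uF; set B := colmx _ _.
have BB : adj B *m B = 1%:M.
  apply/matrixP => i j; rewrite [RHS]mxE.
  have := on (nth [::] F i) (nth [::] F j) (mem_nth _ (ltn_ord i)) (mem_nth _ (ltn_ord j)).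
  rewrite nth_uniq // inner_vc mxE => <-; rewrite mxE; apply: eq_bigr => k _.
  by rewrite !mxE.
split; first by rewrite hadjM hadjK.
by rewrite !mulmxA -[B *m adj B *m B]mulmxA BB mulmx1.
Qed.

Lemma density_psd n (A : 'M[Cx]_(2 ^ n)) : density A -> psd A /\ \tr A = 1.
Proof. by case. Qed.

End Glue.

(** * Tests from machines *)

Lemma nth_flatten_grid (T : Type) (x0 : T) (f : nat -> nat -> T) M N i j :
  (i < M)%N -> (j < N)%N ->
  nth x0 (flatten [seq [seq f i j | j <- iota 0 N] | i <- iota 0 M]) (i * N + j) = f i j.
Proof.
suff H m : (i < M)%N -> (j < N)%N ->
    nth x0 (flatten [seq [seq f i j | j <- iota 0 N] | i <- iota m M]) (i * N + j) = f (m + i)%N j.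
  by move=> hi hj; rewrite H.
elim: M m i => [//|M IH] m [|i] lti ltj /=; rewrite nth_cat size_map size_iota.
  by rewrite mul0n add0n ltj (nth_map 0%N) ?size_iota // nth_iota // addn0.
rewrite mulSn -addnA ltnNge leq_addr /= addKn IH //; congr (f _ _); lia.
Qed.

Lemma size_flatten_grid (T : Type) (f : nat -> nat -> T) M N :
  size (flatten [seq [seq f i j | j <- iota 0 N] | i <- iota 0 M]) = (M * N)%N.
Proof.
suff H m : size (flatten [seq [seq f i j | j <- iota 0 N] | i <- iota m M]) = (M * N)%N.
  exact: H.
by elim: M m => [//|M IH] m /=; rewrite size_cat size_map size_iota IH mulSn.
Qed.

Lemma Re_natr n : complex.Re (n%:R : Cx) = n%:R.
Proof. by elim: n => [//|n IH]; rewrite -natr1 -[in RHS]natr1 -IH; case: (n%:R : Cx). Qed.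

Lemma log2_lt (a b m : nat) : (0 < m)%N -> a%:R + log2 m%:R < b%:R -> (m * 2 ^ a < 2 ^ b)%N.
Proof.
move=> m0; rewrite /log2 => lt.
have l2 : 0 < ln 2 :> Rl by rewrite ln_gt0 // ltr1n.
have : (m * 2 ^ a)%:R < (2 ^ b)%:R :> Rl; last by rewrite ltr_nat.
rewrite -ltr_ln ?posrE ?ltr0n ?muln_gt0 ?m0 ?expn_gt0 //.
rewrite natrM !natrX lnM ?posrE ?ltr0n ?exprn_gt0 // !lnXn ?ltr0n //.
have : (a%:R + ln m%:R / ln 2) * ln 2 < b%:R * ln 2 :> Rl by rewrite ltr_pM2r.
by rewrite mulrDl mulfVK ?gt_eqF // -(mulr_natl (ln 2) a) -(mulr_natl (ln 2) b) addrC.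
Qed.

Section Forward.
Variables (v : nat -> nat) (D : nat -> bool) (dd e : nat).
Hypotheses (cv_ : cpt v) (cD : cpt D).

Definition fcss x : seq (seq (seq rat * box)) :=
  if (unpickle (v x) : option (seq (seq (seq rat * box)))) is Some s then s else [::].
(** Recovers the number of qubits as the logarithm of the length of the first described vector. *)
Definition fdim x := blen (size (head [::] (fcss x))).-1.
(* Absorbs the factor 2 ^ N * size F in [tr_density_hproj_le]. *)
Definition fdelta x : rat := (2 ^+ (2 ^ fdim x + size (fcss x) + e + 2))^-1.
(** Keeps the squared error of an approximated vector below [fdelta x / 4], the tolerance of
    [gram_schmidt_size_labels]: one [2 ^ fdim x] pays for the number of entries, the last 2 bits for
    the quarter. *)
Definition fprec x := (2 ^ fdim x + 2 ^ fdim x + size (fcss x) + e + 4)%N.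
Definition fapprox x : seq gvec := map (fun s => map (fun a => appr a (fprec x)) s) (fcss x).
Definition fbasis x := gram_schmidt (2 ^ fdim x) (fdelta x) (fapprox x).
(** The size condition is put on the computed basis, which is known exactly and turns out to be at
    most |F|. Orthonormality of the output is not tested: the basis spans a projection in any case
    and the condition bounds its weight. Rejected inputs receive the zero projection, so the test is
    indexed by all numbers. *)
Definition fok x := D x && (size (fbasis x) * 2 ^ blen x <= 2 ^ (fdim x + dd))%N.
Definition fentry x (i j : nat) : gq := if fok x then gproj (2 ^ fdim x) (fbasis x) i j else g0.
Definition fcode x : seq (seq rat * box) :=
  flatten (map (fun i => map (fun j => mkalg (fentry x i j) 1) (iota 0 (2 ^ fdim x)))
    (iota 0 (2 ^ fdim x))).
Definition fproj x : 'M[Cx]_(2 ^ fdim x) := \matrix_(i, j) gz Cx (fentry x i j).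
Definition ftau x : rat := if fok x then (size (fbasis x))%:R / 2 ^+ fdim x else 0.

Lemma cpt_fcss : cpt fcss.
Proof.
have h : cpt (unpickle : nat -> option (seq (seq (seq rat * box)))).
  have hr := dcpt_rat; apply: dcpt_seq; apply: dcpt_seq.
  by apply: dcpt_pair; [exact: dcpt_seq|do 3 apply: dcpt_pair => //].
by rewrite /fcss; ct.
Qed.

Lemma cpt_fdim : cpt fdim.
Proof.
have h := cpt_fcss.
have h2 : cpt (fun x => (size (head [::] (fcss x))).-1).
  apply: (@cpt_ext _ _ (fun x => (size (nth [::] (fcss x) 0)).-1)); first by move=> x; rewrite nth0.
  by ct.
exact: cpt_blen h2.
Qed.

Lemma cpt_fbasis : cpt fbasis.
Proof.
have h1 := cpt_fcss; have h2 := cpt_fdim.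
have h3 : cpt fprec by rewrite /fprec; ct.
have h4 : cpt fdelta by rewrite /fdelta; ct.
have h5 : cpt fapprox by rewrite /fapprox; ct.
by rewrite /fbasis; ct.
Qed.

Lemma cpt_fok : cpt fok.
Proof.
have h1 := cpt_fbasis; have h2 := cpt_fdim.
have h3 : cpt (fun x : nat => blen x) by apply: cpt_blen; ct.
by rewrite /fok; ct.
Qed.

Lemma cpt_ftau : cpt ftau.
Proof. by have h1 := cpt_fbasis; have h2 := cpt_fdim; have h3 := cpt_fok; rewrite /ftau; ct. Qed.

Lemma cpt_fcode : cpt fcode.
Proof.
have h1 := cpt_fbasis; have h2 := cpt_fdim; have h3 := cpt_fok.
have h4 : cpt (fun p : nat * nat * nat => fentry p.1.1 p.1.2 p.2) by rewrite /fentry; ct.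
rewrite /fcode; ct.
by apply: cpt_mkalg; ct; apply: (cpt_comp h4 (f := fun p => p)); ct.
Qed.

Lemma fdelta_gt0 x : 0 < fdelta x.
Proof. by rewrite /fdelta invr_gt0 exprn_gt0. Qed.

Lemma fbasis_ortho x : orthobasis Cx (2 ^ fdim x) (fbasis x).
Proof. by apply: gram_schmidt_orthobasis; apply/ltW/fdelta_gt0. Qed.

Lemma fprojE x : fproj x = if fok x then cproj Cx (2 ^ fdim x) (fbasis x) else 0.
Proof.
apply/matrixP => i j; rewrite !mxE /fentry; case: ifP => _; first exact: gprojE.
by rewrite mxE gz0.
Qed.

Lemma fproj_hproj x : hproj (fproj x).
Proof.
rewrite fprojE; case: ifP => _; first by have [] := fbasis_ortho x.
by split; rewrite ?hadj0 ?mul0mx.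
Qed.

Lemma fproj_computable : computable_proj_seq fproj.
Proof.
split; first by move=> x; apply: fproj_hproj.
have [c Hc] := cpt_pair cpt_fdim cpt_fcode; exists c => x.
exists (pickle (fdim x, fcode x)); split; first exact: Hc.
exists (fcode x); split; first exact: pickleK.
split; first exact: size_flatten_grid.
move=> i j; rewrite /fcode nth_flatten_grid // mxE.
have := @alg_denote_mkalg (fentry x i j) 1 ltr01.
by rewrite rmorph1 sqrtC1 divr1.
Qed.

Lemma fproj_tau x : tauS (fproj x) = ratr (ftau x).
Proof.
rewrite /tauS fprojE /ftau; case: ifP => _; last by rewrite mxtrace0 mulr0 rmorph0.
have [_ -> _ _] := fbasis_ortho x.
by rewrite Re_natr fmorph_div /= ratr_nat rmorphXn /= ratr_nat mulrC.
Qed.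

Lemma ftau_le x : 0 <= ftau x <= (2 ^ dd)%N%:R * (if D x then (2 ^+ blen x)^-1 else 0).
Proof.
rewrite /ftau /fok; case: (D x) => /=; last by rewrite mulr0 lexx.
case: leqP => le; last by rewrite lexx mulr_ge0 // invr_ge0 exprn_ge0.
rewrite divr_ge0 ?exprn_ge0 //= ler_pdivrMr ?exprn_gt0 // mulrAC ler_pdivlMr ?exprn_gt0 //.
by rewrite -!natrX -!natrM ler_nat mulnC -expnD [(dd + _)%N]addnC mulnC.
Qed.

Lemma fproj_test c : computable_measure_machine c ->
  (forall x, D x <-> exists y, Defs.eval c x y) -> quantum_Schnorr_test fproj.
Proof.
move=> [pf com] HD.
have cg : cpt (fun x => if D x then (2 ^+ blen x)^-1 else 0 : rat).
  have hb : cpt (fun x : nat => blen x) by apply: cpt_blen; ct.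
  by ct.
have sg : sums_to (fun x => ratr (if D x then (2 ^+ blen x)^-1 else 0)) (dom_measure c).
  have -> : (fun x => ratr (if D x then (2 ^+ blen x)^-1 else 0)) = domweight c.
    apply/funext => x; rewrite /domweight; case: asboolP => [/HD ->|nD].
      by rewrite ratr_exp2V.
    by case: ifP => [/HD //|_]; rewrite rmorph0.
  exact: dom_measure_sums_to.
have [y sy cy] := dominated_computable cpt_ftau cg ftau_le sg com.
have E : (fun m => tauS (fproj m)) = (fun x => ratr (ftau x)).
  by apply/funext => x; apply: fproj_tau.
have t0 i : 0 <= ratr (ftau i) :> Rl by rewrite ler0q; case/andP: (ftau_le i).
have [c1 c2] := series_sums_to t0 sy.
by split; [split; [exact: fproj_computable|rewrite E]|rewrite E c2].
Qed.

Lemma fproj_catches (rho : forall n, 'M[Cx]_(2 ^ n)) n (eps : Rl) c pi k F :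
  density (rho n) -> 0 < eps ->
  (forall x, D x <-> exists y, Defs.eval c x y) ->
  (forall x y, Defs.eval c x y -> v x = y) ->
  mrun c pi k -> set_denote k F -> Defs.orthonormal n F ->
  (eps%:C)%C < \sum_(w <- F) expval (rho n) w ->
  (size pi)%:R + log2 (size F)%:R < (n + dd)%:R ->
  fdim (nat_of_bits pi) = n /\
  (eps%:C)%C < 2 * rhoS rho (fproj (nat_of_bits pi)) + 2 * ratr (2 ^+ e)^-1.
Proof.
move=> dens eps0 HD Hv run sd on lt len.
set x := nat_of_bits pi.
have Dx : D x by apply/HD; exists k.
have vx : v x = k by apply: Hv.
have [css [vs [unp [szc [den FE]]]]] := sd.
have cssE : fcss x = css by rewrite /fcss vx unp.
have memF i : (i < size vs)%N -> nth [::] vs i \in F by move=> lti; rewrite FE mem_undup mem_nth.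
(* A positive level excludes the empty set, so there is a first vector from which [fdim] reads the
   dimension. *)
have szF : (0 < size F)%N.
  rewrite lt0n; apply/eqP => /size0nil E; move: lt; rewrite E big_nil.
  by rewrite -[X in _ < X]/(0%:C)%C ltcR ltNge ltW.
have szvs : (0 < size vs)%N by move: szF; rewrite FE; case: (vs).
have size_i i : (i < size vs)%N -> size (nth [::] css i) = (2 ^ n)%N.
  move=> lti; have [-> _] := den i (etrans (congr1 (leq i.+1) szc) lti).
  by case: on => h _; apply: h; apply: memF.
have En : fdim x = n.
  by rewrite /fdim cssE -nth0 size_i // blen_pred_exp.
split=> //; subst n.
set N := (2 ^ fdim x)%N in memF size_i *.
have [hpsd tr1] := density_psd dens.
have d0 := ltW (fdelta_gt0 x).
pose eta := fdelta x / 4.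
have close i : (i < size (fapprox x))%N ->
    nrm2 (cv Cx N (nth [::] (fapprox x) i) - vc N (nth [::] vs i)) <= ratr eta.
  rewrite size_map cssE szc => lti.
  have lti' : (i < size css)%N by rewrite szc.
  have [sz1 den1] := den i lti'.
  apply: (@le_trans _ _ (\sum_(j < N) ratr ((2 ^+ fprec x)^-1 ^+ 2))).
    rewrite nrm2E; apply: ler_sum => j _; rewrite !mxE rmorphXn /=.
    have ltj : (j < size (nth [::] css i))%N by rewrite size_i.
    rewrite ler_pXn2r ?nnegrE ?normr_ge0 ?ler0q ?invr_ge0 ?exprn_ge0 //.
    rewrite /fapprox (nth_map [::]) ?cssE // (nth_map alg_code0) //.
    exact: alg_denote_appr (den1 _ ltj).
  rewrite sumr_const card_ord -rmorphMn /= ler_rat -mulr_natl /eta /fdelta cssE /fprec cssE.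
  set s := size css; rewrite -[(2 ^ fdim x)%N]/N.
  have hN : N%:R <= 2 ^+ N :> rat by rewrite -natrX ler_nat ltnW // ltn_expl.
  rewrite exprVn -exprM mulnC mul2n -addnn exprD invfM mulrA.
  apply: (@le_trans _ _ ((2 ^+ N * (2 ^+ (N + N + s + e + 4))^-1) * 1)).
    apply: ler_pM; rewrite ?mulr_ge0 ?invr_ge0 ?exprn_ge0 //.
      by rewrite ler_pM2r ?invr_gt0 ?exprn_gt0.
    by rewrite invf_le1 ?exprn_gt0 // exprn_ege1 // ler1n.
  rewrite mulr1 !exprD !invfM; set a := 2 ^+ N.
  have a0 : a != 0 by rewrite expf_neq0.
  by rewrite -!mulrA mulVKf ?a0 //; lra.
have szU : (size (fbasis x) <= size F)%N.
  (* The labels are the denoted vectors themselves, so several codes of one vector count once, in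
     agreement with [undup]. *)
  rewrite FE; apply: (@gram_schmidt_size_labels Cx N _ (fdelta x) eta _ vs (vc N)) => //.
  - by rewrite /eta; lra.
  - by rewrite size_map cssE szc.
  - by move=> i lti t0; rewrite (set_nth_default [::] t0) ?close //; move: lti; rewrite size_map cssE szc.
have okx : fok x.
  rewrite /fok Dx /= blenE; apply: (leq_trans (leq_mul szU (leqnn _))).
  exact/ltnW/log2_lt.
rewrite /rhoS fprojE okx.
set P := cproj _ _ _; have [hP _ _ _] := fbasis_ortho x.
have uF : uniq F by rewrite FE undup_uniq.
have hB := orthonormal_hproj on uF.
(* Twice the distance [fdelta x] of the approximant and twice its error [fdelta x / 4], rounded up
   to 3. *)
have far j : dist2 P (col j (colmx N F)) <= ratr (3 * fdelta x).
  rewrite col_colmx.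
  have : nth [::] F j \in vs by rewrite -mem_undup -FE mem_nth.
  move=> /(nthP [::]) [i lti <-].
  have lti' : (i < size (fapprox x))%N by rewrite size_map cssE szc.
  rewrite -(subrK (cv Cx N (nth [::] (fapprox x) i)) (vc N _)) addrC.
  apply: (le_trans (dist2D_le _ _ hP)).
  have h1 : dist2 P (cv Cx N (nth [::] (fapprox x) i)) <= ratr (fdelta x).
    by apply: gram_schmidt_dist2 => //; apply: mem_nth.
  have h2 := close i lti'; rewrite -nrm2N opprB in h2.
  have -> : ratr (3 * fdelta x) = 2 * ratr (fdelta x) + 2 * ratr (fdelta x / 2) :> Cx.
    by rewrite -(ratr_nat Cx 2) -!rmorphM -rmorphD; congr ratr; field.
  apply: lerD; rewrite ler_wpM2l //; apply: (le_trans h2).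
  by rewrite ler_rat /eta; lra.
have := tr_density_hproj_le hpsd tr1 hP hB far; rewrite -sum_expval => le.
apply: (lt_le_trans lt); apply: (le_trans le); rewrite lerD2l ler_wpM2l //.
rewrite -(ratr_nat Cx 2) -rmorphXn -(ratr_nat Cx (size F)) -!rmorphM /= ler_rat.
have szFs : (size F <= size css)%N by rewrite FE szc size_undup.
rewrite /fdelta cssE; set s := size css in szFs *; rewrite -[(2 ^ fdim x)%N]/N.
have hs : (size F)%:R <= 2 ^+ s :> rat.
  by rewrite -natrX ler_nat (leq_trans szFs) // ltnW // ltn_expl.
rewrite !exprD !invfM; set a := 2 ^+ N; set b := 2 ^+ s in hs *; set d := (2 ^+ e)^-1.
have a0 : a != 0 by rewrite expf_neq0.
have b0 : 0 < b by rewrite exprn_gt0.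
have dd0 : 0 <= d by rewrite invr_ge0 exprn_ge0.
have -> : a * ((size F)%:R * (3 * (a^-1 * b^-1 * d / 2 ^+ 2))) = ((size F)%:R / b) * (3 / 4) * d.
  by field; rewrite a0 gt_eqF.
have : (size F)%:R / b <= 1 by rewrite ler_pdivrMr // mul1r.
set r := _ / b => hr; have : 0 <= (1 - r) * d by rewrite mulr_ge0 // subr_ge0.
by nra.
Qed.

End Forward.

(** The infimum may fail to be attained; one unit of slack produces an actual description and is
    later absorbed by passing from [d] to [d.+1]. *)
Lemma QK_le_witness n c (eps : Rl) (tau : 'M[Cx]_(2 ^ n)) (b : nat) :
  (QK c eps tau <= b%:R%:E)%E ->
  exists pi k F, [/\ mrun c pi k, set_denote k F, Defs.orthonormal n F,
     (eps%:C)%C < \sum_(w <- F) expval tau w &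
     (size pi)%:R + log2 (size F)%:R < (b + 1)%:R].
Proof.
move=> le; apply: contrapT => nex.
suff : ((b + 1)%:R%:E <= QK c eps tau)%E.
  by move=> /le_trans /(_ le); rewrite lee_fin ler_nat addn1 ltnn.
apply: le_ereal_inf_tmp => _ [pi [k [F [h1 h2 h3 h4 ->]]]].
rewrite lee_fin leNgt; apply/negP => lt; apply: nex.
by exists pi, k, F.
Qed.

(** Closes both directions: the factor 2 and the additive error of the catching inequalities cost at
    most a factor 8 in the level. *)
Lemma real_gt_level (eps : Rl) (r : Cx) e : 0 < eps -> 2 ^- e < eps / 4 -> 
  (eps%:C)%C < 2 * r + 2 * ratr (2 ^+ e)^-1 -> ((eps / 8)%:C)%C < r.
Proof.
move=> eps0 lt.
have -> : ratr (2 ^+ e)^-1 = ((2 ^- e)%:C)%C :> Cx.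
  by rewrite fmorphV rmorphXn /= ratr_nat -[in RHS]/(real_complex _ _) fmorphV rmorphXn /= rmorph_nat.
rewrite -ltrBlDr => h.
have : ((eps / 4)%:C)%C < 2 * r.
  apply: le_lt_trans h; rewrite -(rmorph_nat (real_complex Rl) 2) -rmorphM -rmorphB /= lecR; lra.
rewrite -ltr_pdivrMl // => h2; apply: le_lt_trans h2.
rewrite -(rmorph_nat (real_complex Rl) 2) -fmorphV -rmorphM /= lecR; lra.
Qed.

Lemma random_QK (rho : forall n, 'M[Cx]_(2 ^ n)) c (eps : Rl) (d : nat) :
  is_state rho -> quantum_Schnorr_random rho -> computable_measure_machine c -> 0 < eps ->
  exists n0, forall n, (n0 <= n)%N -> ((n + d)%:R%:E < QK c eps (rho n))%E.
Proof.
move=> [dens _] rand cmm eps0; apply: contrapT => nex.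
have [D cD HD] := domain_decidable cmm.
have [v cv_ Hv] := computable_value cD HD.
have [e He] : exists e, 2 ^- e < eps / 4 :> Rl.
  have h0 : 0 < eps / 4 by rewrite divr_gt0.
  exists (Num.bound (eps / 4)^-1); rewrite invf_plt ?posrE ?exprn_gt0 //.
  by apply: lt_trans (lt_exp2 _); apply: Num.Theory.archi_boundP; rewrite invr_ge0 ltW.
apply: (rand _ _ (fproj_test (d.+1) e cv_ cD cmm HD) (eps / 8)); first by lra.
move=> M.
(* Failure needs an index at least [M]. The index is the description itself and has dimension [n],
   so choosing [n] above the dimensions of the first [M] projections forces it to be late. *)
have [n [lenM le]] : exists n, (\max_(x < M) (fdim v x).+1 <= n)%N /\ (QK c eps (rho n) <= (n + d)%:R%:E)%E.
  apply: contrapT => nex2; apply: nex; exists (\max_(x < M) (fdim v x).+1)%N => n len.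
  by rewrite ltNge; apply/negP => le; apply: nex2; exists n.
have [pi [k [F [h1 h2 h3 h4 h5]]]] := QK_le_witness le.
rewrite -addnA addn1 in h5.
have [En cat] := fproj_catches e (dens n) eps0 HD Hv h1 h2 h3 h4 h5.
exists (nat_of_bits pi); split; last exact: real_gt_level cat.
rewrite leqNgt; apply/negP => lt; move: lenM; rewrite leqNgt => /negP; apply.
by rewrite -En; apply: (leq_bigmax (Ordinal lt)).
Qed.

(** * Machines from tests *)

Lemma sum_unique_le (s : seq nat) (P : pred nat) (v : Rl) : uniq s -> 0 <= v ->
  (forall m m', P m -> P m' -> m = m') -> \sum_(m <- s) (if P m then v else 0) <= v.
Proof.
move=> us v0 uP; have [/hasP [m ms Pm]|/hasPn nP] := boolP (has P s); last first.
  by rewrite big1_seq // => m /nP /negPf ->.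
rewrite (bigD1_seq m) //= Pm big1 ?addr0 // => i /eqP im.
by case: ifP => // Pi; case: im; apply: uP.
Qed.

Lemma sum_member_ge (s : seq nat) (P : pred nat) (F : nat -> Rl) m : uniq s ->
  (forall i, 0 <= F i) -> m \in s -> P m -> F m <= \sum_(i <- s) (if P i then F i else 0).
Proof.
move=> us F0 ms Pm; rewrite (bigD1_seq m) //= Pm lerDl sumr_ge0 // => i _.
by case: ifP.
Qed.

(** Each partial sum of one series is bounded by a partial sum of the other through a double sum
    over the incidence [T x m], which holds for at most one [m] per [x] and one [x] per [m]. It
    carries the weights of test indices over to their codewords. *)
Lemma sums_to_reindex (h g : nat -> Rl) (act : nat -> bool) (code : nat -> nat) y :
  (forall m m', act m -> act m' -> code m = code m' -> m = m') ->
  (forall m, 0 <= h m) -> (forall x, 0 <= g x) ->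
  (forall m, ~~ act m -> h m = 0) -> (forall m, act m -> g (code m) = h m) ->
  (forall x, g x != 0 -> exists2 m, act m & code m = x) ->
  sums_to h y -> sums_to g y.
Proof.
move=> inj h0 g0 nact gh gsupp [h1 h2].
pose T x m := act m && (code m == x).
have uT x m m' : T x m -> T x m' -> m = m'.
  by move=> /andP[a /eqP <-] /andP[a' /eqP E]; apply: inj.
split=> [M|d d0].
  have [M' HM'] : exists M', forall M1, (M' <= M1)%N -> forall x, (x < M)%N -> g x != 0 ->
      exists2 m, (m < M1)%N & T x m.
    apply: (@eventually_forall_lt (fun x M1 => g x != 0 -> exists2 m, (m < M1)%N & T x m)) => x _.
    have [E|nz] := boolP (g x == 0); first by exists 0%N.
    have [m am cm] := gsupp x nz; exists m.+1 => M1 lt _; exists m => //.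
    by rewrite /T am cm eqxx.
  apply: le_trans (h1 M').
  apply: (@le_trans _ _ (\sum_(0 <= x < M) \sum_(0 <= m < M') (if T x m then h m else 0))).
    rewrite big_nat [leRHS]big_nat; apply: ler_sum => x /andP[_ ltx].
    have [->|nz] := eqVneq (g x) 0; first by apply: sumr_ge0 => m _; case: ifP.
    have [m ltm Tm] := HM' M' (leqnn _) x ltx nz.
    have -> : g x = h m by move: Tm => /andP[am /eqP <-]; apply: gh.
    by apply: sum_member_ge => //; rewrite ?iota_uniq // mem_index_iota.
  rewrite exchange_big /=; apply: ler_sum => m _.
  by apply: sum_unique_le; rewrite ?iota_uniq // => x x' /andP[_ /eqP <-] /andP[_ /eqP].
have [M' HM'] := h2 d d0.
pose M := (\max_(m < M') (code m).+1)%N; exists M; apply: lt_le_trans HM' _.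
apply: (@le_trans _ _ (\sum_(0 <= m < M') \sum_(0 <= x < M) (if T x m then g x else 0))).
  rewrite big_nat [leRHS]big_nat; apply: ler_sum => m /andP[_ ltm].
  have [am|/nact ->] := boolP (act m); last by apply: sumr_ge0 => x _; case: ifP.
  rewrite -(gh m am); apply: (@sum_member_ge _ (fun x => T x m) g) => //.
  - by rewrite iota_uniq.
  - by rewrite mem_index_iota /=; apply: (leq_bigmax (Ordinal ltm)).
  - by rewrite /T am eqxx.
rewrite exchange_big /=; apply: ler_sum => x _.
by apply: sum_unique_le; rewrite ?iota_uniq //; apply: uT.
Qed.

(** * Shannon-Fano-Elias codes and their machine *)

(** Most significant bit first, so that extending a word means passing to a dyadic subinterval. *)
Definition msb k a : seq bool := [seq odd (a %/ 2 ^ (k - i.+1)) | i <- iota 0 k].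

Lemma size_msb k a : size (msb k a) = k.
Proof. by rewrite size_map size_iota. Qed.

Lemma msbS k a : msb k.+1 a = rcons (msb k a./2) (odd a).
Proof.
rewrite /msb -[X in iota 0 X]addn1 iotaD map_cat /= add0n subnn divn1 cats1; congr rcons.
apply/eq_in_map => i; rewrite mem_iota /= => lti.
by rewrite subSS -(subnSK lti) expnS divnMA divn2.
Qed.

Lemma msb_inj k a b : (a < 2 ^ k)%N -> (b < 2 ^ k)%N -> msb k a = msb k b -> a = b.
Proof.
elim: k a b => [|k IH] a b; first by rewrite !ltnS !leqn0 => /eqP -> /eqP ->.
rewrite !msbS expnS => la lb /rcons_inj [/IH E eo].
rewrite -(odd_double_half a) -(odd_double_half b) eo E //; lia.
Qed.

Lemma msb_prefix k k' a a' : (a < 2 ^ k)%N -> (a' < 2 ^ k')%N -> prefix (msb k a) (msb k' a') ->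
  (k <= k')%N /\ a = (a' %/ 2 ^ (k' - k))%N.
Proof.
move=> la la' pre; have lek := size_prefix pre; rewrite !size_msb in lek; split=> //.
apply: (@msb_inj k) => //.
  by rewrite ltn_divLR ?expn_gt0 // -expnD subnKC.
move: pre; rewrite prefixE size_msb => /eqP <-.
rewrite /msb -map_take take_iota (minn_idPl lek); apply/eq_in_map => i.
rewrite mem_iota /= => lti; rewrite -divnMA -expnD; congr (odd (_ %/ 2 ^ _)); lia.
Qed.

Lemma nat_of_bits_foldr s :
  nat_of_bits s = foldr (fun (b : bool) y => (y.*2 + b + 1)%N) 0%N s.
Proof. by elim: s => //= b s ->. Qed.

Section KraftMachine.
Variables (act : nat -> bool) (l out : nat -> nat).
Hypotheses (cact : cpt act) (cl : cpt l) (cout : cpt out).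
Definition kweight m : rat := if act m then (2 ^+ l m)^-1 else 0.
Definition kcumul m : rat := \sum_(i <- iota 0 m) kweight i.
Hypothesis kle1 : forall m, kcumul m <= 1.

Lemma kweight_ge0 m : 0 <= kweight m.
Proof. by rewrite /kweight; case: ifP => // _; rewrite invr_ge0 exprn_ge0. Qed.

Lemma kcumulS m : kcumul m.+1 = kcumul m + kweight m.
Proof. by rewrite /kcumul -addn1 iotaD big_cat /= big_seq1. Qed.

Lemma kcumul_mono m m' : (m <= m')%N -> kcumul m <= kcumul m'.
Proof.
move=> /subnKC <-; elim: (m' - m)%N => [|k IH]; first by rewrite addn0.
by rewrite addnS kcumulS (le_trans IH) // lerDl kweight_ge0.
Qed.

Lemma kcumul_ge0 m : 0 <= kcumul m.
Proof. by apply: sumr_ge0 => i _; apply: kweight_ge0. Qed.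

(* The dyadic interval of the [m]-th codeword lies between [kcumul m] and
   [kcumul m.+1]. *)
Lemma kindex_exists m : exists a : nat, kcumul m * 2 ^+ (l m).+1 <= a%:R.
Proof.
exists (Num.bound (kcumul m * 2 ^+ (l m).+1)); apply/ltW/Num.Theory.archi_boundP.
by rewrite mulr_ge0 ?kcumul_ge0 ?exprn_ge0.
Qed.

Definition kindex m := ex_minn (kindex_exists m).

Lemma kindex_lower m : kcumul m <= (kindex m)%:R / 2 ^+ (l m).+1.
Proof.
by rewrite ler_pdivlMr ?exprn_gt0 // /kindex; case: ex_minnP.
Qed.

(** Rounding up to the grid of mesh 2 ^- (l + 1) loses less than one mesh and the interval occupies
    another; together they fit in the weight 2 ^- l. This is why codewords have [l + 1] bits. *)
Lemma kindex_upper m : act m -> (kindex m).+1%:R / 2 ^+ (l m).+1 <= kcumul m.+1.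
Proof.
move=> am; rewrite ler_pdivrMr ?exprn_gt0 // kcumulS /kweight am mulrDl.
have -> : (2 ^+ l m)^-1 * 2 ^+ (l m).+1 = 2 :> rat.
  by rewrite exprS mulrCA mulVf ?mulr1 // expf_neq0.
rewrite /kindex; case: ex_minnP => -[|a] _ mn.
  have : 0 <= kcumul m * 2 ^+ (l m).+1 by rewrite mulr_ge0 ?kcumul_ge0 ?exprn_ge0.
  by lra.
have : a%:R < kcumul m * 2 ^+ (l m).+1.
  by rewrite ltNge; apply/negP => /mn; rewrite ltnn.
by rewrite -[in X in _ -> X](natr1 a.+1) -(natr1 a); lra.
Qed.

Lemma kindex_lt m : act m -> (kindex m < 2 ^ (l m).+1)%N.
Proof.
move=> am; have := le_trans (kindex_upper am) (kle1 m.+1).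
by rewrite ler_pdivrMr ?exprn_gt0 // mul1r -natrX ler_nat.
Qed.

Definition kword m := msb (l m).+1 (kindex m).
Definition kcode m := nat_of_bits (kword m).

(** A codeword extending another would have its dyadic interval inside the other's, whereas
    different indices occupy disjoint intervals between consecutive cumulative weights. *)
Lemma kword_prefix_free m m' : act m -> act m' -> prefix (kword m) (kword m') -> m = m'.
Proof.
move=> am am' /(msb_prefix (kindex_lt am) (kindex_lt am')) [lek E].
have d0 := expn_gt0 2 ((l m').+1 - (l m).+1).
have Ek : (2 ^ (l m').+1 = 2 ^ ((l m').+1 - (l m).+1) * 2 ^ (l m).+1)%N by rewrite -expnD subnK.
have lo : (kindex m)%:R / 2 ^+ (l m).+1 <= (kindex m')%:R / 2 ^+ (l m').+1 :> rat.
  rewrite ler_pdivrMr ?exprn_gt0 // mulrAC ler_pdivlMr ?exprn_gt0 //.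
  have : (kindex m * 2 ^ (l m').+1 <= kindex m' * 2 ^ (l m).+1)%N.
    by rewrite Ek mulnA leq_mul2r E leq_divM orbT.
  by rewrite -(ler_nat rat) !natrM !natrX.
have hi : (kindex m')%:R / 2 ^+ (l m').+1 < (kindex m).+1%:R / 2 ^+ (l m).+1 :> rat.
  rewrite ltr_pdivrMr ?exprn_gt0 // mulrAC ltr_pdivlMr ?exprn_gt0 //.
  have : (kindex m' * 2 ^ (l m).+1 < (kindex m).+1 * 2 ^ (l m').+1)%N.
    by rewrite Ek mulnA ltn_mul2r expn_gt0 E ltn_ceil.
  by rewrite -(ltr_nat rat) !natrM !natrX.
have [lt|lt|//] := ltngtP m m'.
  by exfalso; have := kindex_lower m'; have := kcumul_mono lt; have := kindex_upper am; lra.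
exfalso; have := kindex_lower m; have := kcumul_mono lt; have := kindex_upper am'.
have : (kindex m')%:R / 2 ^+ (l m').+1 < (kindex m').+1%:R / 2 ^+ (l m').+1 :> rat.
  by rewrite ltr_pM2r ?invr_gt0 ?exprn_gt0 // ltr_nat.
lra.
Qed.

Lemma cpt_kcode : cpt kcode.
Proof.
have hw : cpt kweight by rewrite /kweight; ct.
have hc : cpt kcumul by rewrite /kcumul; ct.
have hi : cpt kindex.
  by apply: (@cpt_ex_minn _ (fun m a => kcumul m * 2 ^+ (l m).+1 <= a%:R)); ct.
apply: (@cpt_ext _ _ (fun m => foldr (fun (b : bool) y => (y.*2 + b + 1)%N) 0%N (msb (l m).+1 (kindex m)))).
  by move=> m; rewrite /kcode nat_of_bits_foldr.
by rewrite /msb; ct.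
Qed.

Lemma kcode_inj m m' : act m -> act m' -> kcode m = kcode m' -> m = m'.
Proof.
by move=> am am' /nat_of_bits_inj E; apply: kword_prefix_free => //; rewrite E prefix_refl.
Qed.

(** The machine looks for the active index whose codeword is its input, and diverges if there is
    none; injectivity of the code determines what it finds. *)
Lemma kraft_search : exists c, forall x y, Defs.eval c x y <-> exists2 m, act m & kcode m = x /\ out m = y.
Proof.
have hk := cpt_kcode.
have [t Ht] : cpt (fun z => if act (cunpair z).2 && (kcode (cunpair z).2 == (cunpair z).1) then 0%N else 1%N).
  have h1 : cpt (fun z : nat => cunpair z) by apply: cpt_cunpair; ct.
  by ct.
have {}Ht x m : Defs.eval t (cpair x m) (if act m && (kcode m == x) then 0%N else 1%N).
  by have := Ht (cpair x m); rewrite /= cpairK.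
have [po Ho] := cout; exists (PComp po (PMu t)) => x y; split.
  move=> H; inversion H as [| | | | |f g x0 m z Hm Ho' | | | |]; subst.
  inversion Hm as [| | | | | | | | |f0 x1 n1 Hn _]; subst.
  have := eval_det (Ht x m) Hn; case: ifP => // /andP[am /eqP cm] _.
  by exists m => //; split => //; apply: eval_det (Ho m) Ho'.
move=> [m am [cm <-]]; apply: eval_comp (Ho m); apply: eval_mu.
  by have := Ht x m; rewrite am cm eqxx.
move=> k lt; exists 0%N; have := Ht x k; case: ifP => // /andP[ak /eqP ck].
by have := kcode_inj ak am; rewrite ck cm => /(_ erefl) E; rewrite E ltnn in lt.
Qed.

Lemma kraft_machine x : sums_to (fun m => ratr (kweight m)) x -> computable_real x ->
  exists2 c, computable_measure_machine c &
    forall m, act m -> exists2 pi, size pi = (l m).+1 & mrun c pi (out m).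
Proof.
move=> sx cx; have [c Hc] := kraft_search; exists c; last first.
  by move=> m am; exists (kword m); rewrite ?size_msb //; apply/Hc; exists m.
have domE p : mdom c p -> exists2 m, act m & p = kword m.
  by move=> [y /Hc [m am [/nat_of_bits_inj <- _]]]; exists m.
have pf : prefix_free_machine c.
  move=> p q /domE [m am ->] /domE [m' am' ->] /(kword_prefix_free am am') -> //.
split=> //.
have hw : cpt kweight by rewrite /kweight; ct.
(* The extra bit of every codeword halves its weight. *)
have [y sy cy] : exists2 y, sums_to (fun m => ratr (kweight m / 2)) y & computable_real y.
  apply: (@dominated_computable _ kweight 1 x) => //; first by ct.
  by move=> i; have := kweight_ge0 i; rewrite mul1r => h; apply/andP; split; lra.
suff -> : dom_measure c = y by [].
apply: sums_to_unique (dom_measure_sums_to pf) _.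
apply: (@sums_to_reindex (fun m => ratr (kweight m / 2)) _ act kcode) => //.
- exact: kcode_inj.
- by move=> m; rewrite ler0q divr_ge0 // kweight_ge0.
- exact: domweight_ge0.
- by move=> m /negPf am; rewrite /kweight am mul0r rmorph0.
- move=> m am; rewrite /domweight asboolT; last by exists (out m); apply/Hc; exists m.
  by rewrite blenE size_msb /kweight am -invfM -exprSr ratr_exp2V.
- move=> z; rewrite /domweight; case: asboolP => [[w /Hc [m am [<- _]]] _|_]; last by rewrite eqxx.
  by exists m.
Qed.

End KraftMachine.

(** * Ranks and column spaces of the projections of a test *)

(** In a full rank factorisation S = L R, idempotence forces R L = 1. A trace can be approximated
    entrywise, so the rank becomes computable. *)
Lemma idempotent_trace (F : fieldType) n (S : 'M[F]_n) : S *m S = S -> \tr S = (\rank S)%:R.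
Proof.
move=> SS; have E := mulmx_base S.
have RL : row_base S *m col_base S = 1%:M.
  have fR := row_base_free S; have fL := col_base_full S.
  apply: (row_free_inj fR); apply: (row_full_inj fL).
  by rewrite mul1mx E -[in RHS]SS -[in RHS]E !mulmxA.
by rewrite -[in LHS]E mxtrace_mulC RL mxtrace1.
Qed.

Lemma Cx_real_lift (x : Cx) : x \is Num.real -> x = ((complex.Re x)%:C)%C.
Proof.
case: x => a b; rewrite realE !lecE /= => /orP[] /andP[/eqP h _]; first by rewrite h.
by rewrite -h.
Qed.

Lemma Cx_nat_bound (x : Cx) : 0 <= x -> exists K : nat, x <= K%:R.
Proof.
move=> x0; have xr : x \is Num.real by rewrite ger0_real.
exists (Num.bound (complex.Re x)); rewrite [X in X <= _]Cx_real_lift //.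
rewrite -(rmorph_nat (real_complex Rl)) /= lecR; apply/ltW/Num.Theory.archi_boundP.
by move: x0; rewrite [X in _ <= X]Cx_real_lift // -[X in X <= _]/(0%:C)%C lecR.
Qed.

Lemma rat_approx (x : Cx) (d : rat) : x \is Num.real -> 0 < d ->
  exists q : rat, `|ratr q - x| <= ratr d.
Proof.
move=> xr d0; rewrite [x]Cx_real_lift //; set a := complex.Re x.
have d0' : 0 < ratr d :> Rl by rewrite ltr0q.
have [|q] := @rat_in_itvoo Rl (a - ratr d) (a + ratr d); first by lra.
rewrite in_itv /= => /andP[h1 h2]; exists q.
rewrite -2!(fmorph_rat (real_complex Rl)) -rmorphB /= normc_def /=.
rewrite expr0n /= addr0 sqrtr_sqr lecR ler_norml; apply/andP; split; lra.
Qed.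

Lemma gq_approx (z : Cx) (d : rat) : 0 < d -> exists w : gq, `|gz Cx w - z| <= ratr d.
Proof.
move=> d0; have d2 : 0 < d / 2 by rewrite divr_gt0.
have [a Ha] := rat_approx (Creal_Re z) d2; have [b Hb] := rat_approx (Creal_Im z) d2.
exists (a, b); apply: le_trans (gz_dist _ _) _ => /=.
have -> : ratr d = ratr (d / 2) + ratr (d / 2) :> Cx by rewrite -rmorphD; congr ratr; field.
exact: lerD.
Qed.

Lemma nrm2_le_entries n (v : 'cV[Cx]_n) (b : Cx) : (forall i, `|v i 0| <= b) ->
  nrm2 v <= n%:R * b ^+ 2.
Proof.
move=> H; rewrite nrm2E mulr_natl -[X in _ *+ X]card_ord -sumr_const.
by apply: ler_sum => i _; rewrite lerXn2r ?nnegrE ?normr_ge0 // (le_trans (normr_ge0 _) (H i)).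
Qed.

(** Round the columns of L in S = L R to Gaussian rationals and recombine them with the exact
    coefficients R. Membership of [y] in the span is expressed by every matrix fixing [X] fixing
    [y]. Only existence matters, since the vectors are found by search. *)
Lemma column_space_approx n (S : 'M[Cx]_n) (d : rat) : 0 < d ->
  exists2 X : seq gvec, size X = \rank S & forall i, exists2 y : 'cV[Cx]_n,
    (forall P : 'M[Cx]_n, (forall x, x \in X -> P *m cv Cx n x = cv Cx n x) -> P *m y = y) &
    nrm2 (y - col i S) <= ratr d.
Proof.
move=> d0; set r := \rank S; pose L := col_base S; pose R := row_base S.
have [K HK] : exists K : nat, \sum_j \sum_i `|R j i| <= K%:R :> Cx.
  by apply: Cx_nat_bound; do 2 apply: sumr_ge0 => ? _.
have HKi i : \sum_j `|R j i| <= K%:R.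
  apply: le_trans HK; apply: ler_sum => j _.
  by rewrite (bigD1 i) //= lerDl sumr_ge0.
pose Q : rat := (n.+1 * K.+1 ^ 2)%:R.
have Q0 : 0 < Q by rewrite ltr0n muln_gt0 expn_gt0.
pose eta := d / (Q * (1 + d)).
have eta0 : 0 < eta by rewrite divr_gt0 // mulr_gt0 // addr_gt0.
have Hf (p : 'I_n * 'I_r) : exists w : gq, `|gz Cx w - L p.1 p.2| <= ratr eta by apply: gq_approx.
have [f Hf'] := choice Hf.
pose x (j : 'I_r) : gvec := [seq f (k, j) | k <- enum 'I_n].
have xE j k : cv Cx n (x j) k 0 = gz Cx (f (k, j)).
  by rewrite mxE /x (nth_map k) ?size_enum_ord // nth_ord_enum.
exists [seq x j | j <- enum 'I_r]; first by rewrite size_map size_enum_ord.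
move=> i; exists (\sum_j R j i *: cv Cx n (x j)).
  move=> P HP; rewrite mulmx_sumr; apply: eq_bigr => j _; rewrite -scalemxAr HP //.
  by rewrite map_f // mem_enum.
apply: le_trans (nrm2_le_entries (b := K%:R * ratr eta) _) _.
  move=> k; have ES : S = L *m R by rewrite mulmx_base.
  have -> : (\sum_j R j i *: cv Cx n (x j) - col i S) k 0 =
      \sum_j (R j i *: cv Cx n (x j)) k 0 - \sum_j L k j * R j i.
    by rewrite mxE summxE !mxE; congr (_ - _); rewrite [in LHS]ES mxE.
  rewrite -sumrB.
  apply: le_trans (ler_norm_sum _ _ _) _.
  apply: (@le_trans _ _ (\sum_j `|R j i| * ratr eta)); last by rewrite -mulr_suml ler_wpM2r ?ler0q // ltW.
  apply: ler_sum => j _; rewrite mxE xE [L k j * _]mulrC -mulrBr normrM ler_wpM2l //.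
rewrite -(ratr_nat Cx n) -(ratr_nat Cx K) -!(rmorphM, rmorphXn) /= ler_rat.
have h1 : n%:R * K%:R ^+ 2 <= Q.
  by rewrite -natrX -natrM ler_nat leq_mul // leq_sqr.
have h2 : eta <= 1.
  rewrite ler_pdivrMr ?mulr_gt0 ?addr_gt0 // mul1r.
  have : 1 <= Q by rewrite ler1n muln_gt0 expn_gt0.
  by move=> ?; nra.
have h3 : Q * eta <= d.
  rewrite /eta mulrCA invfM mulrA mulrA mulfK ?gt_eqF // ler_pdivrMr ?addr_gt0 //; nra.
rewrite exprMn mulrA; apply: le_trans h3.
apply: (@le_trans _ _ (Q * eta ^+ 2)); first by apply: ler_wpM2r h1; rewrite exprn_ge0 // ltW.
by rewrite ler_pM2l // expr2 ger_pMr.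
Qed.

Section UnitVectors.
Variable n : nat.
Notation N := (2 ^ n)%N.
Implicit Types u w : gvec.

Definition unitvec u : seq Cx :=
  [seq gz Cx (nth g0 u i) / sqrtC (ratr (gvnorm2 N u)) | i <- iota 0 N].

Lemma vc_unitvec u : vc N (unitvec u) = (sqrtC (ratr (gvnorm2 N u)))^-1 *: cv Cx N u.
Proof.
apply/matrixP => i j; rewrite !mxE (nth_map 0%N) ?size_iota // nth_iota // add0n.
by rewrite mulrC.
Qed.

Lemma inner_unitvec u w : inner n (unitvec u) (unitvec w) =
  (sqrtC (ratr (gvnorm2 N u)))^-1 * (sqrtC (ratr (gvnorm2 N w)))^-1 * (adj (cv Cx N u) *m cv Cx N w) 0 0.
Proof.
rewrite inner_vc !vc_unitvec hadjZ -scalemxAr -scalemxAl !mxE mulrCA -mulrA; congr (_ * (_ * _)).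
rewrite conj_Creal // rpredV; apply: ger0_real.
by rewrite sqrtC_ge0 ler0q (gvnorm2_ge0 Cx).
Qed.

Lemma inner_unitvec_self u : gvnorm2 N u != 0 -> inner n (unitvec u) (unitvec u) = 1.
Proof.
move=> nz; rewrite inner_unitvec -invfM -expr2 sqrtCK -/(nrm2 _) -gvnorm2E mulVf //.
by rewrite fmorph_eq0.
Qed.

Variable U : seq gvec.
Hypothesis oU : orthobasis Cx N U.

Lemma orthobasis_orth u w : u \in U -> w \in U -> u != w -> (adj (cv Cx N u) *m cv Cx N w) 0 0 = 0.
Proof.
have [_ _ _] := oU; elim: U => [//|a s IH] /= /andP[/allP al pw].
have sym x : x \in s -> (adj (cv Cx N x) *m cv Cx N a) 0 0 = 0.
  move=> /al /eqP h; rewrite -[cv Cx N a]hadjK -hadjM mxE [X in Num.conj X]mxE h.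
  exact: rmorph0.
rewrite !inE => /orP[/eqP->|us] /orP[/eqP->|ws]; rewrite ?eqxx // => ne.
- by apply/eqP/al.
- exact: sym.
- exact: IH.
Qed.

Lemma inner_unitvec_basis u w : u \in U -> w \in U ->
  inner n (unitvec u) (unitvec w) = (unitvec u == unitvec w)%:R.
Proof.
move=> uU wU; have [_ _ nz _] := oU; have [nzu _] := nz u uU.
have [->|ne] := eqVneq u w; first by rewrite eqxx inner_unitvec_self //; case: (nz w wU).
have E : inner n (unitvec u) (unitvec w) = 0 by rewrite inner_unitvec orthobasis_orth ?mulr0.
by rewrite E; case: eqP => // EE; move: E; rewrite -EE inner_unitvec_self.
Qed.

Lemma unitvec_uniq : uniq (map unitvec U).
Proof.
rewrite map_inj_in_uniq.
  have [_ _ nz pw] := oU; rewrite uniq_pairwise.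
  apply: (@sub_in_pairwise _ (mem U)) pw; last exact: allss.
  move=> u w uU wU /= /eqP h; apply/eqP => uw.
  have [nzu _] := nz u uU; move: h; rewrite -uw -/(nrm2 _) -gvnorm2E => /eqP.
  by rewrite fmorph_eq0 (negPf nzu).
move=> u w uU wU E; apply/eqP/negPn/negP => ne.
have := inner_unitvec_basis uU wU; rewrite inner_unitvec orthobasis_orth // mulr0 E eqxx => /eqP.
by rewrite eq_sym oner_eq0.
Qed.

Lemma unitvec_orthonormal : Defs.orthonormal n (map unitvec U).
Proof.
split; first by move=> _ /mapP[u _ ->]; rewrite size_map size_iota.
by move=> _ _ /mapP[u uU ->] /mapP[w wU ->]; apply: inner_unitvec_basis.
Qed.

Lemma unitvec_expval (rho : 'M[Cx]_N) : 
  \sum_(v <- map unitvec U) expval rho v = \tr (rho *m cproj Cx N U).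
Proof.
rewrite /cproj mulmx_sumr raddf_sum big_map /=; apply: eq_big_seq => u uU.
rewrite expval_qf vc_unitvec qfZ -scalemxAr mxtraceZ; congr (_ * _).
  by rewrite normfV exprVn -normrX sqrtCK ger0_norm // ?fmorphV // ler0q (gvnorm2_ge0 Cx).
by rewrite mulmxA mxtrace_mulC mulmxA [RHS]trace_mx11.
Qed.

Lemma unitvec_denote : set_denote
  (pickle [seq [seq mkalg (nth g0 u i) (gvnorm2 N u) | i <- iota 0 N] | u <- U]) (map unitvec U).
Proof.
exists [seq [seq mkalg (nth g0 u i) (gvnorm2 N u) | i <- iota 0 N] | u <- U], (map unitvec U).
split; first exact: pickleK.
split; first by rewrite !size_map.
split; last by rewrite undup_id // unitvec_uniq.
move=> k; rewrite size_map => ltk; rewrite !(nth_map [::]) //.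
set u := nth [::] U k; have uU : u \in U by apply: mem_nth.
split; first by rewrite !size_map.
move=> i; rewrite size_map size_iota => lti; rewrite !(nth_map 0%N) ?size_iota // nth_iota //.
apply: alg_denote_mkalg; have [_ _ nz _] := oU; have [nzu _] := nz u uU.
by rewrite lt_def nzu (gvnorm2_ge0 Cx).
Qed.

End UnitVectors.

Lemma blen_pred_bounds r : (0 < r)%N -> (2 ^ blen r.-1 <= r)%N /\ (r < 2 ^ (blen r.-1).+1)%N.
Proof.
move=> r0; have [s Es] := nat_of_bits_surj r.-1.
have := nat_of_bits_bounds s; rewrite Es prednK // => -[h1 h2].
by rewrite -Es blenE.
Qed.

Section Reverse.
Variables (dim : nat -> nat) (es : nat -> seq alg_code) (S : forall m, 'M[Cx]_(2 ^ dim m)) (e e0 : nat).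
Hypotheses (cdim : cpt dim) (ces : cpt (es : nat -> seq (seq rat * box))).
Hypothesis Sproj : forall m, hproj (S m).
Hypothesis Sden : forall m (i j : 'I_(2 ^ dim m)),
  alg_denote (nth alg_code0 (es m) (i * 2 ^ dim m + j)) (S m i j).

Notation N m := (2 ^ dim m)%N.

Definition rent m t k : gq := appr (nth (alg_code0 : seq rat * box) (es m) k) t.
Definition rtrace m : rat := \sum_(i <- iota 0 (N m)) (rent m (dim m + 2) (i * N m + i)).1.

Lemma rtrace_rank m : `|rtrace m - (\rank (S m))%:R| <= 1 / 4.
Proof.
have [_ SS] := Sproj m.
rewrite -(ler_rat Cx) ratr_norm rmorphB /= ratr_nat -idempotent_trace //.
have -> : \tr (S m) = \sum_i 'Re (S m i i).
  rewrite -raddf_sum /= -/(\tr (S m)) idempotent_trace //.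
  by apply/esym/Creal_ReP; rewrite realn.
rewrite /rtrace rmorph_sum /= -{1}(subn0 (N m)) -/(index_iota 0 (N m)) big_mkord -sumrB.
apply: le_trans (ler_norm_sum _ _ _) _.
apply: (@le_trans _ _ (\sum_(i < N m) ratr (2 ^+ (dim m + 2))^-1)).
  apply: ler_sum => i _; rewrite -Re_gz -raddfB /=; apply: le_trans (norm_Re_le _) _.
  exact: alg_denote_appr.
rewrite sumr_const card_ord -rmorphMn ler_rat /= -mulr_natl natrX exprD invfM.
by rewrite mulrA mulfV ?expf_neq0 // mul1r; lra.
Qed.

Lemma rank_exists m : exists r : nat, `|rtrace m - r%:R| <= 1 / 4.
Proof. by exists (\rank (S m)); apply: rtrace_rank. Qed.

Definition rrank m := ex_minn (rank_exists m).

Lemma rrankE m : rrank m = \rank (S m).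
Proof.
rewrite /rrank; case: ex_minnP => r h1 mn; have h2 := rtrace_rank m.
apply/eqP; rewrite eqn_leq mn //= leqNgt; apply/negP => lt.
have : (r%:R + 1 : rat) <= (\rank (S m))%:R by rewrite natr1 ler_nat.
by move: h1 h2; rewrite !ler_norml => /andP[a b] /andP[c d]; lra.
Qed.

(* Absorbs the factor 2 ^ N * N in [tr_density_hproj_le]. *)
Definition rdelta m : rat := (2 ^+ (N m + N m + e + 2))^-1.
Definition rcols m : seq gvec := [seq [seq rent m (N m + N m + e + 4) (k * N m + i) | k <- iota 0 (N m)]
  | i <- iota 0 (N m)].
Definition rgood m (X : seq gvec) := (size X <= rrank m)%N &&
  all (fun a => gvnorm2 (N m) (gresid (N m) (gram_schmidt (N m) 0 X) a) <= rdelta m) (rcols m).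
Definition rgoodcode m z := if (unpickle z : option (seq gvec)) is Some X then rgood m X else false.

Lemma nth_rcols m (i : 'I_(N m)) : 
  nrm2 (cv Cx (N m) (nth [::] (rcols m) i) - col i (S m)) <= ratr (rdelta m / 4).
Proof.
set a := nth _ _ _; set t := (N m + N m + e + 4)%N.
apply: le_trans (nrm2_le_entries (b := ratr (2 ^+ t)^-1) _) _.
  move=> k; rewrite !mxE /a (nth_map 0%N) ?size_iota // (nth_map 0%N) ?size_iota //.
  by rewrite !nth_iota // !add0n; apply: alg_denote_appr.
rewrite -(ratr_nat Cx (N m)) -rmorphXn -rmorphM ler_rat /=.
rewrite expr2 mulrA; apply: (@le_trans _ _ (1 * (2 ^+ t)^-1)).
  rewrite ler_wpM2r ?invr_ge0 ?exprn_ge0 // ler_pdivrMr ?exprn_gt0 // mul1r.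
  rewrite -natrX ler_nat /t -!addnA expnD; apply: (leq_trans (ltnW (ltn_expl (N m) (ltnSn 1)))).
  by rewrite leq_pmulr // expn_gt0.
rewrite mul1r /rdelta /t [(_ + 4)%N](_ : _ = N m + N m + e + 2 + 2)%N ?exprD ?invfM; last lia.
by lra.
Qed.

Lemma rgood_exists m : exists z, rgoodcode m z.
Proof.
have d4 : 0 < rdelta m / 4 by rewrite divr_gt0 // invr_gt0 exprn_gt0.
have [X szX HX] := column_space_approx (S m) d4.
exists (pickle X); rewrite /rgoodcode pickleK /rgood rrankE szX leqnn /=.
have oU := gram_schmidt_orthobasis Cx (N m) X (lexx 0); have [hP _ _ _] := oU.
apply/allP => a ha; have [i + <-] := elimT (nthP [::]) ha; rewrite size_map size_iota => lti.
rewrite -(ler_rat Cx) (gresid_dist2 Cx).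
have [y fixy closey] := HX (Ordinal lti).
set P := cproj _ _ _ in hP *.
have Py : P *m y = y.
  apply: fixy => x xX; apply/eqP; rewrite eq_sym -subr_eq0; apply/eqP.
  have : dist2 P (cv Cx (N m) x) = 0.
    apply/eqP; rewrite eq_le nrm2_ge0 andbT.
    by have := gram_schmidt_dist2 Cx (N m) (lexx 0) xX; rewrite rmorph0.
  rewrite /dist2 nrm2E => /psumr_eq0P h0.
  apply/matrixP => k l; rewrite ord1 [RHS]mxE; apply/eqP.
  have /eqP := h0 (fun i _ => exprn_ge0 2 (normr_ge0 _)) k isT.
  by rewrite expf_eq0 /= normr_eq0.
rewrite (dist2_sub_fixed _ Py); apply: (le_trans (dist2_le_nrm2 _ hP)).
have h := nth_rcols (Ordinal lti); rewrite /= in h.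
rewrite -(subrK (col (Ordinal lti) (S m)) (cv _ _ _)) -addrA.
apply: le_trans (nrm2D_le _ _) _.
have -> : ratr (rdelta m) = 2 * ratr (rdelta m / 4) + 2 * ratr (rdelta m / 4) :> Cx.
  by rewrite -(ratr_nat Cx 2) -!rmorphM -rmorphD; congr ratr; field.
by apply: lerD; rewrite ler_wpM2l // -nrm2N opprB.
Qed.

Definition rsel m : seq gvec :=
  if (unpickle (ex_minn (rgood_exists m)) : option (seq gvec)) is Some X then X else [::].
Definition rbasis m := gram_schmidt (N m) 0 (rsel m).

Lemma rsel_good m : rgood m (rsel m).
Proof.
rewrite /rsel; case: ex_minnP => z; rewrite /rgoodcode.
by case: (unpickle z).
Qed.

Lemma rbasis_ortho m : orthobasis Cx (N m) (rbasis m).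
Proof. exact: gram_schmidt_orthobasis. Qed.

Lemma size_rbasis m : (size (rbasis m) <= rrank m)%N.
Proof. by apply: leq_trans (gram_schmidt_size _ _ _) _; case/andP: (rsel_good m). Qed.

Lemma rbasis_catches m (rho : 'M[Cx]_(N m)) : psd rho -> \tr rho = 1 ->
  \tr (rho *m S m) <= 2 * \tr (rho *m cproj Cx (N m) (rbasis m)) + 2 * ratr (2 ^+ e)^-1.
Proof.
move=> rho0 tr1; have [aS SS] := Sproj m; have [hP _ _ _] := rbasis_ortho m.
set P := cproj _ _ _ in hP *.
have ES : S m = S m *m adj (S m) by rewrite aS SS.
have far j : dist2 P (col j (S m)) <= ratr (4 * rdelta m).
  rewrite -(subrK (cv Cx (N m) (nth [::] (rcols m) j)) (col j _)) addrC.
  apply: (le_trans (dist2D_le _ _ hP)).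
  have h1 : dist2 P (cv Cx (N m) (nth [::] (rcols m) j)) <= ratr (rdelta m).
    rewrite /P -gresid_dist2 ler_rat; have /andP[_ /allP] := rsel_good m; apply.
    by rewrite mem_nth // size_map size_iota.
  have h2 := nth_rcols j; rewrite -nrm2N opprB in h2.
  have -> : ratr (4 * rdelta m) = 2 * ratr (rdelta m) + 2 * ratr (rdelta m) :> Cx.
    by rewrite -(ratr_nat Cx 2) -!rmorphM -rmorphD; congr ratr; field.
  apply: lerD; rewrite ler_wpM2l //; apply: (le_trans h2); rewrite ler_rat.
  have : 0 < rdelta m by rewrite invr_gt0 exprn_gt0.
  by lra.
have hS : hproj (S m *m adj (S m)) by rewrite -ES.
have := tr_density_hproj_le rho0 tr1 hP hS far; rewrite -ES => le.
apply: (le_trans le); rewrite lerD2l ler_wpM2l //.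
rewrite -(ratr_nat Cx 2) -rmorphXn -(ratr_nat Cx (N m)) -!rmorphM /= ler_rat.
have hN : (N m)%:R <= 2 ^+ N m :> rat by rewrite -natrX ler_nat ltnW // ltn_expl.
rewrite /rdelta !exprD !invfM; set a := 2 ^+ N m in hN *; set d := (2 ^+ e)^-1.
have a0 : 0 < a by rewrite exprn_gt0.
have d0 : 0 <= d by rewrite invr_ge0 exprn_ge0.
have -> : a * ((N m)%:R * (4 * (a^-1 * a^-1 * d / 2 ^+ 2))) = ((N m)%:R / a) * d.
  by field; rewrite gt_eqF.
by rewrite ler_piMl // ler_pdivrMr // mul1r.
Qed.

Definition rcode m : seq (seq (seq rat * box)) :=
  [seq [seq mkalg (nth g0 u i) (gvnorm2 (N m) u) | i <- iota 0 (N m)] | u <- rbasis m].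

Lemma cpt_rrank : cpt rrank.
Proof.
have hr : cpt (fun p : nat * nat => rent p.1 (dim p.1 + 2) (p.2 * N p.1 + p.2)) by rewrite /rent; ct.
have h : cpt rtrace by rewrite /rtrace; ct.
by apply: (@cpt_ex_minn _ (fun m r => `|rtrace m - r%:R| <= 1 / 4)); ct.
Qed.

Lemma cpt_rbasis : cpt rbasis.
Proof.
have hr := cpt_rrank.
have hd : cpt rdelta by rewrite /rdelta; ct.
have hc : cpt rcols by rewrite /rcols /rent; ct.
have hu : cpt (unpickle : nat -> option (seq gvec)).
  by have h := dcpt_rat; apply: dcpt_seq; apply: dcpt_seq; apply: dcpt_pair.
have hg : cpt (fun p : nat * seq gvec => rgood p.1 p.2) by rewrite /rgood; ct.
have hs : cpt rsel.
  have hm : cpt (fun m => ex_minn (rgood_exists m)).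
    apply: (@cpt_ex_minn _ rgoodcode); rewrite /rgoodcode.
    apply: (@cpt_optmatch _ _ _ (fun p => unpickle p.2) (fun p X => rgood p.1 X) (fun=> false)); [|by ct|by ct].
    by apply: (cpt_comp hg (f := fun q => (q.1.1, q.2))); ct.
  apply: (@cpt_optmatch _ _ _ (fun m => unpickle (ex_minn (rgood_exists m)))
    (fun _ X => X) (fun=> [::])); ct.
by rewrite /rbasis; ct.
Qed.

Lemma cpt_rcode : cpt (fun m => pickle (rcode m)).
Proof.
have h := cpt_rbasis; apply: cpt_pickle; rewrite /rcode; ct.
by apply: cpt_mkalg; ct.
Qed.

End Reverse.

Lemma computable_proj_seq_data (dim : nat -> nat) (S : forall m, 'M[Cx]_(2 ^ dim m)) :
  computable_proj_seq S -> exists es : nat -> seq alg_code,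
    [/\ cpt dim, cpt (es : nat -> seq (seq rat * box)), (forall m, hproj (S m)) &
      forall m (i j : 'I_(2 ^ dim m)),
        alg_denote (nth alg_code0 (es m) (i * 2 ^ dim m + j)) (S m i j)].
Proof.
move=> [hS [c Hc]]; have [k Hk] := choice Hc.
pose dm m : nat * seq (seq rat * box) :=
  if (unpickle (k m) : option (nat * seq (seq rat * box))) is Some p then p else (0%N, [::]).
have hk : cpt k by exists c => m; have [h _] := Hk m.
have hdm : cpt dm.
  have hu : cpt (unpickle : nat -> option (nat * seq (seq rat * box))).
    have hr := dcpt_rat; apply: dcpt_pair; first exact: dcpt_nat.
    apply: dcpt_seq; apply: dcpt_pair; first exact: dcpt_seq.
    by do 3 apply: dcpt_pair => //.
  by rewrite /dm; ct.
have dmE m : (dm m).1 = dim m /\ forall i j : 'I_(2 ^ dim m),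
    alg_denote (nth alg_code0 (dm m).2 (i * 2 ^ dim m + j)) (S m i j).
  by have [_ [es [unp [_ h]]]] := Hk m; rewrite /dm unp.
exists (fun m => (dm m).2); split.
- by apply: (@cpt_ext _ _ (fun m => (dm m).1)); [move=> m; case: (dmE m)|ct].
- by ct.
- by move=> m; have [h1 h2] := hS m.
- by move=> m; case: (dmE m).
Qed.

Lemma log2_size_le s r : (0 < r)%N -> (s <= r)%N -> log2 s%:R <= (blen r.-1).+1%:R.
Proof.
move=> r0 le; have [_ lt] := blen_pred_bounds r0.
have l2 : 0 < ln 2 :> Rl by rewrite ln_gt0 // ltr1n.
rewrite /log2 ler_pdivrMr //; have [->|s0] := posnP s.
  by rewrite ln0 // mulr_ge0 // ltW.
rewrite mulr_natl -lnXn // ler_ln ?posrE ?ltr0n ?exprn_gt0 //.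
by rewrite -natrX ler_nat ltnW // (leq_ltn_trans le).
Qed.

Lemma QK_random (rho : forall n, 'M[Cx]_(2 ^ n)) : is_state rho ->
  (forall c, computable_measure_machine c -> forall eps : Rl, 0 < eps ->
   forall d : nat, exists n0, forall n, (n0 <= n)%N -> ((n + d)%:R%:E < QK c eps (rho n))%E) ->
  quantum_Schnorr_random rho.
Proof.
move=> [dens _] HQK dim S [[hS cv] comp] eps eps0 fails.
have [es [cdim ces Sproj Sden]] := computable_proj_seq_data hS.
have [e He] : exists e, 2 ^- e < eps / 4 :> Rl.
  have h0 : 0 < eps / 4 by rewrite divr_gt0.
  exists (Num.bound (eps / 4)^-1); rewrite invf_plt ?posrE ?exprn_gt0 //.
  by apply: lt_trans (lt_exp2 _); apply: Num.Theory.archi_boundP; rewrite invr_ge0 ltW.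
pose r := rrank Sproj Sden.
have rE m : r m = \rank (S m) by apply: rrankE.
have cr : cpt r by apply: cpt_rrank.
pose tau m : rat := (r m)%:R / 2 ^+ dim m.
have ctau : cpt tau by rewrite /tau; ct.
have tau0 m : 0 <= tau m by rewrite divr_ge0 ?exprn_ge0.
have tauE m : tauS (S m) = ratr (tau m).
  have [_ SS] := Sproj m.
  rewrite /tauS idempotent_trace // -rE Re_natr /tau fmorph_div /= ratr_nat rmorphXn /= ratr_nat.
  exact: mulrC.
have tauS0 m : 0 <= tauS (S m) by rewrite tauE ler0q.
have st := sums_to_series tauS0 cv.
set x := limn _ in comp st.
have x0 : 0 <= x by case: st => /(_ 0%N); rewrite big_geq.
pose e0 := Num.bound x.
have xe0 : x <= 2 ^+ e0.
  by apply/ltW; apply: lt_trans (lt_exp2 _); apply: Num.Theory.archi_boundP.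
pose act m := (0 < r m)%N.
pose l m := (dim m + e0 - blen (r m).-1)%N.
have cb : cpt (fun m => blen (r m).-1) by apply: cpt_blen; ct.
have cact : cpt act by rewrite /act; ct.
have cl : cpt l by rewrite /l; ct.
have ble m : act m -> (blen (r m).-1 <= dim m + e0)%N.
  move=> am; have [h _] := blen_pred_bounds am; apply: leq_trans (leq_addr _ _).
  rewrite -(leq_exp2l (m := 2)) //; apply: (leq_trans h).
  by rewrite rE rank_leq_row.
have kw m : 0 <= kweight act l m <= tau m / 2 ^+ e0.
  rewrite kweight_ge0 /kweight; case: ifP => [am|_] /=; last by rewrite divr_ge0 ?exprn_ge0.
  have [h _] := blen_pred_bounds am; have hb := ble m am.
  rewrite /tau -mulrA -invfM -exprD ler_pdivlMr ?exprn_gt0 //.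
  rewrite mulrC ler_pdivrMr ?exprn_gt0 //.
  rewrite -[(dim m + e0)%N](subnK hb) -/(l m) exprD mulrC ler_pM2r ?exprn_gt0 //.
  by rewrite -natrX ler_nat.
have kle1 m : kcumul act l m <= 1.
  rewrite -(ler_rat Rl) rmorph1 ratr_sum.
  rewrite (_ : iota 0 m = index_iota 0 m); last by rewrite /index_iota subn0.
  apply: (@le_trans _ _ (\sum_(0 <= i < m) tauS (S i) / 2 ^+ e0)).
    apply: ler_sum => i _; have /andP[_] := kw i; rewrite -(ler_rat Rl) tauE fmorph_div /=.
    by rewrite rmorphXn /= ratr_nat.
  rewrite -mulr_suml ler_pdivrMr ?exprn_gt0 // mul1r; apply: le_trans xe0.
  by case: st.
have ckw : cpt (kweight act l) by rewrite /kweight; ct.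
have stau : sums_to (fun m => ratr (tau m)) x.
  by rewrite (_ : (fun m => _) = (fun m => tauS (S m))) //; apply/funext => m; rewrite tauE.
have [y sy cy] : exists2 y, sums_to (fun m => ratr (kweight act l m)) y & computable_real y.
  apply: (@dominated_computable _ tau 1 x) => // m; have /andP[-> h] := kw m.
  apply: (le_trans h); rewrite mul1r ler_pdivrMr ?exprn_gt0 // ler_peMr //.
  by rewrite exprn_ege1 // ler1n.
have cout : cpt (fun m => pickle (rcode e Sproj Sden m)) by apply: cpt_rcode.
have [c cmm Hc] := kraft_machine cact cl cout kle1 sy cy.
have eps8 : 0 < eps / 8 by rewrite divr_gt0.
have [n0 Hn0] := HQK c cmm _ eps8 (e0 + 2)%N.
have [M HM] : exists M, forall m, (M <= m)%N -> act m -> (n0 <= dim m)%N.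
  have d0 : 0 < 2 ^- n0 :> Rl by rewrite invr_gt0 exprn_gt0.
  have [s1 s2] := stau; have [M HM] := s2 _ d0; exists M => m leM am.
  rewrite leqNgt; apply/negP => lt.
  have h1 := s1 m.+1; rewrite big_nat_recr //= in h1.
  have h2 : \sum_(0 <= i < M) ratr (tau i) <= \sum_(0 <= i < m) ratr (tau i) :> Rl.
    have t0 i : 0 <= ratr (tau i) :> Rl by rewrite ler0q.
    have := series_nondecreasing t0 leM; apply.
  have h3 : 2 ^- n0 <= ratr (tau m) :> Rl.
    rewrite -ratr_exp2V ler_rat /tau; apply: (@le_trans _ _ (2 ^+ dim m)^-1).
      by rewrite ler_expn2N // ltnW.
    by rewrite ler_peMl ?invr_ge0 ?exprn_ge0 // ler1n.
  move: HM; rewrite ltrBlDr ltNge => /negP; apply.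
  exact: le_trans (lerD h2 h3) h1.
have [m [leM lt]] := fails M.
have am : act m.
  rewrite /act lt0n; apply/eqP => r0; move: lt; rewrite /rhoS.
  have /eqP -> : S m == 0 by rewrite -mxrank_eq0 -rE r0.
  by rewrite mulmx0 mxtrace0 -[X in _ < X]/(0%:C)%C ltcR ltNge ltW.
have [pi szpi run] := Hc m am.
have lt1 := Hn0 _ (HM m leM am).
have oU := rbasis_ortho e Sproj Sden m.
have [psdr tr1] := density_psd (dens (dim m)).
have catch := rbasis_catches e Sproj Sden psdr tr1.
pose F := map (unitvec (dim m)) (rbasis e Sproj Sden m).
have szF : (size F <= r m)%N by rewrite size_map size_rbasis.
suff : (QK c (eps / 8) (rho (dim m)) <= ((size pi)%:R + log2 (size F)%:R)%:E)%E.
  move=> /(lt_le_trans lt1); rewrite lte_fin => lt2.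
  have h := log2_size_le am szF; have hb := ble m am.
  have : ((dim m + (e0 + 2))%:R : Rl) < ((l m).+1 + (blen (r m).-1).+1)%:R.
    by apply: (lt_le_trans lt2); rewrite szpi natrD lerD2l.
  have -> : ((l m).+1 + (blen (r m).-1).+1 = (dim m + e0).+2)%N.
    by rewrite -(subnK hb) addSn addnS.
  by rewrite ltr_nat addnA addn2 ltnn.
apply: ereal_inf_lbound; exists pi, (pickle (rcode e Sproj Sden m)), F; split => //.
- exact: unitvec_denote.
- exact: unitvec_orthonormal.
- rewrite unitvec_expval; apply: (real_gt_level eps0 He).
  exact: lt_le_trans lt catch.
Qed.

Theorem mainTheorem16 (rho : forall n : nat, 'M[Cx]_(2 ^ n)) :
  is_state rho ->
  (quantum_Schnorr_random rho <->
   forall c : prf, computable_measure_machine c ->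
   forall eps : Rl, 0 < eps ->
   forall d : nat, exists n0 : nat, forall n : nat, (n0 <= n)%N ->
     (((n + d)%:R : Rl)%:E < QK c eps (rho n))%E).
Proof.
move=> st; split; last exact: QK_random.
by move=> rand c cmm eps eps0 d; apply: random_QK.
Qed.
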